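(* Let $F$ be an algebraically closed field of characteristic $\neq 2$ and let $n\ge 2$. For every $\alpha\in F$, the bimodule $V(\alpha)$ is a unital irreducible Jordan bimodule over the Jordan superalgebra $Kan(n)$. Conversely, every unital irreducible Jordan bimodule over $Kan(n)$ is isomorphic, for some $\alpha\in F$, to $V(\alpha)$ or to its opposite bimodule $V(\alpha)^{\mathrm{op}}$.
   Context: **Jordan superalgebras and bimodules.** Over a field $F$ of characteristic $\ne 2$, a Jordan superalgebra is a $\mathbb{Z}_2$-graded algebra $J=J_0+J_1$ satisfying, for homogeneous elements, $xy=(-1)^{|x||y|}yx$ and $$((xy)z)t+(-1)^{|y||z|+|y||t|+|z||t|}((xt)z)y+(-1)^{|x||y|+|x||z|+|x||t|+|z||t|}((yt)z)x=(xy)(zt)+(-1)^{|y||z|}(xz)(yt)+(-1)^{|t|(|y|+|z|)}(xt)(yz).$$ A $\mathbb{Z}_2$-graded $J$-bimodule $V=V_0+V_1$ is a Jordan bimodule if the split null extension $J\oplus V$ (with $V\cdot V=0$) is a Jordan superalgebra. It is unital if $1\in J$ acts as the identity, and irreducible if it is nonzero and has no proper nonzero graded subbimodules. Left and right actions are related by $av=(-1)^{|a||v|}va$. Isomorphisms of bimodules are parity-preserving linear bijections commuting with the action. **The superalgebra $Kan(n)$.** Let $I_n=\{1,\dots,n\}$ and let $G_n$ be the Grassmann superalgebra on odd generators $e_1,\dots,e_n$ ($e_ie_j=-e_je_i$, $e_i^2=0$). Let $\partial/\partial e_j$ be the odd superderivation with $\partial e_i/\partial e_j=\delta_{ij}$,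 $\partial(uv)/\partial e_j=(\partial u/\partial e_j)v+(-1)^{|u|}u\,(\partial v/\partial e_j)$, and put $\{f,g\}=(-1)^{|f|}\sum_{i=1}^n\frac{\partial f}{\partial e_i}\frac{\partial g}{\partial e_i}$. Then $Kan(n)=G_n\oplus\overline{G_n}$, where $\overline{G_n}$ is a copy of $G_n$, with product, for homogeneous $f,g\in G_n$, $$f\bullet g=fg,\quad f\bullet\overline g=\overline{fg},\quad \overline f\bullet g=(-1)^{|g|}\overline{fg},\quad \overline f\bullet\overline g=(-1)^{|g|}\{f,g\},$$ and grading $Kan(n)_0=(G_n)_0+\overline{(G_n)_1}$, $Kan(n)_1=(G_n)_1+\overline{(G_n)_0}$. For an ordered subset $J=\{j_1,\dots,j_s\}\subseteq I_n$ put $e_J=e_{j_1}\cdots e_{j_s}$, $e_\emptyset=1$; the elements $e_J,\overline{e_J}$ span $Kan(n)$. **The bimodule $V(\alpha)$.** It has a basis consisting of elements $v(I)$ and $\overline{v(I)}$, one of each for every subset $I\subseteq I_n$ (written in increasing order); for other orderings one sets $v(\sigma(I))=\mathrm{sgn}(\sigma)v(I)$ and $\overline{v(\sigma(I))}=\mathrm{sgn}(\sigma)\overline{v(I)}$ for a permutation $\sigma$ of $I$. Put $v=v(\emptyset)$. Parities: $|v|\equiv n \pmod 2$, $|v(I)|\equiv|v|+|I|$, $|\overline{v(I)}|\equiv|v|+|I|+1 \pmod 2$. To describe the right action of $e_J,\overline{e_J}$, up to reordering (with signs) $I$ and $J$, write $J=\{j_1,\dots,j_{s_1},j_{s_1+1},\dots,j_{s_1+s_2}\}$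 and $I=\{i_1,\dots,i_{k-s_1},j_{s_1},\dots,j_1\}$, where $I\cap J=\{j_1,\dots,j_{s_1}\}$, and let $s=s_1+s_2=|J|$, $k=|I|$, with $I\setminus J=\{i_1,\dots,i_{k-s_1}\}$ in this order. Then: - $v(I)e_J=v(I\setminus J)$ if $s_2=0$, and $0$ otherwise; - $v(I)\overline{e_J}=\overline{v(I\setminus J)}$ if $s_2=0$, and $0$ otherwise; - $\overline{v(I)}e_J=(-1)^s\,\overline{v(I\setminus J)}$ if $s_2=0$, and $0$ otherwise; - $\overline{v(I)}\,\overline{e_J}=(-1)^{s-1}\alpha(s-1)v(I\setminus J)$ if $s_2=0$; $=(-1)^{s_1}v(\{i_1,\dots,i_{k-s_1},j_s\})$ if $s_2=1$; $=0$ if $s_2\ge2$. **Opposite bimodule.** For a superbimodule $V=V_0\oplus V_1$ over $A$, $V^{\mathrm{op}}$ has $V^{\mathrm{op}}_0=V_1$, $V^{\mathrm{op}}_1=V_0$, with action $a\cdot v=(-1)^{|a|}av$, $v\cdot a=va$. *)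

(* Defs.v *)
From HB Require Import structures.
From mathcomp Require Import all_boot all_order all_algebra.

Set Implicit Arguments.
Unset Strict Implicit.
Unset Printing Implicit Defensive.

Import GRing.Theory.
Local Open Scope ring_scope.

(** ** Superspaces, superalgebras, superbimodules

  Parities are booleans ([true] = odd), added with [(+)] and multiplied with
  [&&].  A Z_2-grading V = V_0 + V_1 is given by its two projections
  [pr false], [pr true]; the homogeneous component V_b is the set of fixed
  points of [pr b].  The records below only carry data; the axioms are the
  predicates that follow them. *)

Definition is_grading (F : fieldType) (V : lmodType F) (pr : bool -> V -> V) :=
  [/\ forall b, linear (pr b),
      forall b c v, pr b (pr c v) = if b == c then pr b v else 0
    & forall v, pr false v + pr true v = v].

Definition homog (F : fieldType) (V : lmodType F) (pr : bool -> V -> V)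
  (b : bool) (v : V) := pr b v = v.

Definition bilin (F : fieldType) (U V W : lmodType F) (f : U -> V -> W) :=
  (forall u, linear (f u)) /\ (forall v, linear (fun u => f u v)).

Record superalg (F : fieldType) := SuperAlg {
  sa_car :> lmodType F;
  sa_pr : bool -> sa_car -> sa_car;
  sa_mul : sa_car -> sa_car -> sa_car
}.

Definition is_superalg (F : fieldType) (A : superalg F) :=
  [/\ is_grading (@sa_pr F A), bilin (@sa_mul F A)
    & forall i j (x y : A), homog (@sa_pr F A) i x -> homog (@sa_pr F A) j y ->
        homog (@sa_pr F A) (i (+) j) (sa_mul x y)].

Definition is_jordan_superalg (F : fieldType) (A : superalg F) :=
  let m := @sa_mul F A in
  let hom := homog (@sa_pr F A) in
  [/\ is_superalg A,
      forall (i j : bool) (x y : A), hom i x -> hom j y ->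
        m x y = (-1) ^+ (i && j) *: m y x
    & forall (i j k l : bool) (x y z t : A),
        hom i x -> hom j y -> hom k z -> hom l t ->
        m (m (m x y) z) t
        + (-1) ^+ ((j && k) + (j && l) + (k && l))%N *: m (m (m x t) z) y
        + (-1) ^+ ((i && j) + (i && k) + (i && l) + (k && l))%N
            *: m (m (m y t) z) x
        = m (m x y) (m z t)
        + (-1) ^+ (j && k) *: m (m x z) (m y t)
        + (-1) ^+ (l && (j (+) k)) *: m (m x t) (m y z)].

Record superbimod (F : fieldType) (A : superalg F) := SuperBimod {
  bm_car :> lmodType F;
  bm_pr : bool -> bm_car -> bm_car;
  bm_l : A -> bm_car -> bm_car;
  bm_r : bm_car -> A -> bm_car
}.

Section Bimodules.
Variables (F : fieldType) (A : superalg F).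

Definition is_superbimod (V : superbimod A) :=
  [/\ is_grading (@bm_pr F A V), bilin (@bm_l F A V), bilin (@bm_r F A V),
      forall i j (a : A) (v : V),
        homog (@sa_pr F A) i a -> homog (@bm_pr F A V) j v ->
        homog (@bm_pr F A V) (i (+) j) (bm_l a v)
    & forall i j (a : A) (v : V),
        homog (@sa_pr F A) i a -> homog (@bm_pr F A V) j v ->
        homog (@bm_pr F A V) (i (+) j) (bm_r v a)].

Definition split_null_ext (V : superbimod A) : superalg F :=
  @SuperAlg F (A * V)%type
    (fun b x => (sa_pr b x.1, bm_pr b x.2))
    (fun x y => (sa_mul x.1 y.1, bm_l x.1 y.2 + bm_r x.2 y.1)).

Definition jordan_bimod (V : superbimod A) :=
  is_superbimod V /\ is_jordan_superalg (split_null_ext V).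

Definition unital_bimod (V : superbimod A) :=
  exists2 e : A, (forall a : A, sa_mul e a = a /\ sa_mul a e = a)
    & (forall v : V, bm_l e v = v /\ bm_r v e = v).

Definition graded_subbimod (V : superbimod A) (W : V -> Prop) :=
  [/\ W 0,
      forall (c : F) u v, W u -> W v -> W (c *: u + v),
      forall b v, W v -> W (bm_pr b v)
    & forall (a : A) v, W v -> W (bm_l a v) /\ W (bm_r v a)].

Definition irreducible_bimod (V : superbimod A) :=
  (exists v : V, v <> 0) /\
  (forall W : V -> Prop, graded_subbimod W ->
     (forall v, W v -> v = 0) \/ (forall v, W v)).

Definition bimod_iso (V W : superbimod A) :=
  exists f : {linear V -> W},
    [/\ bijective f,
        forall b v, f (bm_pr b v) = bm_pr b (f v),
        forall (a : A) v, f (bm_l a v) = bm_l a (f v)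
      & forall (a : A) v, f (bm_r v a) = bm_r (f v) a].

(* The left action a . v = (-1)^|a| a v, extended linearly in a. *)
Definition op_bimod (V : superbimod A) : superbimod A :=
  @SuperBimod F A V
    (fun b => bm_pr (~~ b))
    (fun a v => bm_l (sa_pr false a) v - bm_l (sa_pr true a) v)
    (fun v a => bm_r v a).

End Bimodules.

(** ** The Grassmann superalgebra

  [f : grass F n] stands for the sum of the [f J *: e_J], where e_J is the
  product of the e_j, j in J, taken in increasing order (the order of
  [enum J]). *)

Notation grass F n := {ffun {set 'I_n} -> F^o}.

(* The number of inversions of a word; for a word without repetitions its
   parity is that of the permutation that sorts the word. *)
Fixpoint inversions (n : nat) (w : seq 'I_n) : nat :=
  if w is i :: w' then (count (fun j : 'I_n => (j < i)%N) w' + inversions w')%N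
  else 0%N.

Section Grassmann.
Variables (F : fieldType) (n : nat).
Implicit Types (I J : {set 'I_n}) (w : seq 'I_n).

Definition sgn_word w : F := (-1) ^+ inversions w.

Definition gbas J : grass F n := [ffun K => (K == J)%:R].

(* The product e_{w_1} e_{w_2} ... of the generators along the word w. *)
Definition gword w : grass F n :=
  if uniq w then sgn_word w *: gbas [set i in w] else 0.

Definition gmul (f g : grass F n) : grass F n :=
  \sum_I \sum_J (f I * g J : F) *: gword (enum I ++ enum J).

(* The value at e_J comes from e_J = +- e_j e_{J \ j} when j is in J. *)
Definition gder (j : 'I_n) (f : grass F n) : grass F n :=
  \sum_(J : {set 'I_n} | j \in J) (f J * sgn_word (j :: enum (J :\ j)) : F) *: gbas (J :\ j).

(* f |-> (-1)^|f| f, extended linearly. *)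
Definition gpar (f : grass F n) : grass F n :=
  [ffun J : {set 'I_n} => (-1) ^+ #|J| * f J].

Definition gbracket (f g : grass F n) : grass F n :=
  \sum_(i < n) gmul (gder i (gpar f)) (gder i g).

End Grassmann.

(** ** Kan(n): the pair [(f, g)] stands for f + \bar g *)

Definition kan_pr (F : fieldType) (n : nat) (b : bool)
    (x : grass F n * grass F n) : grass F n * grass F n :=
  ([ffun J : {set 'I_n} => if odd #|J| == b then x.1 J else 0],
   [ffun J : {set 'I_n} => if ~~ odd #|J| == b then x.2 J else 0]).

Definition kan_mul (F : fieldType) (n : nat)
    (x y : grass F n * grass F n) : grass F n * grass F n :=
  (gmul x.1 y.1 + gbracket x.2 (gpar y.2),
   gmul x.1 y.2 + gmul x.2 (gpar y.1)).

Definition Kan (F : fieldType) (n : nat) : superalg F :=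
  @SuperAlg F (grass F n * grass F n)%type (@kan_pr F n) (@kan_mul F n).

(** ** The bimodule V(alpha)

  Basis vectors of Kan(n) and of V(alpha) are indexed by pairs [(c, I)], where
  [c] tells whether there is a bar: [(false, I)] for e_I or v(I), [(true, I)]
  for \bar{e_I} or \bar{v(I)}.  As for Kan(n), a vector of V(alpha) is the pair
  of its families of coordinates on the v(I) and on the \bar{v(I)}. *)

Section Valpha.
Variables (F : fieldType) (n : nat) (alpha : F).
Implicit Types (I J : {set 'I_n}) (w : seq 'I_n) (c d : bool).

Local Notation space := (grass F n * grass F n)%type.

Definition coord c I (x : space) : F := if c then x.2 I else x.1 I.

Definition kan_parity c I : bool := c (+) odd #|I|.
Definition V_parity c I : bool := odd n (+) odd #|I| (+) c.

(* v(w), or \bar{v(w)}, for an arbitrary ordering w of a set of indices. *)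
Definition vword c w : space :=
  let u := sgn_word F w *: gbas F [set i in w] in if c then (0, u) else (u, 0).

(* The right action of e_J or \bar{e_J} (according to d) on v(I) or \bar{v(I)}
   (according to c).  With J0 = I n J, one reads the defining formulas for the
   orderings J0, J \ I of J and I \ J, J0 reversed of I; [sg] is the sign of
   these two reorderings.  The result does not depend on the orders chosen on
   J0, I \ J and J \ I. *)
Definition V_table c I d J : space :=
  let wIJ := enum (I :\: J) in
  let wJI := enum (J :\: I) in
  let w0 := enum (I :&: J) in
  let sg : F := sgn_word F (wIJ ++ rev w0) * sgn_word F (w0 ++ wJI) in
  let s := #|J| in
  let s1 := #|I :&: J| in
  let s2 := #|J :\: I| in
  sg *: match c, d with
  | false, false => if s2 == 0%N then vword false wIJ else 0
  | false, true => if s2 == 0%N then vword true wIJ else 0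
  | true, false => if s2 == 0%N then (-1) ^+ s *: vword true wIJ else 0
  | true, true =>
      (* (-1)^(s-1) is written (-1)^(s+1), as s may be 0 *)
      if s2 == 0%N then ((-1) ^+ s.+1 * alpha * (s%:R - 1)) *: vword false wIJ
      else if s2 == 1%N then (-1) ^+ s1 *: vword false (wIJ ++ wJI)
      else 0
  end.

Definition V_pr (b : bool) (x : space) : space :=
  ([ffun I : {set 'I_n} => if V_parity false I == b then x.1 I else 0],
   [ffun I : {set 'I_n} => if V_parity true I == b then x.2 I else 0]).

Definition V_r (x a : space) : space :=
  \sum_c \sum_I \sum_d \sum_J (coord c I x * coord d J a) *: V_table c I d J.

Definition V_l (a x : space) : space :=
  \sum_c \sum_I \sum_d \sum_J
    ((-1) ^+ (kan_parity d J && V_parity c I) * coord c I x * coord d J a)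
      *: V_table c I d J.

Definition Valpha : superbimod (Kan F n) :=
  @SuperBimod F (Kan F n) space V_pr V_l V_r.

End Valpha.

(* Main.v *)
Require Import Defs.
From HB Require Import structures.
From mathcomp Require Import all_boot all_order all_algebra.
From mathcomp Require Import ring zify.
From Stdlib Require Classical_Prop.

Set Implicit Arguments.
Unset Strict Implicit.
Unset Printing Implicit Defensive.

Import GRing.Theory.
Local Open Scope ring_scope.

(** Both halves of the theorem rest on a model of V(alpha) in which the Grassmann
    algebra G_n acts by multiplication. The vectors v(I_n) e_J are, up to sign, the
    v(I) for I the complement of J; reading V(alpha) in this basis turns it into the
    regular bimodule of Kan(n) whose product of two barred elements is changed by a
    multiple of alpha ([Kalpha]; the isomorphism is [kstar], by [V_table_star]).

    This bimodule is Jordan because its null extension is a piece of a Kantor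
    double. Add letters to G_n: one for each odd factor of an identity, to make it
    even, and two more whose product, which is even and has square zero, marks the
    elements of the bimodule. On the even part of the larger Grassmann algebra, the
    Poisson bracket is deformed into a bracket of contact type by the derivation
    that has weight alpha on a marking letter. The Jordan identity of its Kantor
    double is a polynomial identity in a commutative ring ([kantor_jordan]), and
    coming back to G_n restores all the signs ([el_jordan]). The model is
    irreducible since products and derivatives lead from any nonzero vector to 1
    ([Kalpha_irreducible]).

    Conversely, let V be unital and irreducible, and let X_i, Y_i and D be the right
    multiplications by e_i, \bar e_i and \bar 1. The Jordan identity has two
    consequences: supercommutators of right multiplications are superderivations
    over those of Kan(n) ([inner_derivation]), and the action is determined by a
    few generators ([identity1], [kan_generated]). Thus Q = [Y_i, X_i] removes bars,
    and [D, Y_i] acts as a partial derivative. A nilpotent operator that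
    supercommutes with the action is zero, by irreducibility. This kills one
    obstruction after the other: Q does not depend on i, the X_i anticommute with
    each other and with D, their squares vanish, and e_i e_j acts as X_i X_j, so
    that G_n acts associatively ([opQ_eq], [XX0], [eta_eq0], [r_kG_mul]).

    Since Q^2 = 0, the kernel of Q is not zero. There, the X_i and the operators
    C_i : v |-> v D Y_i satisfy the canonical anticommutation relations, so that some
    homogeneous m in the kernel is annihilated by all the C_i ([vacuum]). The central
    operator D^2 is a scalar alpha: V is finitely generated over the polynomials in
    D^2, and the field is algebraically closed ([T_scalar]). Then
    f + \bar g |-> m f + (m g) D commutes with the right action; it is bijective, as
    the model and V are irreducible. According to the parity of m, it identifies V
    with V(alpha) or with its opposite. *)

(** * Signed sums in an abelian group *)

Inductive zexp := ZAtom of nat | ZAdd of zexp & zexp | ZOpp of zexp | ZZero.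

Fixpoint zeval (V : zmodType) (env : seq V) (e : zexp) : V :=
  match e with
  | ZAtom i => nth 0 env i
  | ZAdd a b => zeval env a + zeval env b
  | ZOpp a => - zeval env a
  | ZZero => 0
  end.

Fixpoint zsplit (e : zexp) : seq nat * seq nat :=
  match e with
  | ZAtom i => ([:: i], [::])
  | ZAdd a b => ((zsplit a).1 ++ (zsplit b).1, (zsplit a).2 ++ (zsplit b).2)
  | ZOpp a => ((zsplit a).2, (zsplit a).1)
  | ZZero => ([::], [::])
  end.

(** Cancellation is tested by moving every negative term to the other side. *)
Definition zequal a b :=
  perm_eq ((zsplit a).1 ++ (zsplit b).2) ((zsplit b).1 ++ (zsplit a).2).

Lemma zevalE (V : zmodType) (env : seq V) e : zeval env e =
  \sum_(i <- (zsplit e).1) nth 0 env i - \sum_(i <- (zsplit e).2) nth 0 env i.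
Proof.
elim: e => [i|a IHa b IHb|a IHa|] /=.
- by rewrite big_seq1 big_nil subr0.
- by rewrite IHa IHb !big_cat opprD addrACA.
- by rewrite IHa opprB.
by rewrite !big_nil subr0.
Qed.

Lemma zequalP (V : zmodType) (env : seq V) a b :
  zequal a b -> zeval env a = zeval env b.
Proof.
move=> ab; rewrite !zevalE; apply/eqP.
by rewrite subr_eq addrAC eq_sym subr_eq -!big_cat /= eq_sym (perm_big _ ab).
Qed.

(* Terms are compared up to the instances of the algebraic structures, which
   differ according to the way they were inferred. *)
Ltac zsame x y :=
  lazymatch x with
  | y => constr:(true)
  | (?a *: ?u)%R => lazymatch y with (?b *: ?v)%R => zsame2 a u b v | _ => constr:(false) end
  | (?a * ?u)%R => lazymatch y with (?b * ?v)%R => zsame2 a u b v | _ => constr:(false) end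
  | (?a + ?u)%R => lazymatch y with (?b + ?v)%R => zsame2 a u b v | _ => constr:(false) end
  | (- ?a)%R => lazymatch y with (- ?b)%R => zsame a b | _ => constr:(false) end
  | 1%R => lazymatch y with 1%R => constr:(true) | _ => constr:(false) end
  | 0%R => lazymatch y with 0%R => constr:(true) | _ => constr:(false) end
  | ?f ?a => lazymatch y with ?g ?b => zsame2 f a g b | _ => constr:(false) end
  | _ => constr:(false)
  end
with zsame2 a u b v :=
  let r := zsame a b in
  lazymatch r with true => zsame u v | false => constr:(false) end.

Ltac zfind x l :=
  lazymatch l with
  | ?y :: ?t =>
    let r := zsame x y in
    lazymatch r with
    | true => constr:(Some 0%N)
    | false => let s := zfind x t in
      lazymatch s with Some ?k => constr:(Some (S k)) | None => constr:(@None nat) end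
    end
  | _ => constr:(@None nat)
  end.

Ltac zsnoc l x :=
  lazymatch l with
  | ?y :: ?t => let r := zsnoc t x in constr:(y :: r)
  | _ => constr:([:: x])
  end.

Ltac zlen l := lazymatch l with _ :: ?t => let r := zlen t in constr:(S r) | _ => constr:(0%N) end.

Ltac zquote l t k :=
  lazymatch t with
  | (?a + ?b)%R => zquote l a ltac:(fun l1 ea => zquote l1 b ltac:(fun l2 eb => k l2 constr:(ZAdd ea eb)))
  | (- ?a)%R => zquote l a ltac:(fun l1 ea => k l1 constr:(ZOpp ea))
  | 0%R => k l constr:(ZZero)
  | _ => let r := zfind t l in lazymatch r with
         | Some ?i => k l constr:(ZAtom i)
         | None => let i := zlen l in let l' := zsnoc l t in k l' constr:(ZAtom i)
         end
  end.

(** Identities between signed sums in a module: unlike [ring], the terms are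
    opaque, and only their order and their cancellation matter. *)
Ltac zmod :=
  rewrite ?mulr2n;
  lazymatch goal with
  | |- @eq ?T ?a ?b =>
    zquote (@nil T) a ltac:(fun l ea => zquote l b ltac:(fun l' eb =>
      refine (@zequalP _ l' ea eb _); vm_compute; reflexivity))
  end.

(** * Linear maps given by a predicate *)

Section UnbundledLinear.
Variables (F : fieldType) (U V : lmodType F) (f : U -> V).
Hypothesis f_lin : linear f.

Lemma linD u v : f (u + v) = f u + f v.
Proof. by have := f_lin 1 u v; rewrite !scale1r. Qed.

Lemma lin0 : f 0 = 0.
Proof. by apply: (addrI (f 0)); rewrite -linD !addr0. Qed.

Lemma linZ a u : f (a *: u) = a *: f u.
Proof. by have := f_lin a u 0; rewrite lin0 !addr0. Qed.

Lemma linN u : f (- u) = - f u.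
Proof. by rewrite -scaleN1r linZ scaleN1r. Qed.

Lemma linB u v : f (u - v) = f u - f v.
Proof. by rewrite linD linN. Qed.

Lemma lin_sum (T : Type) (r : seq T) (P : pred T) (G : T -> U) :
  f (\sum_(x <- r | P x) G x) = \sum_(x <- r | P x) f (G x).
Proof. by apply: big_morph; [exact: linD | exact: lin0]. Qed.

End UnbundledLinear.

(** * Words and signs *)

Section Words.
Variable n : nat.
Implicit Types (u w : seq 'I_n) (i j : 'I_n).

(** The inversions between two words; their parity is the sign for moving one
    word across the other. *)
Definition crossings u w := (\sum_(i <- u) count (fun j : 'I_n => (j < i)%N) w)%N.

Lemma inversions_cat u w :
  inversions (u ++ w) = (inversions u + inversions w + crossings u w)%N.
Proof.
elim: u => [|i u IH] /=; first by rewrite /crossings big_nil addn0.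
rewrite IH /crossings big_cons count_cat.
by rewrite addnACA addnA [X in (_ = X + _)%N]addnAC -!addnA; congr addn; rewrite addnCA.
Qed.

Lemma perm_crossings u u' w w' :
  perm_eq u u' -> perm_eq w w' -> crossings u w = crossings u' w'.
Proof.
move=> pu pw; rewrite /crossings (perm_big _ pu) /=.
by apply: eq_bigr => i _; apply/permP.
Qed.

Lemma crossings_swap u w : uniq (u ++ w) ->
  (crossings u w + crossings w u = size u * size w)%N.
Proof.
elim: u => [|i u IH] /=.
  by rewrite /crossings big_nil big1_seq // => j _.
rewrite mem_cat negb_or -andbA => /and3P[_ iw /IH] {}IH.
rewrite mulSn -IH /crossings big_cons.
have -> : (\sum_(j <- w) count (fun k : 'I_n => (k < j)%N) (i :: u) =
   count (fun j : 'I_n => (i < j)%N) w +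
   \sum_(j <- w) count (fun k : 'I_n => (k < j)%N) u)%N.
  rewrite /= big_split /=; congr addn.
  by rewrite -sum1_count [RHS]big_mkcond /=; apply: eq_bigr => j _; case: ifP.
rewrite -(count_predC (fun j : 'I_n => (j < i)%N) w).
have -> : count (predC (fun j : 'I_n => (j < i)%N)) w =
          count (fun j : 'I_n => (i < j)%N) w.
  apply: eq_in_count => j jw /=; rewrite -leqNgt leq_eqVlt.
  by case: eqP => // /val_inj ij; rewrite ij jw in iw.
lia.
Qed.

Lemma inversions_enum (J : {set 'I_n}) : inversions (enum J) = 0%N.
Proof.
have : sorted (fun i j : 'I_n => (i < j)%N) (enum J).
  have -> : enum J = filter (mem J) (enum 'I_n) by rewrite enumT.
  apply: sorted_filter; first by move=> ? ? ?; apply: ltn_trans.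
  by have := iota_ltn_sorted 0 n; rewrite -val_enum_ord sorted_map.
elim: (enum J) => //= i w IH pw.
rewrite IH ?(path_sorted pw) // addn0; apply/eqP; rewrite -leqn0 leqNgt -has_count.
apply/hasP => -[j jw]; rewrite ltnNge => /negP[]; apply: ltnW.
move: pw; rewrite (path_sortedE (fun _ _ _ => @ltn_trans _ _ _)).
by case/andP => /allP /(_ j jw).
Qed.

End Words.

(** * The Grassmann algebra as a ring *)

Section GrassmannRing.
Variables (F : fieldType) (n : nat).
Implicit Types (I J : {set 'I_n}) (u w : seq 'I_n) (i j : 'I_n).
Implicit Types (f g h : grass F n).

Local Notation gw := (gword F).

Lemma sgn_cat u w : sgn_word F (u ++ w) =
  sgn_word F u * sgn_word F w * (-1) ^+ crossings u w.
Proof. by rewrite /sgn_word inversions_cat !exprD. Qed.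

Lemma sgn_sqr u : sgn_word F u * sgn_word F u = 1.
Proof. by rewrite /sgn_word -exprMn mulrNN mul1r expr1n. Qed.

Lemma sgn_neq0 u : sgn_word F u != 0.
Proof. by rewrite /sgn_word signr_eq0. Qed.

Lemma sgn_enum J : sgn_word F (enum J) = 1.
Proof. by rewrite /sgn_word inversions_enum. Qed.

Lemma gword_enum J : gw (enum J) = gbas F J.
Proof. by rewrite /gword enum_uniq sgn_enum scale1r set_enum. Qed.

Lemma gword_perm u w : perm_eq u w ->
  gw u = (sgn_word F u * sgn_word F w) *: gw w.
Proof.
move=> puw; rewrite /gword (perm_uniq puw); case: ifP => _; last by rewrite scaler0.
rewrite scalerA -mulrA sgn_sqr mulr1; congr (_ *: gbas _ _).
by apply/setP => i; rewrite !inE (perm_mem puw).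
Qed.

Lemma gbasP f : f = \sum_J f J *: gbas F J.
Proof.
apply/ffunP => K; rewrite sum_ffunE (bigD1 K) //= !ffunE eqxx big1 ?addr0.
  by rewrite /GRing.scale /= mulr1.
by move=> J neJ; rewrite !ffunE eq_sym (negbTE neJ) scaler0.
Qed.

Lemma gmul_linear f : linear (gmul f).
Proof.
move=> a g h; rewrite /gmul scaler_sumr -big_split; apply: eq_bigr => I _ /=.
rewrite scaler_sumr -big_split; apply: eq_bigr => J _ /=.
rewrite scalerA -scalerDl; congr (_ *: _); rewrite !ffunE mulrDr mulrCA; ring.
Qed.

Lemma gmul_linearl g : linear (fun f : grass F n => gmul f g).
Proof.
move=> a f h; rewrite /gmul scaler_sumr -big_split; apply: eq_bigr => I _ /=.
rewrite scaler_sumr -big_split; apply: eq_bigr => J _ /=.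
rewrite scalerA -scalerDl; congr (_ *: _); rewrite !ffunE mulrDl.
by rewrite mulrA.
Qed.

Lemma gbas_ind (P : grass F n -> Prop) :
  P 0 -> (forall a f g, P f -> P g -> P (a *: f + g)) ->
  (forall J, P (gbas F J)) -> forall f, P f.
Proof.
move=> P0 PD PJ f; rewrite (gbasP f); elim/big_rec: _ => // J g _ Pg.
exact: PD.
Qed.

Lemma gmul_gbas I J : gmul (gbas F I) (gbas F J) = gw (enum I ++ enum J).
Proof.
rewrite /gmul (bigD1 I) //= (bigD1 J) //= !ffunE !eqxx mulr1 scale1r.
rewrite big1 => [|K neK]; last by rewrite !ffunE (negbTE neK) mulr0 scale0r.
rewrite addr0 big1 ?addr0 // => L neL; rewrite big1 // => K _.
by rewrite !ffunE (negbTE neL) mul0r scale0r.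
Qed.

(** A word is, up to sign, a basis element, and the signs are compatible with
    concatenation; associativity of the product is then that of words. *)
Lemma gmul_gword u w : gmul (gw u) (gw w) = gw (u ++ w).
Proof.
case: (boolP (uniq u)) => Uu; last first.
  rewrite /gword cat_uniq (negbTE Uu) /=.
  exact: lin0 (gmul_linearl _).
case: (boolP (uniq w)) => Uw; last first.
  rewrite /gword cat_uniq (negbTE Uw) !andbF.
  exact: lin0 (gmul_linear _).
have pe (v : seq 'I_n) : uniq v -> perm_eq v (enum [set i in v]).
  move=> Uv; apply: uniq_perm => //; first exact: enum_uniq.
  by move=> i; rewrite mem_enum inE.
rewrite [in LHS]/gword Uu Uw (linZ (gmul_linearl _)) (linZ (gmul_linear _)) scalerA gmul_gbas.
have puw := perm_cat (pe u Uu) (pe w Uw).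
rewrite (gword_perm puw) !sgn_cat !sgn_enum !mul1r -(perm_crossings (pe u Uu) (pe w Uw)).
by rewrite -mulrA -expr2 sqrr_sign mulr1.
Qed.

Lemma gmulA : associative (@gmul F n).
Proof.
move=> f g h; elim/gbas_ind: f => [|a f1 f2 IH1 IH2|I].
- by rewrite !(lin0 (gmul_linearl _)).
- by rewrite !gmul_linearl IH1 IH2.
elim/gbas_ind: g => [|a f1 f2 IH1 IH2|J].
- by rewrite (lin0 (gmul_linearl _)) !(lin0 (gmul_linear _)) (lin0 (gmul_linearl _)).
- by rewrite gmul_linearl !gmul_linear gmul_linearl IH1 IH2.
elim/gbas_ind: h => [|a f1 f2 IH1 IH2|K].
- by rewrite !(lin0 (gmul_linear _)).
- by rewrite !gmul_linear IH1 IH2.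
by rewrite -!gword_enum !gmul_gword catA.
Qed.

Lemma gword_nil : gw ([::] : seq 'I_n) = gbas F set0.
Proof. by rewrite -gword_enum enum_set0. Qed.

Lemma gmul1l : left_id (gbas F set0) (@gmul F n).
Proof.
move=> f; elim/gbas_ind: f => [|a f1 f2 IH1 IH2|I].
- by rewrite (lin0 (gmul_linear _)).
- by rewrite gmul_linear IH1 IH2.
by rewrite -gword_nil -gword_enum gmul_gword.
Qed.

Lemma gmul1r : right_id (gbas F set0) (@gmul F n).
Proof.
move=> f; elim/gbas_ind: f => [|a f1 f2 IH1 IH2|I].
- by rewrite (lin0 (gmul_linearl _)).
- by rewrite gmul_linearl IH1 IH2.
by rewrite -gword_nil -gword_enum gmul_gword cats0.
Qed.

Lemma gmulDl : left_distributive (@gmul F n) +%R.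
Proof. by move=> f g h; exact: linD (gmul_linearl h) _ _. Qed.

Lemma gmulDr : right_distributive (@gmul F n) +%R.
Proof. by move=> f g h; exact: linD (gmul_linear f) _ _. Qed.

Lemma gbas0_neq0 : gbas F (set0 : {set 'I_n}) != 0.
Proof.
apply/eqP => /ffunP /(_ set0); rewrite !ffunE eqxx => /eqP.
by rewrite oner_eq0.
Qed.

End GrassmannRing.

(** The finite functions already carry a pointwise product; the Grassmann
    product is put on a copy of the type. *)
Definition gring (F : fieldType) (n : nat) : Type := grass F n.
HB.instance Definition _ (F : fieldType) n := GRing.Lmodule.copy (gring F n) (grass F n).
HB.instance Definition _ (F : fieldType) n :=
  GRing.Zmodule_isNzRing.Build (gring F n) (@gmulA F n) (@gmul1l F n) (@gmul1r F n)
    (@gmulDl F n) (@gmulDr F n) (@gbas0_neq0 F n).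
HB.instance Definition _ (F : fieldType) n :=
  GRing.Lmodule_isLalgebra.Build F (gring F n)
    (fun a f g => esym (linZ (@gmul_linearl F n g) a f)).
HB.instance Definition _ (F : fieldType) n :=
  GRing.Lalgebra_isAlgebra.Build F (gring F n)
    (fun a f g => esym (linZ (@gmul_linear F n f) a g)).

(** * Parity and derivations of the Grassmann algebra *)

Section Superderivations.
Variables (F : fieldType) (n : nat).
Local Notation G := (gring F n).
Implicit Types (I J : {set 'I_n}) (u w : seq 'I_n) (i j k : 'I_n).
Implicit Types (f g h : G) (p q : bool).

Definition gen i : G := gbas F [set i].

Lemma gword1 i : gword F [:: i] = gen i.
Proof. by rewrite -[[:: i]](enum_set1 i) gword_enum. Qed.

Lemma gwordM u w : (gword F u : G) * gword F w = gword F (u ++ w).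
Proof. exact: gmul_gword. Qed.

Lemma gword_cons i w : gword F (i :: w) = gen i * gword F w :> G.
Proof. by rewrite -gword1 gwordM. Qed.

Lemma gword_rcons w i : gword F (rcons w i) = (gword F w : G) * gen i.
Proof. by rewrite -gword1 gwordM cats1. Qed.

Lemma gword_nil1 : gword F [::] = 1 :> G.
Proof. exact: gword_nil. Qed.

Lemma gword_ind (P : G -> Prop) :
  (forall a f g, P f -> P g -> P (a *: f + g)) ->
  (forall w, P (gword F w)) -> forall f, P f.
Proof.
move=> PD Pw; apply: gbas_ind => [||J]; last by rewrite -gword_enum.
  by rewrite -(addNr (1 : G)) -scaleN1r; apply: PD; rewrite -gword_nil1.
exact: PD.
Qed.

Lemma gmul_ind (P : G -> Prop) :
  P 1 -> (forall a f g, P f -> P g -> P (a *: f + g)) ->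
  (forall i f, P f -> P (gen i * f)) -> forall f, P f.
Proof.
move=> P1 PD PM; apply: gword_ind => // w.
by elim: w => [|i w IH]; rewrite ?gword_nil1 // gword_cons; apply: PM.
Qed.

Lemma gmul_rind (P : G -> Prop) :
  P 1 -> (forall a f g, P f -> P g -> P (a *: f + g)) ->
  (forall i f, P f -> P (f * gen i)) -> forall f, P f.
Proof.
move=> P1 PD PM; apply: gword_ind => // w.
by elim/last_ind: w => [|w i IH]; rewrite ?gword_nil1 // gword_rcons; apply: PM.
Qed.

(** ** The parity involution *)

Lemma gpar_linear : linear (@gpar F n).
Proof.
by move=> a f g; apply/ffunP => J; rewrite !ffunE mulrDr mulrCA.
Qed.

Lemma gpar_gbas J : gpar (gbas F J) = (-1) ^+ #|J| *: gbas F J.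
Proof.
apply/ffunP => K; rewrite !ffunE /GRing.scale /=.
by case: eqP => [->|_] //; rewrite !mulr0.
Qed.

Lemma gpar_gword w : gpar (gword F w) = (-1) ^+ size w *: gword F w.
Proof.
rewrite /gword; case: ifP => [Uw|_]; last by rewrite (lin0 gpar_linear) scaler0.
rewrite (linZ gpar_linear) gpar_gbas !scalerA mulrC; congr (_ ^+ _ * _ *: _).
by rewrite cardsE; apply/card_uniqP.
Qed.

Lemma gparM f g : gpar (f * g) = (gpar f : G) * gpar g.
Proof.
elim/gword_ind: f => [a f1 f2 IH1 IH2|u].
  by rewrite mulrDl -scalerAl !gpar_linear IH1 IH2 mulrDl -scalerAl.
elim/gword_ind: g => [a f1 f2 IH1 IH2|w].
  by rewrite mulrDr -scalerAr !gpar_linear IH1 IH2 mulrDr -scalerAr.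
by rewrite gwordM !gpar_gword -scalerAl -scalerAr gwordM scalerA size_cat exprD.
Qed.

Lemma gpar1 : gpar (1 : G) = 1 :> G.
Proof. by rewrite -gword_nil1 gpar_gword scale1r. Qed.

Lemma gpar_gen i : gpar (gen i) = - gen i.
Proof. by rewrite -gword1 gpar_gword scaleN1r. Qed.

Lemma gparK : involutive (@gpar F n).
Proof.
by move=> f; apply/ffunP => J; rewrite !ffunE mulrA -expr2 sqrr_sign mul1r.
Qed.

(** Membership in a homogeneous component, coordinatewise. *)
Definition ghom p f := forall J, odd #|J| != p -> f J = 0.

Lemma ghomZD p a f g : ghom p f -> ghom p g -> ghom p (a *: f + g).
Proof. by move=> hf hg J pJ; rewrite !ffunE hf // hg // scaler0 addr0. Qed.

Lemma ghom0 p : ghom p (0 : G).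
Proof. by move=> J _; rewrite ffunE. Qed.

Lemma ghomD p f g : ghom p f -> ghom p g -> ghom p (f + g).
Proof. by move=> hf hg; rewrite -[f]scale1r; exact: ghomZD. Qed.

Lemma ghomZ p a f : ghom p f -> ghom p (a *: f).
Proof. by move=> hf; rewrite -[_ *: _]addr0; apply: ghomZD => //; exact: ghom0. Qed.

Lemma ghomN p f : ghom p f -> ghom p (- f).
Proof. by rewrite -scaleN1r; exact: ghomZ. Qed.

Lemma ghom_gbas J : ghom (odd #|J|) (gbas F J).
Proof. by move=> K; rewrite ffunE; case: (K =P J) => // ->; rewrite eqxx. Qed.

Lemma ghom_ind p (P : G -> Prop) :
  P 0 -> (forall a f g, P f -> P g -> P (a *: f + g)) ->
  (forall J, odd #|J| = p -> P (gbas F J)) -> forall f, ghom p f -> P f.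
Proof.
move=> P0 PD PJ f hf; rewrite (gbasP f); elim/big_rec: _ => // J g _ Pg.
have [pJ|pJ] := eqVneq (odd #|J|) p; first by apply: PD => //; exact: PJ.
by rewrite (hf J pJ) scale0r add0r.
Qed.

Lemma ghom_gpar p f : ghom p f -> gpar f = (-1) ^+ p *: f.
Proof.
move=> hf; apply/ffunP => J; rewrite !ffunE -signr_odd.
have [->//|/hf ->] := eqVneq (odd #|J|) p.
by rewrite mulr0 scaler0.
Qed.

Lemma ghom1 : ghom false (1 : G).
Proof. by have := @ghom_gbas set0; rewrite cards0. Qed.

Lemma ghom_gen i : ghom true (gen i).
Proof. by have := @ghom_gbas [set i]; rewrite cards1. Qed.

Lemma ghom_gword w : ghom (odd (size w)) (gword F w).
Proof.
rewrite /gword; case: ifP => [Uw|_]; last exact: ghom0.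
apply: ghomZ; have := @ghom_gbas [set i in w].
by rewrite cardsE (card_uniqP Uw).
Qed.

Lemma ghomM p q f g : ghom p f -> ghom q g -> ghom (p (+) q) (f * g).
Proof.
move=> hf hg; elim/ghom_ind: hf => [|a f1 f2 IH1 IH2|I <-].
- by rewrite mul0r; exact: ghom0.
- by rewrite mulrDl -scalerAl; exact: ghomZD.
elim/ghom_ind: hg => [|a f1 f2 IH1 IH2|J <-].
- by rewrite mulr0; exact: ghom0.
- by rewrite mulrDr -scalerAr; exact: ghomZD.
rewrite -!gword_enum gwordM !cardE -oddD -size_cat; exact: ghom_gword.
Qed.

Lemma gmul_superC p q f g : ghom p f -> ghom q g ->
  f * g = (-1) ^+ (p && q) *: (g * f).
Proof.
move=> hf hg; elim/ghom_ind: hf => [|a f1 f2 IH1 IH2|I <-].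
- by rewrite mul0r mulr0 scaler0.
- rewrite mulrDl -scalerAl IH1 IH2 mulrDr -scalerAr scalerDr !scalerA.
  by rewrite [a * _]mulrC.
elim/ghom_ind: hg => [|a f1 f2 IH1 IH2|J <-].
- by rewrite mul0r mulr0 scaler0.
- rewrite mulrDr -scalerAr IH1 IH2 mulrDl -scalerAl scalerDr !scalerA.
  by rewrite [a * _]mulrC.
rewrite -[gbas F I]gword_enum -[gbas F J]gword_enum !gwordM.
rewrite /gword !cat_uniq !enum_uniq /= !andbT has_sym.
case: ifP => [disj|_]; last by rewrite !scaler0.
have U : uniq (enum I ++ enum J) by rewrite cat_uniq !enum_uniq has_sym disj.
rewrite !scalerA; congr (_ *: gbas _ _); last first.
  by apply/setP => i; rewrite !inE !mem_cat orbC.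
rewrite !sgn_cat !sgn_enum !mul1r -oddM !cardE -(crossings_swap U) signr_odd.
by rewrite exprD -mulrA -expr2 sqrr_sign mulr1.
Qed.

(** ** The derivations *)

Lemma gder_linear i : linear (@gder F n i).
Proof.
move=> a f g; rewrite /gder scaler_sumr -big_split; apply: eq_bigr => J _ /=.
by rewrite scalerA -scalerDl !ffunE mulrDl mulrA.
Qed.

Lemma gder_gbas i J : gder i (gbas F J) =
  if i \in J then sgn_word F (i :: enum (J :\ i)) *: gbas F (J :\ i) else 0.
Proof.
rewrite /gder; case: ifP => iJ; last first.
  rewrite big1 // => K iK; rewrite ffunE.
  by case: eqP iK => [->|_]; rewrite ?iJ // mul0r scale0r.
rewrite (bigD1 J) //= ffunE eqxx mul1r big1 ?addr0 // => K /andP[_ KJ].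
by rewrite ffunE (negbTE KJ) mul0r scale0r.
Qed.

Lemma gbas_extract i J : i \in J ->
  gbas F J = sgn_word F (i :: enum (J :\ i)) *: (gen i * gbas F (J :\ i)) :> G.
Proof.
move=> iJ; rewrite -[gbas F (J :\ i)]gword_enum -gword_cons /gword /= enum_uniq.
rewrite mem_enum !inE eqxx /= scalerA sgn_sqr scale1r; congr gbas.
by apply/setP => k; rewrite !inE mem_enum !inE; case: eqP => [->|].
Qed.

Lemma gen_sqr i : gen i * gen i = 0.
Proof. by rewrite -!gword1 gwordM /gword /= inE eqxx. Qed.

Lemma gen_anticomm i j : gen i * gen j = - (gen j * gen i).
Proof. by rewrite (gmul_superC (ghom_gen i) (ghom_gen j)) scaleN1r. Qed.

Lemma gder_notin i J : i \notin J -> gder i (gen i * gbas F J) = gbas F J.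
Proof.
move=> iJ; have -> : gen i * gbas F J = sgn_word F (i :: enum J) *: gbas F (i |: J) :> G.
  rewrite -[gbas F J]gword_enum -gword_cons /gword /= mem_enum iJ enum_uniq.
  by congr (_ *: gbas _ _); apply/setP => k; rewrite !inE mem_enum.
rewrite (linZ (gder_linear i)) gder_gbas !inE eqxx /= setU1K // scalerA.
by rewrite sgn_sqr scale1r.
Qed.

Lemma gder_gen_mul i j f :
  gder i (gen j * f) = (i == j)%:R *: f - gen j * gder i f :> G.
Proof.
elim/gbas_ind: f => [|a f1 f2 IH1 IH2|J].
- by rewrite mulr0 (lin0 (gder_linear i)) mulr0 scaler0 subr0.
- rewrite mulrDr -scalerAr !(gder_linear i) IH1 IH2 mulrDr -scalerAr !scalerBr.
  rewrite scalerDr opprD !scalerA [a * _]mulrC; rewrite -!addrA; congr (_ + _).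
  by rewrite addrCA.
have [->|nij] := eqVneq j i.
  have [iJ|iJ] := boolP (i \in J).
    rewrite gder_gbas iJ -scalerAr -gbas_extract // scale1r subrr.
    by rewrite (gbas_extract iJ) -scalerAr mulrA gen_sqr mul0r scaler0 (lin0 (gder_linear i)).
  by rewrite gder_notin // gder_gbas (negbTE iJ) mulr0 subr0 scale1r.
rewrite scale0r sub0r.
have [iJ|iJ] := boolP (i \in J); last first.
  rewrite gder_gbas (negbTE iJ) mulr0 oppr0.
  rewrite -[gbas F J]gword_enum -gword_cons /gword.
  case: ifP => _; last by rewrite (lin0 (gder_linear i)).
  by rewrite (linZ (gder_linear i)) gder_gbas inE in_cons mem_enum (negbTE iJ) eq_sym (negbTE nij) scaler0.
rewrite gder_gbas iJ [X in gen j * X](gbas_extract iJ).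
rewrite -!scalerAr (linZ (gder_linear i)) -scalerN; congr (_ *: _).
rewrite mulrA gen_anticomm mulNr (linN (gder_linear i)) -mulrA; congr (- _).
rewrite -[gbas F (J :\ i)]gword_enum -gword_cons.
have : i \notin j :: enum (J :\ i) by rewrite in_cons mem_enum !inE eqxx eq_sym (negbTE nij).
move: (j :: _) => w iw; rewrite {1 2}/gword; case: ifP => _; last first.
  by rewrite mulr0 (lin0 (gder_linear i)).
by rewrite -scalerAr (linZ (gder_linear i)) gder_notin // inE.
Qed.

Lemma gder1 i : gder i (1 : G) = 0.
Proof. by rewrite gder_gbas inE. Qed.

Lemma gder_gen i j : gder i (gen j) = (i == j)%:R :> G.
Proof. by rewrite -[gen j]mulr1 gder_gen_mul gder1 mulr0 subr0 scaler_nat. Qed.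

Lemma gderM i f g : gder i (f * g) = (gder i f : G) * g + (gpar f : G) * gder i g.
Proof.
elim/gmul_ind: f => [|a f1 f2 IH1 IH2|j f IH].
- by rewrite gder1 gpar1 !mul1r mul0r add0r.
- rewrite mulrDl -scalerAl !(gder_linear i) IH1 IH2 gpar_linear !mulrDl.
  by rewrite -!scalerAl scalerDr addrACA.
rewrite -mulrA !gder_gen_mul IH gparM gpar_gen mulrBl -scalerAl mulrDr opprD.
by rewrite !mulNr !mulrA addrA.
Qed.

Lemma gder_anticomm i j f : gder i (gder j f) = - gder j (gder i f).
Proof.
elim/gmul_ind: f => [|a f1 f2 IH1 IH2|k f IH].
- by rewrite !gder1 !(lin0 (gder_linear _)) oppr0.
- by rewrite !gder_linear IH1 IH2 opprD scalerN.
rewrite !gder_gen_mul !(linB (gder_linear _)) !(linZ (gder_linear _)) !gder_gen_mul IH.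
by rewrite mulrN opprK opprD opprB addrA addrAC.
Qed.

Lemma ghom_gder p i f : ghom p f -> ghom (~~ p) (gder i f).
Proof.
move=> hf; elim/ghom_ind: hf => [|a f1 f2 IH1 IH2|J <-].
- by rewrite (lin0 (gder_linear i)); exact: ghom0.
- by rewrite gder_linear; exact: ghomZD.
rewrite gder_gbas; case: ifP => iJ; last exact: ghom0.
apply: ghomZ; rewrite (cardsD1 i J) iJ /= negbK; exact: ghom_gbas.
Qed.

(** ** Weight derivations *)

(** The even derivation that multiplies each letter [i] by [om i]; the Euler
    operator is the case where every weight is 1. *)
Definition gwt (om : 'I_n -> F) (f : G) : G :=
  [ffun J : {set 'I_n} => (\sum_(i in J) om i) * f J].

Variable om : 'I_n -> F.

Lemma gwt_linear : linear (gwt om).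
Proof. by move=> a f g; apply/ffunP => J; rewrite !ffunE mulrDr mulrCA. Qed.

Lemma gwt_gword w : gwt om (gword F w) = (\sum_(i <- w) om i) *: gword F w.
Proof.
rewrite /gword; case: ifP => Uw; last by rewrite (lin0 gwt_linear) scaler0.
apply/ffunP => J; rewrite !ffunE; case: eqP => [->|_]; last first.
  by rewrite /GRing.scale /= !mulr0.
congr (_ * _); rewrite (big_uniq _ Uw) /=; apply: eq_bigl => i.
by rewrite inE.
Qed.

Lemma gwtM f g : gwt om (f * g) = (gwt om f : G) * g + f * gwt om g.
Proof.
elim/gword_ind: f => [a f1 f2 IH1 IH2|u].
  by rewrite mulrDl -scalerAl !gwt_linear IH1 IH2 !mulrDl -!scalerAl scalerDr addrACA.
elim/gword_ind: g => [a f1 f2 IH1 IH2|w].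
  by rewrite mulrDr -scalerAr !gwt_linear IH1 IH2 !mulrDr -!scalerAr scalerDr addrACA.
by rewrite gwordM !gwt_gword -scalerAl -scalerAr gwordM big_cat /= scalerDl.
Qed.

Lemma gder_gwt i f : gder i (gwt om f) = gwt om (gder i f) + om i *: gder i f.
Proof.
elim/gbas_ind: f => [|a f1 f2 IH1 IH2|J].
- by rewrite (lin0 gwt_linear) (lin0 (gder_linear i)) (lin0 gwt_linear) scaler0 addr0.
- rewrite !(gwt_linear, gder_linear) IH1 IH2 !scalerDr !scalerA [a * _]mulrC.
  by rewrite addrACA.
rewrite -gword_enum gwt_gword (linZ (gder_linear i)) gword_enum gder_gbas.
case: ifP => iJ; last by rewrite (lin0 gwt_linear) !scaler0 addr0.
rewrite (linZ gwt_linear) -[gbas F (J :\ i)]gword_enum gwt_gword !scalerA -scalerDl.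
congr (_ *: _); rewrite !big_enum /= (big_setD1 i iJ) /=; ring.
Qed.

Lemma ghom_gwt p f : ghom p f -> ghom p (gwt om f).
Proof. by move=> hf J /hf fJ; rewrite ffunE fJ mulr0. Qed.

End Superderivations.

(** * The regular bimodule of Kan(n) and its deformation *)

Section KanProducts.
Variables (F : fieldType) (n : nat).
Local Notation G := (gring F n).
Implicit Types (f g h : G) (i j : 'I_n) (p q : bool).

Lemma gbracketE f g : gbracket f g = \sum_i (gder i (gpar f) : G) * gder i g :> G.
Proof. by []. Qed.

Lemma gbracket_linear f : linear (fun g : G => gbracket f g : G).
Proof.
move=> a g h; rewrite !gbracketE scaler_sumr -big_split; apply: eq_bigr => i _ /=.
by rewrite gder_linear mulrDr -scalerAr.
Qed.

Lemma gbracket_linearl g : linear (fun f : G => gbracket f g : G).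
Proof.
move=> a f h; rewrite !gbracketE scaler_sumr -big_split; apply: eq_bigr => i _ /=.
by rewrite gpar_linear gder_linear mulrDl -scalerAl.
Qed.

Lemma ghom_gbracket p q f g : ghom p f -> ghom q g -> ghom (p (+) q) (gbracket f g : G).
Proof.
move=> hf hg; rewrite gbracketE; elim/big_rec: _ => [|i x _ hx]; first exact: ghom0.
apply: ghomD => //; rewrite (ghom_gpar hf) (linZ (gder_linear i)) -scalerAl.
by apply: ghomZ; have := ghomM (ghom_gder i hf) (ghom_gder i hg); rewrite addNb addbN negbK.
Qed.

Lemma gbracket1 f : gbracket f (1 : G) = 0 :> G.
Proof. by rewrite gbracketE big1 // => i _; rewrite gder1 mulr0. Qed.

Lemma gbracket_gen f i : gbracket f (gen F i) = gder i (gpar f) :> G.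
Proof.
rewrite gbracketE (bigD1 i) //= gder_gen eqxx mulr1 big1 ?addr0 // => j ji.
by rewrite gder_gen (negbTE ji) mulr0.
Qed.

(** ** The Euler operator *)

(** The degree minus 1; it is locked since its unfolding, a difference, matches
    too many rewriting rules. *)
Fact geuler_key : unit. Proof. by []. Qed.
Definition geuler f : G := locked_with geuler_key (gwt (fun=> 1) f - f).

Lemma geulerE f : geuler f = gwt (fun=> 1) f - f.
Proof. by rewrite /geuler unlock. Qed.

Lemma geuler_linear : linear geuler.
Proof.
move=> a f g; rewrite !geulerE gwt_linear scalerBr opprD addrACA.
by [].
Qed.

Lemma ghom_geuler p f : ghom p f -> ghom p (geuler f).
Proof. by move=> hf; rewrite geulerE; apply: ghomD; [exact: ghom_gwt | exact: ghomN]. Qed.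

Lemma geuler1 : geuler 1 = - 1.
Proof. by rewrite !geulerE -gword_nil1 gwt_gword big_nil scale0r sub0r. Qed.

Lemma geuler_gen i : geuler (gen F i) = 0.
Proof. by rewrite !geulerE -gword1 gwt_gword big_seq1 scale1r subrr. Qed.

(** ** The twisted regular bimodule *)

Variable alpha : F.

(** The regular bimodule, deformed by [alpha] on the product of two barred
    elements. Up to the identification of e_A with the complementary basis
    vector, this is V(alpha); here the Jordan identity and the submodules are
    easier to see. *)
Definition kal_r (x a : G * G) : G * G :=
  (x.1 * a.1 + gbracket x.2 (gpar a.2) - alpha *: (x.2 * geuler (gpar a.2)),
   x.1 * a.2 + x.2 * gpar a.1).

Definition kal_l (a x : G * G) : G * G :=
  (a.1 * x.1 + gbracket a.2 (gpar x.2) + alpha *: (geuler a.2 * gpar x.2),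
   a.1 * x.2 + a.2 * gpar x.1).

Definition Kalpha : superbimod (Kan F n) :=
  @SuperBimod F (Kan F n) (G * G)%type (@kan_pr F n) kal_l kal_r.

Definition kel (c : bool) f : G * G := if c then (0, f) else (f, 0).

Lemma kel_linear c : linear (kel c).
Proof. by case: c => a f g; congr pair; rewrite /= ?scaler0 ?addr0. Qed.

Lemma kelE (x : G * G) : x = kel false x.1 + kel true x.2.
Proof. by case: x => f g; congr pair; rewrite /= ?addr0 ?add0r. Qed.

Lemma kan_mulE (x y : G * G) : kan_mul x y =
  (x.1 * y.1 + gbracket x.2 (gpar y.2), x.1 * y.2 + x.2 * gpar y.1) :> G * G.
Proof. by []. Qed.

Lemma kal_r_linear (x : G * G) : linear (kal_r x).
Proof.
move=> a y z; congr pair; rewrite /=.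
  rewrite gpar_linear gbracket_linear geuler_linear !mulrDr -!scalerAr scalerDr scalerDr.
  rewrite !scalerDr !scalerN !scalerA [alpha * a]mulrC opprD.
  by zmod.
rewrite gpar_linear !mulrDr -!scalerAr scalerDr.
by zmod.
Qed.

Lemma kal_r_linearl (y : G * G) : linear (fun x => kal_r x y).
Proof.
move=> a x z; congr pair; rewrite /=.
  rewrite gbracket_linearl !mulrDl -!scalerAl !scalerDr.
  rewrite !scalerN !scalerA [alpha * a]mulrC opprD.
  by zmod.
rewrite !mulrDl -!scalerAl scalerDr.
by zmod.
Qed.

Lemma kal_l_linear (x : G * G) : linear (kal_l x).
Proof.
move=> a y z; congr pair; rewrite /=.
  rewrite gpar_linear gbracket_linear !mulrDr -!scalerAr scalerDr scalerDr.
  rewrite !scalerDr !scalerA [alpha * a]mulrC.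
  by zmod.
rewrite gpar_linear !mulrDr -!scalerAr scalerDr.
by zmod.
Qed.

Lemma kal_l_linearl (y : G * G) : linear (fun x => kal_l x y).
Proof.
move=> a x z; congr pair; rewrite /=.
  rewrite gbracket_linearl geuler_linear !mulrDl -!scalerAl !scalerDr.
  rewrite !scalerA [alpha * a]mulrC.
  by zmod.
rewrite !mulrDl -!scalerAl scalerDr.
by zmod.
Qed.

End KanProducts.

(** * The Kantor double of a contact bracket *)

Section KantorDouble.
Variables (K : comNzRingType) (P : K -> K -> K) (E D : K -> K).
Hypothesis PC : forall x y, P x y = - P y x.
Hypothesis PD : forall x y z, P (x + y) z = P x z + P y z.
Hypothesis PM : forall x y z, P (x * y) z = x * P y z + P x z * y.
Hypothesis PJ : forall x y z, P (P x y) z + P (P y z) x + P (P z x) y = 0.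
Hypothesis ED : forall x y, E (x + y) = E x + E y.
Hypothesis EM : forall x y, E (x * y) = E x * y + x * E y.
Hypothesis DD : forall x y, D (x + y) = D x + D y.
Hypothesis DM : forall x y, D (x * y) = D x * y + x * D y.
Hypothesis EDC : forall x, E (D x) = D (E x).
Hypothesis EP : forall x y, E (P x y) = P (E x) y + P x (E y) - P x y *+ 2.
Hypothesis DP : forall x y, D (P x y) = P (D x) y + P x (D y).

(** A bracket of contact type, made from a Poisson bracket [P] of degree -2 for
    [E], and from a derivation [D] of [P] that commutes with [E]. *)
Definition jbracket x y := P x y + (E x - x) * D y - D x * (E y - y).

Definition kantor (c d : bool) x y := if c && d then jbracket x y else x * y.

Let PDr x y z : P x (y + z) = P x y + P x z.
Proof. by rewrite PC PD opprD -(PC x y) -(PC x z). Qed.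
Let PMr x y z : P x (y * z) = y * P x z + P x y * z.
Proof. by rewrite PC PM opprD -mulrN -mulNr -(PC x z) -(PC x y). Qed.
Let addN (A : K -> K) : (forall x y, A (x + y) = A x + A y) -> forall x, A (- x) = - A x.
Proof.
move=> AD x; have A0 : A 0 = 0 by apply: (addrI (A 0)); rewrite -AD !addr0.
by apply: (addIr (A x)); rewrite -AD !addNr.
Qed.
Let PN x y : P (- x) y = - P x y.
Proof. exact: (addN (fun u v => PD u v y)). Qed.
Let PNr x y : P x (- y) = - P x y.
Proof. exact: (addN (fun u v => PDr x u v)). Qed.
Let EN := addN ED.
Let DN := addN DD.

(* [ring] does not know that [P] is alternating: its arguments are sorted first. *)
Ltac idx x y z t a :=
  lazymatch a with
  | context [P _ _] => constr:(0%N)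
  | context [t] => constr:(4%N)
  | context [z] => constr:(3%N)
  | context [y] => constr:(2%N)
  | context [x] => constr:(1%N)
  end.

Ltac orient x y z t :=
  repeat match goal with
  | |- context [P ?a ?b] =>
    let i := idx x y z t a in let j := idx x y z t b in
    let r := eval vm_compute in (j < i)%N in
    lazymatch r with true => rewrite (PC a b) end
  end.

(** On even elements only the bars are odd, and each of the sixteen cases is a
    polynomial identity in the values of [P], [E] and [D], modulo one instance of
    the identity of Jacobi. *)
Lemma kantor_jordan (c1 c2 c3 c4 : bool) x y z t :
  let m := kantor in
  m (c1 (+) c2 (+) c3) c4 (m (c1 (+) c2) c3 (m c1 c2 x y) z) t
  + (-1) ^+ ((c2 && c3) + (c2 && c4) + (c3 && c4))%N
    * m (c1 (+) c4 (+) c3) c2 (m (c1 (+) c4) c3 (m c1 c4 x t) z) y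
  + (-1) ^+ ((c1 && c2) + (c1 && c3) + (c1 && c4) + (c3 && c4))%N
    * m (c2 (+) c4 (+) c3) c1 (m (c2 (+) c4) c3 (m c2 c4 y t) z) x
  = m (c1 (+) c2) (c3 (+) c4) (m c1 c2 x y) (m c3 c4 z t)
  + (-1) ^+ (c2 && c3)
    * m (c1 (+) c3) (c2 (+) c4) (m c1 c3 x z) (m c2 c4 y t)
  + (-1) ^+ (c4 && (c2 (+) c3))
    * m (c1 (+) c4) (c2 (+) c3) (m c1 c4 x t) (m c2 c3 y z).
Proof.
have J := PJ x y t.
have J2 : P (P y t) x = - P (P x y) t - P (P t x) y.
  by apply/eqP; rewrite -subr_eq0 -J; apply/eqP; ring.
move=> m; rewrite {}/m; case: c1; case: c2; case: c3; case: c4;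
  rewrite /kantor /jbracket /=;
  rewrite ?(PD, PM, PDr, PMr, PN, PNr, ED, EM, EN, DD, DM, DN, EDC, EP, DP, mulr2n, opprD, opprK);
  rewrite ?J2 ; orient x y z t; rewrite ?PN; ring.
Qed.

End KantorDouble.

(** * The even part of a Grassmann algebra *)

Section EvenPart.
Variables (F : fieldType) (n : nat).
Local Notation G := (gring F n).

Definition geven : {pred G} := fun f => [forall J : {set 'I_n}, odd #|J| ==> (f J == 0)].

Lemma gevenP f : reflect (ghom false f) (f \in geven).
Proof.
apply: (iffP forallP) => [H J|H J].
  by have := H J; case: (odd _) => //= /eqP.
by apply/implyP => oJ; rewrite H // oJ.
Qed.

Fact geven_subring : subring_closed geven.
Proof.
split=> [|f g /gevenP hf /gevenP hg|f g /gevenP hf /gevenP hg]; apply/gevenP.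
- exact: ghom1.
- by apply: ghomD => //; apply: ghomN.
- exact: ghomM hf hg.
Qed.
HB.instance Definition _ := GRing.isSubringClosed.Build G geven geven_subring.

(** The even part is a commutative ring, which gives access to [ring] through
    [kantor_jordan]. *)
Record evenG := EvenG { even_val :> G; even_valP : even_val \in geven }.
HB.instance Definition _ := [isSub for even_val].
HB.instance Definition _ := [Choice of evenG by <:].
HB.instance Definition _ := [SubChoice_isSubNzRing of evenG by <:].

Fact even_mulC : @commutative evenG evenG *%R.
Proof.
move=> [f hf] [g hg]; apply: val_inj => /=.
move/gevenP: hf => hf; move/gevenP: hg => hg.
by rewrite (gmul_superC hf hg) scale1r.
Qed.
HB.instance Definition _ := GRing.PzRing_hasCommutativeMul.Build evenG even_mulC.

Lemma even_valD (x y : evenG) : even_val (x + y) = even_val x + even_val y.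
Proof. by []. Qed.
Lemma even_valM (x y : evenG) : even_val (x * y) = even_val x * even_val y.
Proof. by []. Qed.
Lemma even_valN (x : evenG) : even_val (- x) = - even_val x.
Proof. exact: (rmorphN val). Qed.

Variable S : pred 'I_n.
Implicit Types f g h : G.

(** Only the letters in [S] enter the bracket; the others are parameters. *)
Definition poisson f g : G := \sum_(i | S i) (gder i f : G) * gder i g.

Lemma poissonDl f g h : poisson (f + g) h = poisson f h + poisson g h.
Proof.
rewrite /poisson -big_split; apply: eq_bigr => i _.
by rewrite (linD (gder_linear i)) mulrDl.
Qed.

Section Even.
Variables f g h : G.
Hypotheses (hf : ghom false f) (hg : ghom false g) (hh : ghom false h).

Let evenC f1 : f1 * g = g * f1.
Proof.
have H p (f2 : G) : ghom p f2 -> f2 * g = g * f2.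
  by move=> hp; rewrite (gmul_superC hp hg) andbF scale1r.
elim/gbas_ind: f1 => [|a f2 f3 IH1 IH2|J]; first by rewrite mul0r mulr0.
  by rewrite mulrDl mulrDr -scalerAl -scalerAr IH1 IH2.
exact: H (@ghom_gbas _ _ J).
Qed.

Lemma poisson_even : ghom false (poisson f g).
Proof.
rewrite /poisson; elim/big_rec: _ => [|i x _ hx]; first exact: ghom0.
by apply: ghomD => //; apply: ghomM (ghom_gder i hf) (ghom_gder i hg).
Qed.

Lemma poissonC : poisson f g = - poisson g f.
Proof.
rewrite -sumrN; apply: eq_bigr => i _.
by rewrite (gmul_superC (ghom_gder i hf) (ghom_gder i hg)) scaleN1r.
Qed.

Lemma poissonM : poisson (f * g) h = f * poisson g h + poisson f h * g.
Proof.
rewrite /poisson mulr_sumr mulr_suml -big_split; apply: eq_bigr => i _ /=.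
rewrite gderM (ghom_gpar hf) scale1r mulrDl addrC -!mulrA; congr (_ + _ * _).
by rewrite -evenC.
Qed.

Lemma gwt_poisson (om : 'I_n -> F) (c : F) : {in S, forall i, om i = c} ->
  gwt om (poisson f g) =
  poisson (gwt om f) g + poisson f (gwt om g) - (c *+ 2) *: poisson f g.
Proof.
move=> omc; rewrite /poisson (lin_sum (gwt_linear om)) scaler_sumr -sumrN -!big_split.
apply: eq_bigr => i Si /=; rewrite gwtM !gder_gwt omc // mulrDl mulrDr.
by rewrite -scalerAl -scalerAr addrACA mulr2n scalerDl addrK.
Qed.

End Even.

Let A f g h : G := \sum_(i | S i) \sum_(j | S j) (gder i (gder j f) : G) * gder j g * gder i h.

(** The second derivatives are symmetric in the two other arguments, so that
    they cancel in the cyclic sum. *)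
Lemma poisson_poisson f g h : ghom false f -> ghom false g -> ghom false h ->
  poisson (poisson f g) h = A f g h - A g f h.
Proof.
move=> hf hg hh; rewrite /A -sumrB; apply: eq_bigr => i Si.
rewrite /poisson (lin_sum (gder_linear i)) mulr_suml -sumrB; apply: eq_bigr => j Sj.
rewrite gderM (ghom_gpar (ghom_gder j hf)) scaleN1r mulrDl mulNr mulNr.
by rewrite (gmul_superC (ghom_gder j hf) (ghom_gder i (ghom_gder j hg))) scale1r.
Qed.

Lemma poisson2_sym f g h : ghom false f -> ghom false g -> ghom false h ->
  A f g h = A f h g.
Proof.
move=> hf hg hh; rewrite {1}/A exchange_big; apply: eq_bigr => i Si; apply: eq_bigr => j Sj /=.
rewrite gder_anticomm mulNr mulNr -!mulrA -mulrN.
by rewrite (gmul_superC (ghom_gder i hg) (ghom_gder j hh)) scaleN1r opprK.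
Qed.

Lemma poisson_jacobi f g h : ghom false f -> ghom false g -> ghom false h ->
  poisson (poisson f g) h + poisson (poisson g h) f + poisson (poisson h f) g = 0.
Proof.
move=> hf hg hh; rewrite !poisson_poisson //.
rewrite (poisson2_sym hf hh hg) (poisson2_sym hg hh hf) (poisson2_sym hh hg hf).
by rewrite addrC addrA subrKA addrA subrK subrr.
Qed.

(** ** The Kantor double of the even part *)

Variable (omE omD : 'I_n -> F).
Hypothesis omE1 : {in S, forall i, omE i = 1}.
Hypothesis omD0 : {in S, forall i, omD i = 0}.

Definition gbr f g : G :=
  poisson f g + (gwt omE f - f) * gwt omD g - gwt omD f * (gwt omE g - g).

Definition gkantor (c d : bool) f g : G := if c && d then gbr f g else f * g.

Let PK (x y : evenG) : evenG :=
  EvenG (introT (gevenP _) (poisson_even (elimT (gevenP x) (even_valP x)) (elimT (gevenP y) (even_valP y)))).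
Let WK om (x : evenG) : evenG :=
  EvenG (introT (gevenP _) (ghom_gwt om (elimT (gevenP x) (even_valP x)))).

Lemma even_hom (x : evenG) : ghom false x.
Proof. exact: (elimT (gevenP x) (even_valP x)). Qed.

Lemma gkantor_jordan (c1 c2 c3 c4 : bool) x y z t :
  ghom false x -> ghom false y -> ghom false z -> ghom false t ->
  let m := gkantor in
  m (c1 (+) c2 (+) c3) c4 (m (c1 (+) c2) c3 (m c1 c2 x y) z) t
  + (-1) ^+ ((c2 && c3) + (c2 && c4) + (c3 && c4))%N
    *: m (c1 (+) c4 (+) c3) c2 (m (c1 (+) c4) c3 (m c1 c4 x t) z) y
  + (-1) ^+ ((c1 && c2) + (c1 && c3) + (c1 && c4) + (c3 && c4))%N
    *: m (c2 (+) c4 (+) c3) c1 (m (c2 (+) c4) c3 (m c2 c4 y t) z) x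
  = m (c1 (+) c2) (c3 (+) c4) (m c1 c2 x y) (m c3 c4 z t)
  + (-1) ^+ (c2 && c3)
    *: m (c1 (+) c3) (c2 (+) c4) (m c1 c3 x z) (m c2 c4 y t)
  + (-1) ^+ (c4 && (c2 (+) c3))
    *: m (c1 (+) c4) (c2 (+) c3) (m c1 c4 x t) (m c2 c3 y z).
Proof.
move=> /gevenP hx /gevenP hy /gevenP hz /gevenP ht m; rewrite {}/m.
have := @kantor_jordan evenG PK (WK omE) (WK omD).
have vE (c d : bool) (u v : evenG) :
    even_val (kantor PK (WK omE) (WK omD) c d u v) = gkantor c d u v.
  rewrite /kantor /gkantor; case: (c && d); rewrite /jbracket /gbr ?even_valM //.
move=> H; have {}H := (fun H1 H2 H3 H4 H5 H6 H7 H8 H9 H10 H11 => congr1 even_val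
  (H H1 H2 H3 H4 H5 H6 H7 H8 H9 H10 H11 c1 c2 c3 c4 (EvenG hx) (EvenG hy) (EvenG hz) (EvenG ht))).
have signE k (u : evenG) : even_val ((-1) ^+ k * u) = (-1) ^+ k *: even_val u.
  by rewrite -signr_odd -[in RHS]signr_odd; case: (odd k); rewrite ?expr1 ?expr0 ?mulN1r ?even_valN ?scaleN1r ?mul1r ?scale1r.
move: H; rewrite !even_valD !signE !vE /=; apply.
- by move=> u v; apply: val_inj; rewrite [RHS]even_valN; apply: poissonC; apply: even_hom.
- by move=> u v w; apply: val_inj; apply: poissonDl.
- by move=> u v w; apply: val_inj; apply: poissonM; apply: even_hom.
- by move=> u v w; apply: val_inj; apply: poisson_jacobi; apply: even_hom.
- by move=> u v; apply: val_inj; apply: (linD (gwt_linear omE)).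
- by move=> u v; apply: val_inj; apply: gwtM.
- by move=> u v; apply: val_inj; apply: (linD (gwt_linear omD)).
- by move=> u v; apply: val_inj; apply: gwtM.
- by move=> u; apply: val_inj; apply/ffunP => J; rewrite !ffunE mulrCA.
- move=> u v; rewrite mulr2n; apply: val_inj; rewrite /= (gwt_poisson _ _ omE1); try exact: even_hom.
  by rewrite mulr2n scalerDl scale1r.
- move=> u v; apply: val_inj; rewrite /= (gwt_poisson _ _ omD0); try exact: even_hom.
  by rewrite mul0rn scale0r subr0.
Qed.

Lemma gkantorZl c d a f g : gkantor c d (a *: f) g = a *: gkantor c d f g.
Proof.
have PZ : poisson (a *: f) g = a *: poisson f g.
  rewrite /poisson scaler_sumr; apply: eq_bigr => i _.
  by rewrite (linZ (gder_linear i)) -scalerAl.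
rewrite /gkantor /gbr PZ !(linZ (gwt_linear _)) -scalerBr -!scalerAl.
by case: ifP => _ //; rewrite scalerBr scalerDr.
Qed.

Lemma gkantorZr c d a f g : gkantor c d f (a *: g) = a *: gkantor c d f g.
Proof.
have PZ : poisson f (a *: g) = a *: poisson f g.
  rewrite /poisson scaler_sumr; apply: eq_bigr => i _.
  by rewrite (linZ (gder_linear i)) -scalerAr.
rewrite /gkantor /gbr PZ !(linZ (gwt_linear _)) -scalerBr -!scalerAr.
by case: ifP => _ //; rewrite scalerBr scalerDr.
Qed.

End EvenPart.

(** * Adding letters to a Grassmann algebra *)

Section Extension.
Variables (F : fieldType) (n k : nat).
Local Notation G := (gring F n).
Local Notation GN := (gring F (n + k)).
Implicit Types (J : {set 'I_n}) (f g : G) (i j : 'I_n) (p q : bool).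
Implicit Types (u : seq 'I_k) (w : seq 'I_n).

(** [emb] puts [f] in the first [n] letters of the larger algebra, and [ext] is a
    word in the [k] others; both are locked to keep products from unfolding. *)
Fact emb_key : unit. Proof. by []. Qed.
Definition emb f : GN := locked_with emb_key
  (\sum_J f J *: (gword F (map (lshift k) (enum J)) : GN)).

Lemma embE f : emb f = \sum_J f J *: (gword F (map (lshift k) (enum J)) : GN).
Proof. by rewrite /emb unlock. Qed.

Fact ext_key : unit. Proof. by []. Qed.
Definition ext u : GN := locked_with ext_key (gword F (map (@rshift n k) u)).

Lemma extE u : ext u = gword F (map (@rshift n k) u).
Proof. by rewrite /ext unlock. Qed.

Lemma emb_linear : linear emb.
Proof.
move=> a f g; rewrite !embE scaler_sumr -big_split; apply: eq_bigr => J _ /=.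
by rewrite !ffunE scalerDl scalerA.
Qed.

Lemma inversions_map w : inversions (map (lshift k) w) = inversions w.
Proof. by elim: w => //= i w ->; rewrite count_map; congr addn; apply: eq_count. Qed.

Lemma emb_gbas J : emb (gbas F J) = gword F (map (lshift k) (enum J)).
Proof.
rewrite !embE (bigD1 J) //= ffunE eqxx scale1r big1 ?addr0 // => K KJ.
by rewrite ffunE (negbTE KJ) scale0r.
Qed.

Lemma emb_gword w : emb (gword F w) = gword F (map (lshift k) w).
Proof.
have inj := @lshift_inj n k.
rewrite {1}/gword; case: ifP => Uw; last first.
  by rewrite (lin0 emb_linear) /gword (map_inj_uniq inj) Uw.
rewrite (linZ emb_linear) emb_gbas.
have pw : perm_eq w (enum [set i in w]).
  by apply: uniq_perm => [//||i]; rewrite ?enum_uniq // mem_enum inE.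
rewrite [RHS](gword_perm _ (perm_map _ pw)); congr (_ *: _).
by rewrite /sgn_word !inversions_map inversions_enum mulr1.
Qed.

Lemma emb1 : emb 1 = 1.
Proof. by rewrite -gword_nil1 emb_gword gword_nil1. Qed.

Lemma embM f g : emb (f * g) = emb f * emb g.
Proof.
elim/gword_ind: f => [a f1 f2 IH1 IH2|u].
  by rewrite mulrDl -scalerAl !emb_linear IH1 IH2 mulrDl -scalerAl.
elim/gword_ind: g => [a f1 f2 IH1 IH2|w].
  by rewrite mulrDr -scalerAr !emb_linear IH1 IH2 mulrDr -scalerAr.
by rewrite gwordM !emb_gword gwordM map_cat.
Qed.

Lemma emb_gen i : emb (gen F i) = gen F (lshift k i).
Proof. by rewrite -!gword1 emb_gword. Qed.

Lemma ghom_emb p f : ghom p f -> ghom p (emb f).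
Proof.
elim/ghom_ind => [|a f1 f2 h1 h2|J <-].
- by rewrite (lin0 emb_linear); exact: ghom0.
- by rewrite emb_linear; exact: ghomZD.
by rewrite emb_gbas cardE -(size_map (lshift k)); exact: ghom_gword.
Qed.

Lemma gder_emb i f : gder (lshift k i) (emb f) = emb (gder i f).
Proof.
elim/gmul_ind: f => [|a f g IHf IHg|j f IH].
- by rewrite emb1 !gder1 (lin0 emb_linear).
- by rewrite !(gder_linear, emb_linear) IHf IHg.
rewrite embM emb_gen !gder_gen_mul (linB emb_linear) (linZ emb_linear) embM emb_gen IH.
by rewrite (inj_eq (@lshift_inj n k)).
Qed.

Lemma gwt_emb (om : 'I_(n + k) -> F) f :
  gwt om (emb f) = emb (gwt (fun i => om (lshift k i)) f).
Proof.
elim/gword_ind: f => [a f g IHf IHg|w].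
  by rewrite !(gwt_linear, emb_linear) IHf IHg.
by rewrite gwt_gword (linZ emb_linear) !emb_gword gwt_gword big_map.
Qed.

Lemma ghom_ext u : ghom (odd (size u)) (ext u).
Proof. by rewrite extE -(size_map (@rshift n k)); exact: ghom_gword. Qed.

Lemma extM u u' : ext u * ext u' = ext (u ++ u').
Proof. by rewrite !extE map_cat gwordM. Qed.

Lemma ext_swap (v a b w : seq 'I_k) : ext (v ++ a ++ b ++ w) =
  (-1) ^+ (odd (size a) && odd (size b)) *: ext (v ++ b ++ a ++ w).
Proof.
rewrite -!extM [ext a * _]mulrA (gmul_superC (@ghom_ext a) (@ghom_ext b)).
by rewrite -scalerAl -scalerAr -mulrA.
Qed.

Lemma gder_ext i u : gder (lshift k i) (ext u) = 0.
Proof.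
rewrite !extE; elim: u => [|j u IH] /=; first by rewrite gword_nil1 gder1.
by rewrite gword_cons gder_gen_mul IH eq_lrshift scale0r mulr0 subrr.
Qed.

Lemma gwt_ext om u : gwt om (ext u) = (\sum_(i <- u) om (rshift n i)) *: ext u.
Proof. by rewrite !extE gwt_gword big_map. Qed.

(** Distinct basis elements have as products with [ext u] distinct basis elements,
    up to sign. This is how identities come back from the envelope. *)
Lemma emb_ext_eq0 f u : uniq u -> emb f * ext u = 0 -> f = 0.
Proof.
move=> Uu /ffunP fu0; apply/ffunP => J; rewrite ffunE.
pose s (K : {set 'I_n}) := (map (lshift k) (enum K) ++ map (@rshift n k) u) : seq 'I_(n + k).
have Us K : uniq (s K).
  rewrite cat_uniq !map_inj_uniq ?enum_uniq ?Uu ?andbT /=.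
  - by apply/hasP => -[x /mapP[a _ ->] /mapP[b _ /eqP]]; rewrite eq_rlshift.
  - exact: rshift_inj.
  - exact: lshift_inj.
have := fu0 [set i in s J]; rewrite ffunE embE mulr_suml sum_ffunE (bigD1 J) //=.
rewrite big1 ?addr0 => [|K KJ].
  rewrite extE -scalerAl gwordM -/(s J) /gword Us !ffunE eqxx /GRing.scale /= mulr1.
  by move/eqP; rewrite mulf_eq0 (negbTE (sgn_neq0 _ _)) orbF => /eqP.
rewrite extE -scalerAl gwordM -/(s K) /gword Us !ffunE.
case: eqP => [/setP E|_]; last by rewrite !scaler0.
case/eqP: KJ; apply/setP => i; have := E (lshift k i).
rewrite !inE !mem_cat !(mem_map (@lshift_inj n k)) !mem_enum.
have -> : (lshift k i \in map (@rshift n k) u) = false.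
  by apply/mapP => -[b _ /eqP]; rewrite eq_lrshift.
by rewrite !orbF.
Qed.

End Extension.

(** * The Grassmann envelope *)

Section RawProduct.
Variables (F : fieldType) (n : nat) (alpha : F).
Local Notation G := (gring F n).
Implicit Types (f g : G) (c d p q : bool) (mu nu : nat).

(** The products of Kan(n) and of its bimodule stripped of their signs: [c], [d]
    are the bars of the factors, and [mu], [nu] tell which factor lies in the
    bimodule. All three products have this common form. *)
Definition kraw c d mu nu f g : G :=
  if c && d then gbracket f g + (alpha *+ nu) *: (geuler f * g)
                 - (alpha *+ mu) *: (f * geuler g)
  else f * g.

Lemma ghom_kraw c d mu nu p q f g : ghom p f -> ghom q g ->
  ghom (p (+) q) (kraw c d mu nu f g).
Proof.
move=> hf hg; rewrite /kraw; case: ifP => _; last exact: ghomM.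
apply: ghomD; last by apply/ghomN/ghomZ/ghomM => //; exact: ghom_geuler.
apply: ghomD; first exact: ghom_gbracket.
by apply/ghomZ/ghomM => //; exact: ghom_geuler.
Qed.

Variable k : nat.
Local Notation GN := (gring F (n + k)).
Variable x0 : 'I_k.
Implicit Types u w : seq 'I_k.

(* The derivation [D] of the contact bracket has weight [alpha] on the letter
   [x0], that marks the elements of the bimodule; the degree counts the [n] letters of
   the Grassmann algebra. *)
Let S : pred 'I_(n + k) := fun i => (i < n)%N.
Let omE (i : 'I_(n + k)) : F := ((i < n)%N)%:R.
Let omD (i : 'I_(n + k)) : F := if i == rshift n x0 then alpha else 0.
Let gk := gkantor S omE omD.

Lemma poisson_env p q f g u w : ghom p f -> ghom q g -> odd (size u) = p ->
  poisson S (emb k f * ext F n u) (emb k g * ext F n w) =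
  (-1) ^+ (p && q) *: (emb k (gbracket f g) * ext F n (u ++ w)).
Proof.
move=> hf hg pu; rewrite /poisson big_split_ord /= [X in _ + X]big1 => [|i]; last first.
  by rewrite /S /= ltnNge leq_addr.
have -> : emb k (gbracket f g) * ext F n (u ++ w) =
    \sum_i emb k ((gder i (gpar f) : G) * gder i g) * ext F n (u ++ w).
  by rewrite gbracketE (lin_sum (@emb_linear F n k)) mulr_suml.
rewrite addr0 [RHS]scaler_sumr.
apply: eq_big => [i|i _]; first by rewrite /S /= ltn_ord.
rewrite !gderM !gder_ext !mulr0 !addr0 !gder_emb -mulrA [ext F n u * _]mulrA.
rewrite (gmul_superC (@ghom_ext F n k u) (ghom_emb (k:=k) (ghom_gder i hg))) pu.
rewrite -scalerAl -scalerAr -mulrA extM mulrA -embM.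
rewrite (ghom_gpar hf) (linZ (gder_linear i)) -scalerAl (linZ (@emb_linear F n k)).
rewrite -[in RHS]scalerAl scalerA; congr (_ *: _).
by case: (p); case: (q); rewrite /= ?mulN1r ?mulr1 ?mul1r ?opprK.
Qed.

Lemma omD_ext u : gwt omD (ext F n u) = (alpha *+ count_mem x0 u) *: ext F n u.
Proof.
rewrite gwt_ext; congr (_ *: _); elim: u => [|i u IH]; first by rewrite big_nil.
rewrite big_cons IH /omD (inj_eq (@rshift_inj n k)) /= mulrnDr.
by case: eqP.
Qed.

Lemma gwtD_env f u : gwt omD (emb k f * ext F n u) =
  (alpha *+ count_mem x0 u) *: (emb k f * ext F n u).
Proof.
rewrite gwtM gwt_emb omD_ext -scalerAr.
have -> : gwt (fun i => omD (lshift k i)) f = 0.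
  apply/ffunP => J; rewrite !ffunE big1 ?mul0r // => i _.
  by rewrite /omD eq_lrshift.
by rewrite (lin0 (@emb_linear F n k)) mul0r add0r.
Qed.

Lemma gwtE_env f u : gwt omE (emb k f * ext F n u) - emb k f * ext F n u =
  emb k (geuler f) * ext F n u.
Proof.
rewrite gwtM gwt_emb gwt_ext big1_seq => [|i _]; last first.
  by rewrite /omE /= ltnNge leq_addr.
rewrite scale0r mulr0 addr0 geulerE (linB (@emb_linear F n k)) mulrBl.
congr (emb k _ * _ - _); apply/ffunP => J; rewrite !ffunE; congr (_ * _).
by apply: eq_bigr => i _; rewrite /omE /= ltn_ord.
Qed.

Lemma mul_env p q f g u w : ghom p f -> ghom q g -> odd (size u) = p ->
  (emb k f * ext F n u) * (emb k g * ext F n w) =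
  (-1) ^+ (p && q) *: (emb k (f * g) * ext F n (u ++ w)).
Proof.
move=> hf hg pu; rewrite -mulrA [ext F n u * _]mulrA.
rewrite (gmul_superC (@ghom_ext F n k u) (ghom_emb (k:=k) hg)) pu.
by rewrite -scalerAl -scalerAr -mulrA extM mulrA -embM.
Qed.

Lemma kraw_env c d p q f g u w : ghom p f -> ghom q g -> odd (size u) = p ->
  gk c d (emb k f * ext F n u) (emb k g * ext F n w) =
  (-1) ^+ (p && q) *:
    (emb k (kraw c d (count_mem x0 u) (count_mem x0 w) f g) * ext F n (u ++ w)).
Proof.
move=> hf hg pu; rewrite /gk /gkantor /kraw; case: ifP => _; last exact: mul_env.
rewrite /gbr (poisson_env _ hf hg pu) !gwtE_env !gwtD_env -scalerAl -scalerAr.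
rewrite (mul_env w (ghom_geuler hf) hg pu) (mul_env w hf (ghom_geuler hg) pu).
rewrite (linB (@emb_linear F n k)) (linD (@emb_linear F n k)) !(linZ (@emb_linear F n k)).
rewrite mulrBl mulrDl -!scalerAl scalerBr scalerDr !scalerA.
by rewrite ![_ * (-1) ^+ _]mulrC.
Qed.

End RawProduct.

(** * The deformed bimodule is Jordan *)

Section KalphaJordan.
Variables (F : fieldType) (n : nat) (alpha : F).
Local Notation G := (gring F n).
Local Notation A := (split_null_ext (Kalpha n alpha)).
Local Notation raw := (kraw alpha).
Local Notation m := (@sa_mul F A).
Implicit Types (f g : G) (c d p q : bool) (mu nu : nat).

(** The null extension, graded by the number [mu] of factors from the bimodule;
    products of two of them vanish. *)
Definition el c mu f : A :=
  match mu with
  | 0%N => (kel c f, 0)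
  | 1%N => (0, kel c f)
  | _ => 0
  end.

Lemma el_linear c mu : linear (el c mu).
Proof.
case: mu => [|[|mu]] a f g /=; last by rewrite scaler0 addr0.
  by congr pair; [exact: kel_linear | rewrite /= scaler0 addr0].
by congr pair; [rewrite /= scaler0 addr0 | exact: kel_linear].
Qed.

Lemma ext_mulE (x y : A) : m x y =
  (kan_mul x.1 y.1, kal_l alpha x.1 y.2 + kal_r alpha x.2 y.1).
Proof. by []. Qed.

Lemma ext_mul_linear (x : A) : linear (m x).
Proof.
move=> a y z; rewrite !ext_mulE /=; congr pair.
  have := kal_r_linear 0 x.1 a y.1 z.1; rewrite /kal_r !scale0r !subr0; exact.
by rewrite kal_l_linear kal_r_linear /= scalerDr addrACA.
Qed.

Lemma ext_mul_linearl (y : A) : linear (fun x => m x y).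
Proof.
move=> a x z; rewrite !ext_mulE /=; congr pair.
  have := kal_r_linearl 0 y.1 a x.1 z.1; rewrite /kal_r !scale0r !subr0; exact.
by rewrite kal_l_linearl kal_r_linearl /= scalerDr addrACA.
Qed.

Section KelProducts.
Variables (q : bool) (f g : G).
Hypothesis hg : ghom q g.

Let gq := ghom_gpar hg.
Let gp0 : gpar (0 : G) = 0 := lin0 (@gpar_linear F n).
Let br0 h : gbracket h (0 : G) = 0 :> G := lin0 (gbracket_linear h).
Let br0l h : gbracket (0 : G) h = 0 :> G := lin0 (gbracket_linearl h).
Let brZ a h h' : gbracket h (a *: h' : G) = a *: (gbracket h h' : G) :> G :=
  linZ (gbracket_linear h) a h'.
Let e0 : geuler (0 : G) = 0 := lin0 (@geuler_linear F n).
Let eZ a h : geuler (a *: h : G) = a *: geuler h := linZ (@geuler_linear F n) a h.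
Let zs := (gp0, br0, br0l, e0, mulr0, mul0r, scaler0, subr0, addr0, add0r, mulr0n,
           scale0r, mulr1n, oppr0).

Lemma kel_kan c d : kan_mul (kel c f) (kel d g) =
  (-1) ^+ (c && q) *: kel (c (+) d) (raw c d 0 0 f g).
Proof.
rewrite kan_mulE /raw; case: c; case: d => /=; rewrite ?gq ?zs ?scale1r //.
- by congr pair; rewrite /= ?scaler0 // brZ.
- by congr pair; rewrite /= ?scaler0 // -scalerAr.
Qed.

Lemma kel_l c d : kal_l alpha (kel c f) (kel d g) =
  (-1) ^+ (c && q) *: kel (c (+) d) (raw c d 0 1 f g).
Proof.
rewrite /kal_l /raw; case: c; case: d => /=; rewrite ?gq ?zs ?scale1r //.
- congr pair; rewrite /= ?scaler0 // brZ -scalerAr scalerDr !scalerA.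
  by rewrite [alpha * _]mulrC.
- by congr pair; rewrite /= ?scaler0 // -scalerAr.
Qed.

Lemma kel_r c d : kal_r alpha (kel c f) (kel d g) =
  (-1) ^+ (c && q) *: kel (c (+) d) (raw c d 1 0 f g).
Proof.
rewrite /kal_r /raw; case: c; case: d => /=; rewrite ?gq ?zs ?scale1r //.
- congr pair; rewrite /= ?scaler0 // brZ eZ -scalerAr scalerBr !scalerA.
  by rewrite [alpha * _]mulrC.
- by congr pair; rewrite /= ?scaler0 // -scalerAr.
Qed.

End KelProducts.

Lemma el_mul q c d mu nu f g : ghom q g ->
  m (el c mu f) (el d nu g) =
  (-1) ^+ (c && q) *: el (c (+) d) (mu + nu) (raw c d mu nu f g).
Proof.
move=> hg.
have m0 x : m 0 x = 0 by exact: (lin0 (ext_mul_linearl x)).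
have m0r x : m x 0 = 0 by exact: (lin0 (ext_mul_linear x)).
have kr0 x : kal_r alpha x 0 = 0 by exact: (lin0 (kal_r_linear alpha x)).
have k0r x : kal_r alpha 0 x = 0 by exact: (lin0 (kal_r_linearl alpha x)).
have kl0 x : kal_l alpha x 0 = 0 by exact: (lin0 (kal_l_linear alpha x)).
have k0l x : kal_l alpha 0 x = 0 by exact: (lin0 (kal_l_linearl alpha x)).
have km0 (x : G * G) : kan_mul x 0 = 0.
  by have := kal_r_linear 0 x; rewrite /kal_r => /lin0; rewrite !scale0r !subr0.
have k0m (x : G * G) : kan_mul 0 x = 0.
  by have := kal_r_linearl 0 x; rewrite /kal_r => /lin0; rewrite !scale0r !subr0.
case: mu => [|[|mu]] /=; case: nu => [|[|nu]] /=; rewrite ?m0 ?m0r ?scaler0 //;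
  rewrite ?km0 ?k0m ?kr0 ?k0r ?kl0 ?k0l ?addr0 ?add0r //.
- by rewrite (kel_kan f hg); congr pair; rewrite /= scaler0.
- by rewrite (kel_l f hg); congr pair; rewrite /= scaler0.
- by rewrite (kel_r f hg); congr pair; rewrite /= scaler0.
Qed.

(** Stated for abstract terms, because rewriting inside the products of the
    algebra would unfold them. *)
Lemma eq_six (V : lmodType F) (s2 s3 s5 s6 : F) (a1 a2 a3 a4 a5 a6 b1 b2 b3 b4 b5 b6 : V) :
  a1 = b1 -> a2 = b2 -> a3 = b3 -> a4 = b4 -> a5 = b5 -> a6 = b6 ->
  (a1 + s2 *: a2 + s3 *: a3 = a4 + s5 *: a5 + s6 *: a6) <->
  (b1 + s2 *: b2 + s3 *: b3 = b4 + s5 *: b5 + s6 *: b6).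
Proof. by move=> -> -> -> -> -> ->. Qed.

Lemma eq_sign_six (V : lmodType F) (s1 s2 s3 s4 s5 s6 t1 t2 t3 t4 t5 t6 : bool)
    (a1 a2 a3 a4 a5 a6 : V) :
  t1 = s1 -> t2 = s2 -> t3 = s3 -> t4 = s4 -> t5 = s5 -> t6 = s6 ->
  (-1) ^+ s1 *: a1 + (-1) ^+ s2 *: a2 + (-1) ^+ s3 *: a3 =
  (-1) ^+ s4 *: a4 + (-1) ^+ s5 *: a5 + (-1) ^+ s6 *: a6 ->
  (-1) ^+ t1 *: a1 + (-1) ^+ t2 *: a2 + (-1) ^+ t3 *: a3 =
  (-1) ^+ t4 *: a4 + (-1) ^+ t5 *: a5 + (-1) ^+ t6 *: a6.
Proof. by move=> -> -> -> -> -> ->. Qed.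

Lemma lin_six (U V : lmodType F) (h : U -> V) (k s1 s2 s3 s4 s5 s6 : F) r1 r2 r3 r4 r5 r6 :
  linear h ->
  s1 *: r1 + s2 *: r2 + s3 *: r3 = s4 *: r4 + s5 *: r5 + s6 *: r6 ->
  (k * s1) *: h r1 + (k * s2) *: h r2 + (k * s3) *: h r3 =
  (k * s4) *: h r4 + (k * s5) *: h r5 + (k * s6) *: h r6.
Proof.
move=> hl /(congr1 (fun r => k *: h r)).
by rewrite !(linD hl) !(linZ hl) !scalerDr !scalerA.
Qed.

Section FourElements.
Variables (c p : nat -> bool) (mu : nat -> nat) (f : nat -> G).
Hypothesis hf : forall a, ghom (p a) (f a).

Let x a := el (c a) (mu a) (f a).

Let raw3 (a b e d : nat) :=
  raw (c a (+) c b (+) c e) (c d) (mu a + mu b + mu e) (mu d)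
    (raw (c a (+) c b) (c e) (mu a + mu b) (mu e) (raw (c a) (c b) (mu a) (mu b) (f a) (f b))
       (f e)) (f d).

Let raw22 (a b e d : nat) :=
  raw (c a (+) c b) (c e (+) c d) (mu a + mu b) (mu e + mu d)
    (raw (c a) (c b) (mu a) (mu b) (f a) (f b)) (raw (c e) (c d) (mu e) (mu d) (f e) (f d)).

Let mZ k y z : m (k *: y) z = k *: m y z.
Proof. exact: (linZ (ext_mul_linearl z)). Qed.
Let mZr k y z : m y (k *: z) = k *: m y z.
Proof. exact: (linZ (ext_mul_linear y)). Qed.

Lemma el3 (a b e d : nat) : m (m (m (x a) (x b)) (x e)) (x d) =
  (-1) ^+ ((c a && p b) (+) ((c a (+) c b) && p e) (+) ((c a (+) c b (+) c e) && p d))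
    *: el (c a (+) c b (+) c e (+) c d) (mu a + mu b + mu e + mu d) (raw3 a b e d).
Proof.
by rewrite /x (el_mul _ _ _ _ _ (@hf b)) mZ (el_mul _ _ _ _ _ (@hf e)) !mZ
  (el_mul _ _ _ _ _ (@hf d)) !scalerA -!signr_addb.
Qed.

Lemma el22 (a b e d : nat) : m (m (x a) (x b)) (m (x e) (x d)) =
  (-1) ^+ ((c a && p b) (+) (c e && p d) (+) ((c a (+) c b) && (p e (+) p d)))
    *: el (c a (+) c b (+) c e (+) c d) (mu a + mu b + mu e + mu d) (raw22 a b e d).
Proof.
rewrite /x (el_mul _ _ _ _ _ (@hf b)) (el_mul _ _ _ _ _ (@hf d)) mZ mZr.
rewrite (el_mul _ _ _ _ _ (ghom_kraw _ _ _ _ _ (@hf e) (@hf d))) !scalerA -!signr_addb.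
by rewrite !addbA !addnA.
Qed.

(** ** The envelope *)

(* The factor [a] is made even by its own letter [a] when it is odd. A factor
   from the bimodule also gets the letters 4 and 5: their product is even with
   square zero, and letter 4 carries the weight [alpha]. *)
Let letter (a : nat) : 'I_6 := inZp a.
Let u a := nseq (p a) (letter a) ++ nseq (mu a) (letter 4) ++ nseq (mu a) (letter 5).

Let size_u a : odd (size (u a)) = p a.
Proof. by rewrite !size_cat !size_nseq oddD addnn odd_double addbF oddb. Qed.

Let count_u a : (a < 4)%N -> count_mem (letter 4) (u a) = mu a.
Proof.
move=> a4; have e4 : pred1 (letter 4) (letter a) = false.
  by apply/negP => /eqP/(congr1 val) /=; rewrite modn_small; lia.
by rewrite !count_cat !count_nseq e4 mul0n add0n mul1n addn0.
Qed.

Let size_cat_u v a q : odd (size v) = q -> odd (size (v ++ u a)) = q (+) p a.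
Proof. by rewrite size_cat oddD size_u => ->. Qed.

Let count_cat_u v a nu : count_mem (letter 4) v = nu -> (a < 4)%N ->
  count_mem (letter 4) (v ++ u a) = (nu + mu a)%N.
Proof. by move=> <- a4; rewrite count_cat count_u. Qed.

Let gk := gkantor (fun i : 'I_(n + 6) => (i < n)%N) (fun i => ((i < n)%N)%:R : F)
  (fun i => if i == rshift n (letter 4) then alpha else 0).

Let X a := emb 6 (f a) * ext F n (u a).

Let gkZ b d k (y z : gring F (n + 6)) : gk b d (k *: y) z = k *: gk b d y z.
Proof. exact: gkantorZl. Qed.
Let gkZr b d k (y z : gring F (n + 6)) : gk b d y (k *: z) = k *: gk b d y z.
Proof. exact: gkantorZr. Qed.

Let kE c1 d p1 q (f1 g : G) v w (h1 : ghom p1 f1) (h2 : ghom q g) (pv : odd (size v) = p1) :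
  gk c1 d (emb 6 f1 * ext F n v) (emb 6 g * ext F n w) =
  (-1) ^+ (p1 && q) *: (emb 6 (raw c1 d (count_mem (letter 4) v) (count_mem (letter 4) w) f1 g)
     * ext F n (v ++ w)) := kraw_env alpha (letter 4) c1 d w h1 h2 pv.

Lemma env3 (a b e d : nat) : (a < 4)%N -> (b < 4)%N -> (e < 4)%N -> (d < 4)%N ->
  gk (c a (+) c b (+) c e) (c d) (gk (c a (+) c b) (c e) (gk (c a) (c b) (X a) (X b)) (X e)) (X d) =
  (-1) ^+ ((p a && p b) (+) ((p a (+) p b) && p e) (+) ((p a (+) p b (+) p e) && p d))
    *: (emb 6 (raw3 a b e d) * ext F n (u a ++ u b ++ u e ++ u d)).
Proof.
move=> a4 b4 e4 d4; have h2 := ghom_kraw alpha (c a) (c b) (mu a) (mu b) (@hf a) (@hf b).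
have h3 := ghom_kraw alpha (c a (+) c b) (c e) (mu a + mu b) (mu e) h2 (@hf e).
have s2 := size_cat_u b (size_u a); have s3 := size_cat_u e s2.
have n2 := count_cat_u (count_u a4) b4; have n3 := count_cat_u n2 e4.
rewrite /X (kE _ _ _ (@hf a) (@hf b) (size_u a)) !count_u // gkZ.
rewrite (kE _ _ _ h2 (@hf e) s2) n2 count_u // !gkZ.
rewrite (kE _ _ _ h3 (@hf d) s3) n3 count_u //.
by rewrite !scalerA -!signr_addb -!catA; congr (_ ^+ _ *: _); do !case: (p _).
Qed.

Lemma env22 (a b e d : nat) : (a < 4)%N -> (b < 4)%N -> (e < 4)%N -> (d < 4)%N ->
  gk (c a (+) c b) (c e (+) c d) (gk (c a) (c b) (X a) (X b)) (gk (c e) (c d) (X e) (X d)) =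
  (-1) ^+ ((p a && p b) (+) (p e && p d) (+) ((p a (+) p b) && (p e (+) p d)))
    *: (emb 6 (raw22 a b e d) * ext F n (u a ++ u b ++ u e ++ u d)).
Proof.
move=> a4 b4 e4 d4; have h2 := ghom_kraw alpha (c a) (c b) (mu a) (mu b) (@hf a) (@hf b).
have h3 := ghom_kraw alpha (c e) (c d) (mu e) (mu d) (@hf e) (@hf d).
have s2 := size_cat_u b (size_u a).
have n2 := count_cat_u (count_u a4) b4; have n3 := count_cat_u (count_u e4) d4.
rewrite /X (kE _ _ _ (@hf a) (@hf b) (size_u a)) (kE _ _ _ (@hf e) (@hf d) (size_u e)).
rewrite !count_u // gkZ gkZr (kE _ _ _ h2 h3 s2) n2 n3 !scalerA -!signr_addb -!catA.
by congr (_ ^+ _ *: _); do !case: (p _).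
Qed.

Let X_even a : ghom false (X a).
Proof.
by have := ghomM (ghom_emb (k:=6) (@hf a)) (@ghom_ext F n 6 (u a)); rewrite size_u addbb.
Qed.

Let u_swap v a b w : ext F n (v ++ u a ++ u b ++ w) =
  (-1) ^+ (p a && p b) *: ext F n (v ++ u b ++ u a ++ w).
Proof. by rewrite ext_swap !size_u. Qed.

Let U := u 0 ++ u 1 ++ u 2 ++ u 3.

Let uniq_U : (mu 0 + mu 1 + mu 2 + mu 3 <= 1)%N -> uniq U.
Proof.
rewrite /U /u; move: (mu 0) (mu 1) (mu 2) (mu 3) => [|[|?]] [|[|?]] [|[|?]] [|[|?]] //= _;
by case: (p 0); case: (p 1); case: (p 2); case: (p 3).
Qed.

(** The Jordan identity of the envelope, once the letters have been sorted into
    [U] in each of its six terms. *)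
Lemma raw_jordan : (mu 0 + mu 1 + mu 2 + mu 3 <= 1)%N ->
  let sg k (b : bool) := (-1) ^+ (odd k (+) b) : F in
  sg 0 ((p 0 && p 1) (+) ((p 0 (+) p 1) && p 2) (+) ((p 0 (+) p 1 (+) p 2) && p 3))
    *: raw3 0 1 2 3
  + sg ((c 1 && c 2) + (c 1 && c 3) + (c 2 && c 3))%N
       ((p 0 && p 3) (+) ((p 0 (+) p 3) && p 2) (+) ((p 0 (+) p 3 (+) p 2) && p 1)
        (+) (p 1 && p 2) (+) (p 1 && p 3) (+) (p 2 && p 3))
    *: raw3 0 3 2 1
  + sg ((c 0 && c 1) + (c 0 && c 2) + (c 0 && c 3) + (c 2 && c 3))%N
       ((p 1 && p 3) (+) ((p 1 (+) p 3) && p 2) (+) ((p 1 (+) p 3 (+) p 2) && p 0)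
        (+) (p 0 && p 1) (+) (p 0 && p 2) (+) (p 0 && p 3) (+) (p 2 && p 3))
    *: raw3 1 3 2 0
  = sg 0 ((p 0 && p 1) (+) (p 2 && p 3) (+) ((p 0 (+) p 1) && (p 2 (+) p 3)))
    *: raw22 0 1 2 3
  + sg (c 1 && c 2) ((p 0 && p 2) (+) (p 1 && p 3) (+) ((p 0 (+) p 2) && (p 1 (+) p 3))
        (+) (p 1 && p 2))
    *: raw22 0 2 1 3
  + sg (c 3 && (c 1 (+) c 2)) ((p 0 && p 3) (+) (p 1 && p 2) (+) ((p 0 (+) p 3) && (p 1 (+) p 2))
        (+) (p 1 && p 3) (+) (p 2 && p 3))
    *: raw22 0 3 1 2.
Proof.
move=> mu1 sg; apply/eqP; rewrite -subr_eq0; apply/eqP.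
apply: (emb_ext_eq0 (uniq_U mu1)).
have := @gkantor_jordan F (n + 6) (fun i => (i < n)%N) (fun i => ((i < n)%N)%:R : F)
  (fun i => if i == rshift n (letter 4) then alpha else 0).
have e1 : {in (fun i : 'I_(n + 6) => (i < n)%N), forall i : 'I_(n + 6), ((i < n)%N)%:R = 1 :> F}.
  by move=> i; rewrite unfold_in => ->.
have e2 : {in (fun i : 'I_(n + 6) => (i < n)%N), forall i : 'I_(n + 6),
    (if i == rshift n (letter 4) then alpha else 0) = 0 :> F}.
  by move=> i; rewrite unfold_in; case: eqP => // -> /=; rewrite ltnNge leq_addr.
move/(_ e1 e2 (c 0) (c 1) (c 2) (c 3) _ _ _ _ (X_even 0) (X_even 1) (X_even 2) (X_even 3)).
move=> E; lazy zeta in E; rewrite -/gk in E.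
have {}E := (eq_six _ _ _ _ (@env3 0 1 2 3 isT isT isT isT) (@env3 0 3 2 1 isT isT isT isT)
  (@env3 1 3 2 0 isT isT isT isT) (@env22 0 1 2 3 isT isT isT isT)
  (@env22 0 2 1 3 isT isT isT isT) (@env22 0 3 1 2 isT isT isT isT)).1 E.
have U2 : ext F n (u 0 ++ u 3 ++ u 2 ++ u 1) =
    (-1) ^+ ((p 1 && p 2) (+) (p 1 && p 3) (+) (p 2 && p 3)) *: ext F n U.
  rewrite (u_swap (u 0) 3 2 (u 1)).
  have := u_swap (u 0 ++ u 2) 3 1 [::]; rewrite !cats0 -!(catA (u 0) (u 2)) => ->.
  rewrite (u_swap (u 0) 2 1 (u 3)).
  rewrite !scalerA -!signr_addb; congr (_ ^+ _ *: _).
  by case: (p 1); case: (p 2); case: (p 3).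
have U3 : ext F n (u 1 ++ u 3 ++ u 2 ++ u 0) =
    (-1) ^+ ((p 0 && p 1) (+) (p 0 && p 2) (+) (p 0 && p 3) (+) (p 2 && p 3)) *: ext F n U.
  have := u_swap (u 1 ++ u 3) 2 0 [::]; rewrite !cats0 -!(catA (u 1) (u 3)) => ->.
  rewrite (u_swap (u 1) 3 0 (u 2)).
  rewrite (u_swap [::] 1 0 (u 3 ++ u 2)) /=.
  have := u_swap (u 0 ++ u 1) 3 2 [::]; rewrite !cats0 -!(catA (u 0) (u 1)) => ->.
  rewrite !scalerA -!signr_addb; congr (_ ^+ _ *: _).
  by case: (p 0); case: (p 1); case: (p 2); case: (p 3).
have U5 : ext F n (u 0 ++ u 2 ++ u 1 ++ u 3) = (-1) ^+ (p 1 && p 2) *: ext F n U.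
  by rewrite (u_swap (u 0) 2 1 (u 3)) andbC.
have U6 : ext F n (u 0 ++ u 3 ++ u 1 ++ u 2) =
    (-1) ^+ ((p 1 && p 3) (+) (p 2 && p 3)) *: ext F n U.
  rewrite (u_swap (u 0) 3 1 (u 2)).
  have := u_swap (u 0 ++ u 1) 3 2 [::]; rewrite !cats0 -!(catA (u 0) (u 1)) => ->.
  by rewrite !scalerA -!signr_addb andbC [p 3 && p 2]andbC.
move: E; rewrite U2 U3 U5 U6 => E.
rewrite (linB (@emb_linear F n 6)) !(linD (@emb_linear F n 6)) !(linZ (@emb_linear F n 6)).
rewrite mulrBl !mulrDl -!scalerAl.
apply/eqP; rewrite subr_eq0; apply/eqP.
move: E; rewrite -!scalerAr !scalerA -/U /sg !addFb.
rewrite -![in X in X -> _](signr_odd _ (_ + _)%N) -!signr_addb => E.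
by rewrite ?oddb !addbA in E *; exact: E.
Qed.

Let par a := c a (+) p a.

Lemma el_jordan :
  m (m (m (x 0) (x 1)) (x 2)) (x 3)
  + (-1) ^+ ((par 1 && par 2) + (par 1 && par 3) + (par 2 && par 3))%N
      *: m (m (m (x 0) (x 3)) (x 2)) (x 1)
  + (-1) ^+ ((par 0 && par 1) + (par 0 && par 2) + (par 0 && par 3) + (par 2 && par 3))%N
      *: m (m (m (x 1) (x 3)) (x 2)) (x 0)
  = m (m (x 0) (x 1)) (m (x 2) (x 3))
  + (-1) ^+ (par 1 && par 2) *: m (m (x 0) (x 2)) (m (x 1) (x 3))
  + (-1) ^+ (par 3 && (par 1 (+) par 2)) *: m (m (x 0) (x 3)) (m (x 1) (x 2)).
Proof.
apply: (eq_six _ _ _ _ (el3 0 1 2 3) (el3 0 3 2 1) (el3 1 3 2 0)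
  (el22 0 1 2 3) (el22 0 2 1 3) (el22 0 3 1 2)).2.
have -> : (mu 0 + mu 3 + mu 2 + mu 1 = mu 0 + mu 1 + mu 2 + mu 3)%N by lia.
have -> : (mu 1 + mu 3 + mu 2 + mu 0 = mu 0 + mu 1 + mu 2 + mu 3)%N by lia.
have -> : (mu 0 + mu 2 + mu 1 + mu 3 = mu 0 + mu 1 + mu 2 + mu 3)%N by lia.
have -> : (mu 0 + mu 3 + mu 1 + mu 2 = mu 0 + mu 1 + mu 2 + mu 3)%N by lia.
have [mu1|mu2] := leqP (mu 0 + mu 1 + mu 2 + mu 3) 1; last first.
  have el0 c0 nu g : (1 < nu)%N -> el c0 nu g = 0 by case: nu => [|[|nu]].
  by rewrite !(el0 _ _ _ mu2) !scaler0 !addr0.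
have := raw_jordan mu1.
set M := (mu 0 + mu 1 + mu 2 + mu 3)%N; lazy zeta.
have -> : c 0 (+) c 3 (+) c 2 (+) c 1 = c 0 (+) c 1 (+) c 2 (+) c 3.
  by case: (c 0); case: (c 1); case: (c 2); case: (c 3).
have -> : c 1 (+) c 3 (+) c 2 (+) c 0 = c 0 (+) c 1 (+) c 2 (+) c 3.
  by case: (c 0); case: (c 1); case: (c 2); case: (c 3).
have -> : c 0 (+) c 2 (+) c 1 (+) c 3 = c 0 (+) c 1 (+) c 2 (+) c 3.
  by case: (c 0); case: (c 1); case: (c 2); case: (c 3).
have -> : c 0 (+) c 3 (+) c 1 (+) c 2 = c 0 (+) c 1 (+) c 2 (+) c 3.
  by case: (c 0); case: (c 1); case: (c 2); case: (c 3).
set C := c 0 (+) c 1 (+) c 2 (+) c 3.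
(* the sign that turns the products of the envelope into those of the algebra *)
pose kap := ((c 0 && p 1) (+) ((c 0 (+) c 1) && p 2) (+) ((c 0 (+) c 1 (+) c 2) && p 3)
   (+) ((p 0 && p 1) (+) ((p 0 (+) p 1) && p 2) (+) ((p 0 (+) p 1 (+) p 2) && p 3))).
move: (raw3 0 1 2 3) (raw3 0 3 2 1) (raw3 1 3 2 0) (raw22 0 1 2 3) (raw22 0 2 1 3) (raw22 0 3 1 2).
move=> r1 r2 r3 r4 r5 r6 /(lin_six ((-1) ^+ kap) (el_linear C M)).
rewrite -!signr_addb => E.
rewrite -[(-1) ^+ (_ + _ + _ + _)%N]signr_odd -[(-1) ^+ (_ + _ + _)%N]signr_odd.
rewrite !scalerA -!signr_addb.
rewrite !oddD !oddb /kap /par in E *.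
apply: (eq_sign_six _ _ _ _ _ _ E);
  move: (c 0) (c 1) (c 2) (c 3) (p 0) (p 1) (p 2) (p 3); clear; by do 8!case.
Qed.

End FourElements.

End KalphaJordan.

Section JordanIdentity.
Variables (F : fieldType) (V : lmodType F) (M : V -> V -> V).
Hypothesis M_lin : forall x, linear (M x).
Hypothesis M_linl : forall y, linear (fun x => M x y).

(** The Jordan identity, with arbitrary coefficients for the signs. *)
Definition jordan_at (s2 s3 s5 s6 : F) x y z t :=
  M (M (M x y) z) t + s2 *: M (M (M x t) z) y + s3 *: M (M (M y t) z) x =
  M (M x y) (M z t) + s5 *: M (M x z) (M y t) + s6 *: M (M x t) (M y z).

Variables s2 s3 s5 s6 : F.
Local Notation J := (jordan_at s2 s3 s5 s6).

Let D u v w : M (u + v) w = M u w + M v w.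
Proof. exact: (linD (M_linl w)). Qed.
Let Dr u v w : M u (v + w) = M u v + M u w.
Proof. exact: (linD (M_lin u)). Qed.
Let S (a b c d e f a' b' c' d' e' f' : V) :
  a + b + c = d + e + f -> a' + b' + c' = d' + e' + f' ->
  (a + a') + (b + b') + (c + c') = (d + d') + (e + e') + (f + f').
Proof.
move=> E E'; transitivity ((a + b + c) + (a' + b' + c')); first by zmod.
by rewrite E E'; zmod.
Qed.

Lemma jordan_at_addx x x' y z t : J x y z t -> J x' y z t -> J (x + x') y z t.
Proof. by rewrite /jordan_at !(D, Dr) !scalerDr; exact: S. Qed.
Lemma jordan_at_addy x y y' z t : J x y z t -> J x y' z t -> J x (y + y') z t.
Proof. by rewrite /jordan_at !(D, Dr) !scalerDr; exact: S. Qed.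
Lemma jordan_at_addz x y z z' t : J x y z t -> J x y z' t -> J x y (z + z') t.
Proof. by rewrite /jordan_at !(D, Dr) !scalerDr; exact: S. Qed.
Lemma jordan_at_addt x y z t t' : J x y z t -> J x y z t' -> J x y z (t + t').
Proof. by rewrite /jordan_at !(D, Dr) !scalerDr; exact: S. Qed.

End JordanIdentity.

Section KalphaBimodule.
Variables (F : fieldType) (n : nat) (alpha : F).
Local Notation G := (gring F n).
Local Notation A := (split_null_ext (Kalpha n alpha)).
Local Notation raw := (kraw alpha).
Local Notation m := (@sa_mul F A).
Implicit Types (f g : G) (c d p q i j : bool) (mu nu : nat).

Lemma kan_pr_linear b : linear (@kan_pr F n b).
Proof.
move=> a x y; congr pair; apply/ffunP => J; rewrite !ffunE;
  by case: ifP => _ //; rewrite scaler0 addr0.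
Qed.

Lemma kan_pr_grading : @is_grading F (G * G)%type (@kan_pr F n).
Proof.
split=> [|b c x|x]; first exact: kan_pr_linear.
- by rewrite /kan_pr; case: eqP => [<-|ne]; congr pair; apply/ffunP => J; rewrite !ffunE /=;
    case: eqP => // E; rewrite ?ffunE /=; case: eqP => // E'; case: ne; rewrite -E.
- case: x => f g; congr pair; apply/ffunP => J; rewrite !ffunE /=;
    by case: (odd _); rewrite /= ?addr0 ?add0r.
Qed.

Lemma kan_homogP b (x : G * G) :
  homog (V := (G * G)%type) (@kan_pr F n) b x <-> ghom b x.1 /\ ghom (~~ b) x.2.
Proof.
split=> [<-|[h1 h2]].
  split=> J E; rewrite ffunE; first by rewrite (negbTE E).
  by move: E; case: (odd _); case: (b).
case: x h1 h2 => f g h1 h2; congr pair; apply/ffunP => J; rewrite ffunE /=.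
  by case: ifP => // /negbT E; rewrite h1.
case: ifP => // /negbT E; rewrite h2 //.
by move: E; case: (odd _); case: (b).
Qed.

Lemma hom_el p c mu f : ghom p f -> homog (@sa_pr F A) (c (+) p) (el alpha c mu f).
Proof.
have K0 b : kan_pr b (0 : G * G) = 0 by exact: (lin0 (kan_pr_linear b)).
have hk : ghom p f -> homog (V := (G * G)%type) (@kan_pr F n) (c (+) p) (kel c f).
  move=> hf; apply/kan_homogP; case: c => /=; split; rewrite ?addTb ?addFb ?negbK //;
  exact: ghom0.
by move=> /hk hf; case: mu => [|[|mu]]; rewrite /homog /= ?hf ?K0 //; congr pair; rewrite K0.
Qed.

(** Reduces multilinear statements to the elements [el c mu f]. *)
Lemma hom_span i (P : A -> Prop) :
  (forall x y, P x -> P y -> P (x + y)) ->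
  (forall p c mu f, c (+) p = i -> ghom p f -> P (el alpha c mu f)) ->
  forall x, homog (@sa_pr F A) i x -> P x.
Proof.
move=> PD Pel [x y] [hx hy].
have [h1 h2] := (kan_homogP i x).1 hx; have [h3 h4] := (kan_homogP i y).1 hy.
have -> : (x, y) = el alpha false 0 x.1 + el alpha true 0 x.2 +
   (el alpha false 1 y.1 + el alpha true 1 y.2) :> A.
  congr pair; rewrite /= ?addr0 ?add0r; exact: kelE.
by apply: (PD); apply: (PD); [apply: (Pel i)|apply: (Pel (~~ i))|apply: (Pel i)|apply: (Pel (~~ i))];
  rewrite ?addFb ?addTb ?negbK.
Qed.

Lemma kraw_sym p q c d mu nu f g : ghom p f -> ghom q g ->
  raw c d mu nu f g = (-1) ^+ ((c && d) (+) (p && q)) *: raw d c nu mu g f.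
Proof.
move=> hf hg; rewrite /kraw [d && c]andbC; case: (c && d) => /=; last exact: gmul_superC.
rewrite (gmul_superC (ghom_geuler hf) hg) (gmul_superC hf (ghom_geuler hg)).
have -> : gbracket f g = (-1) ^+ (~~ (p && q)) *: (gbracket g f : G) :> G.
  rewrite !gbracketE scaler_sumr; apply: eq_bigr => k _.
  rewrite (ghom_gpar hf) (ghom_gpar hg) !(linZ (gder_linear k)) -!scalerAl scalerA.
  rewrite (gmul_superC (ghom_gder k hf) (ghom_gder k hg)) scalerA -!signr_addb.
  by congr (_ ^+ _ *: _); case: (p); case: (q).
rewrite scalerBr scalerDr -!addrA; congr (_ + _).
rewrite [RHS]addrC; congr (_ + _).
  by rewrite !scalerA -!scaleNr; congr (_ *: _); case: (_ && _);
    rewrite /= ?expr1 ?expr0 ?mulN1r ?mul1r ?mulrN1 ?mulr1 ?opprK.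
by rewrite !scalerA -!scaleNr; congr (_ *: _); case: (_ && _);
  rewrite /= ?expr1 ?expr0 ?mulN1r ?mul1r ?mulrN1 ?mulr1 ?opprK.
Qed.

Lemma ext_homM i j (x y : A) :
  homog (@sa_pr F A) i x -> homog (@sa_pr F A) j y ->
  homog (@sa_pr F A) (i (+) j) (m x y).
Proof.
have L b : linear (@sa_pr F A b) by move=> a u v; congr pair; apply: kan_pr_linear.
have hD b (u v : A) : homog (@sa_pr F A) b u -> homog (@sa_pr F A) b v ->
    homog (@sa_pr F A) b (u + v) by rewrite /homog (linD (L b)) => -> ->.
have hZ b a (u : A) : homog (@sa_pr F A) b u -> homog (@sa_pr F A) b (a *: u).
  by rewrite /homog (linZ (L b)) => ->.
move=> hx hy; move: x hx; apply: hom_span => [x1 x2 h1 h2|p c mu f ci hf].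
  by rewrite (linD (ext_mul_linearl y)); apply: hD.
move: y hy; apply: hom_span => [y1 y2 h1 h2|q d nu g dj hg].
  by rewrite (linD (ext_mul_linear _)); apply: hD.
rewrite (el_mul _ _ _ _ _ _ hg); apply: hZ.
have := hom_el (c (+) d) (mu + nu) (ghom_kraw alpha c d mu nu hf hg).
by rewrite -ci -dj addbACA.
Qed.

Lemma ext_superC i j (x y : A) :
  homog (@sa_pr F A) i x -> homog (@sa_pr F A) j y ->
  m x y = (-1) ^+ (i && j) *: m y x.
Proof.
move=> hx hy; move: x hx; apply: hom_span => [x1 x2 h1 h2|p c mu f ci hf].
  by rewrite (linD (ext_mul_linearl y)) (linD (ext_mul_linear y)) h1 h2 scalerDr.
move: y hy; apply: hom_span => [y1 y2 h1 h2|q d nu g dj hg].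
  by rewrite (linD (ext_mul_linear _)) (linD (ext_mul_linearl _)) h1 h2 scalerDr.
rewrite (el_mul _ _ _ _ _ _ hg) (el_mul _ _ _ _ _ _ hf) (kraw_sym _ _ _ _ hf hg).
rewrite [(nu + mu)%N]addnC [d (+) c]addbC (linZ (el_linear _ _ _)) !scalerA -!signr_addb.
by rewrite -ci -dj; congr (_ ^+ _ *: _); case: (c); case: (d); case: (p); case: (q).
Qed.

Lemma ext_jordan (i j k l : bool) (x y z t : A) :
  homog (@sa_pr F A) i x -> homog (@sa_pr F A) j y ->
  homog (@sa_pr F A) k z -> homog (@sa_pr F A) l t ->
  m (m (m x y) z) t
  + (-1) ^+ ((j && k) + (j && l) + (k && l))%N *: m (m (m x t) z) y
  + (-1) ^+ ((i && j) + (i && k) + (i && l) + (k && l))%N *: m (m (m y t) z) x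
  = m (m x y) (m z t)
  + (-1) ^+ (j && k) *: m (m x z) (m y t)
  + (-1) ^+ (l && (j (+) k)) *: m (m x t) (m y z).
Proof.
move=> hx hy hz ht.
have L := ext_mul_linear (n := n) (alpha := alpha).
have Ll := ext_mul_linearl (n := n) (alpha := alpha).
move: x hx; apply: hom_span => [x1 x2|p1 c1 mu1 f1 <- hf1].
  exact: jordan_at_addx L Ll _ _ _ _ _ _ _ _ _.
move: y hy; apply: hom_span => [x1 x2|p2 c2 mu2 f2 <- hf2].
  exact: jordan_at_addy L Ll _ _ _ _ _ _ _ _ _.
move: z hz; apply: hom_span => [x1 x2|p3 c3 mu3 f3 <- hf3].
  exact: jordan_at_addz L Ll _ _ _ _ _ _ _ _ _.
move: t ht; apply: hom_span => [x1 x2|p4 c4 mu4 f4 <- hf4].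
  exact: jordan_at_addt L Ll _ _ _ _ _ _ _ _ _.
(* [el_jordan] takes its four elements as a sequence *)
pose sel T (a b c d : T) (e : nat) := if e == 0%N then a else if e == 1%N then b else
  if e == 2 then c else d.
have hf e : ghom (sel _ p1 p2 p3 p4 e) (sel _ f1 f2 f3 f4 e).
  by rewrite /sel; case: e => [|[|[|e]]].
exact: (@el_jordan F n alpha (sel _ c1 c2 c3 c4) _ (sel _ mu1 mu2 mu3 mu4) _ hf).
Qed.

Lemma Kalpha_superbimod : is_superbimod (Kalpha n alpha).
Proof.
split.
- exact: kan_pr_grading.
- by split; [exact: kal_l_linear | exact: kal_l_linearl].
- by split; [exact: kal_r_linear | exact: kal_r_linearl].
- move=> i j a v ha hv.
  have K0 b : kan_pr b (0 : G * G) = 0 by exact: (lin0 (kan_pr_linear b)).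
  have h1 : homog (@sa_pr F A) i (a, 0 : Kalpha n alpha) by congr pair; rewrite ?ha //= K0.
  have h2 : homog (@sa_pr F A) j (0 : Kan F n, v) by congr pair; rewrite ?hv //= K0.
  have E : kan_pr (i (+) j) (kal_l alpha a v + kal_r alpha 0 (0 : G * G)) =
    kal_l alpha a v + kal_r alpha 0 (0 : G * G) := congr1 snd (ext_homM h1 h2).
  by rewrite (lin0 (kal_r_linear alpha _)) addr0 in E.
- move=> i j a v ha hv.
  have K0 b : kan_pr b (0 : G * G) = 0 by exact: (lin0 (kan_pr_linear b)).
  have h1 : homog (@sa_pr F A) i (a, 0 : Kalpha n alpha) by congr pair; rewrite ?ha //= K0.
  have h2 : homog (@sa_pr F A) j (0 : Kan F n, v) by congr pair; rewrite ?hv //= K0.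
  have E : kan_pr (j (+) i) (kal_l alpha 0 (0 : G * G) + kal_r alpha v a) =
    kal_l alpha 0 (0 : G * G) + kal_r alpha v a := congr1 snd (ext_homM h2 h1).
  by rewrite (lin0 (kal_l_linear alpha _)) add0r addbC in E.
Qed.

Lemma Kalpha_jordan : jordan_bimod (Kalpha n alpha).
Proof.
split; first exact: Kalpha_superbimod.
split; [split | exact: ext_superC | exact: ext_jordan].
- have [L P S] := kan_pr_grading; split=> [b a x y|b c x|x].
  + by congr pair; apply: L.
  + by rewrite /= !P; case: eqP.
  + by case: x => x y; congr pair; apply: S.
- by split; [exact: ext_mul_linear | exact: ext_mul_linearl].
- exact: ext_homM.
Qed.

End KalphaBimodule.

(** * V(alpha) is the deformed bimodule *)

Section ValphaModel.
Variables (F : fieldType) (n : nat) (alpha : F).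
Local Notation G := (gring F n).
Local Notation gw := (gword F).
Local Notation sgn := (sgn_word F).
Implicit Types (f g : G) (c d : bool) (A I J : {set 'I_n}) (u w : seq 'I_n).

(** ** The complement map *)

(** The sign for which [gstar] maps a word [w] to v(I_n) acted upon by [w]: by
    definition of the action of e_J, the word is erased from the end of I_n in
    the reverse order. *)
Definition gstar_sign A : F := sgn (enum (~: A) ++ rev (enum A)).

Definition gstar f : G := [ffun I : {set 'I_n} => gstar_sign (~: I) * f (~: I)].

Lemma gstar_linear : linear gstar.
Proof. by move=> a f g; apply/ffunP => I; rewrite !ffunE mulrDr mulrCA. Qed.

Lemma gstar_gbas A : gstar (gbas F A) = gstar_sign A *: gbas F (~: A).
Proof.
apply/ffunP => I; rewrite !ffunE /GRing.scale /= (can2_eq (@setCK _) (@setCK _)).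
by case: eqP => [->|_]; rewrite ?setCK // !mulr0.
Qed.

Lemma gstar_signK A : gstar_sign A * gstar_sign A = 1.
Proof. exact: sgn_sqr. Qed.

Lemma gword_rev w : gw (rev w) = (-1) ^+ 'C(size w, 2) *: gw w :> G.
Proof.
elim: w => [|i w IH]; first by rewrite /= bin0n scale1r.
rewrite rev_cons gword_rcons IH gword_cons -scalerAl binS bin1 exprD.
rewrite (gmul_superC (@ghom_gword F n w) (ghom_gen F i)) andbT scalerA.
by rewrite signr_odd.
Qed.

Lemma sgn_rev w : uniq w -> sgn (rev w) = (-1) ^+ 'C(size w, 2) * sgn w.
Proof.
move=> Uw; have := gword_rev w; rewrite /gword rev_uniq Uw scalerA.
have -> : [set i in rev w] = [set i in w] by apply/setP => i; rewrite !inE mem_rev.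
move=> /ffunP /(_ [set i in w]); rewrite !ffunE eqxx /GRing.scale /=.
by rewrite !mulr1.
Qed.

Lemma sgn_perml u u' w : perm_eq u u' -> sgn (u ++ w) = sgn u * sgn u' * sgn (u' ++ w).
Proof.
move=> pu; rewrite !sgn_cat (perm_crossings pu (perm_refl w)).
by rewrite -[RHS]mulrA !(mulrA (sgn u')) sgn_sqr mul1r mulrA.
Qed.

Lemma sgn_consr i w : uniq (i :: w) -> sgn (i :: w) = (-1) ^+ size w * sgn (w ++ [:: i]).
Proof.
move=> Uw; have := @crossings_swap n [:: i] w Uw; rewrite mul1n => E.
rewrite -cat1s !sgn_cat -E exprD; have := sqrr_sign F (crossings w [:: i]); rewrite expr2.
by move: ((-1) ^+ crossings w [:: i]) ((-1) ^+ crossings [:: i] w) (sgn [:: i]) (sgn w) => x y z t x2; ring: x2.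
Qed.

(** The sign does not depend on the orders chosen for the word and for its
    complement. *)
Lemma gstar_gword u w : perm_eq (u ++ w) (enum 'I_n) ->
  gstar (gw w) = sgn (u ++ rev w) *: gw u.
Proof.
move=> puw; have Uuw : uniq (u ++ w) by rewrite (perm_uniq puw) enum_uniq.
have [Uu Uw] : uniq u /\ uniq w by move: Uuw; rewrite cat_uniq => /and3P[].
have wE : [set i in u] = ~: [set i in w].
  apply/setP => i; rewrite !inE; have := perm_mem puw i.
  rewrite mem_cat mem_enum; case: (boolP (i \in w)) => iw; last by rewrite orbF.
  move=> _; apply/negP => iu; move: Uuw; rewrite cat_uniq => /and3P[_ /hasP[]].
  by exists i.
have pe (v : seq 'I_n) : uniq v -> perm_eq v (enum [set i in v]).
  by move=> Uv; apply: uniq_perm => [//||i]; rewrite ?enum_uniq // mem_enum inE.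
rewrite /gword Uu Uw (linZ gstar_linear) gstar_gbas !scalerA wE; congr (_ *: _).
rewrite /gstar_sign -wE !sgn_cat sgn_enum mul1r !sgn_rev ?enum_uniq // sgn_enum mulr1.
rewrite -(perm_crossings (pe _ Uu) (perm_refl _)).
have -> : crossings u (rev (enum [set i in w])) = crossings u (rev w).
  apply: perm_crossings => //; apply: uniq_perm; rewrite ?rev_uniq ?enum_uniq //.
  by move=> i; rewrite !mem_rev mem_enum inE.
rewrite -(perm_size (pe _ Uw)); have := sgn_sqr F u.
move: (sgn u) (sgn w) => a b a2.
by move: (_ ^+ _) (_ ^+ _) => x y; ring: a2.
Qed.


(** ** The table of [V(alpha)] *)

Lemma gbas_mul_meet A J i : i \in A -> i \in J -> (gbas F A : G) * gbas F J = 0.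
Proof.
move=> iA iJ; rewrite -[gbas F A]gword_enum -[gbas F J]gword_enum gwordM /gword.
rewrite cat_uniq (_ : has _ _ = true) ?andbF //.
by apply/hasP; exists i; rewrite ?mem_enum.
Qed.

Lemma gder_gbas_mul A J i k : i \in A -> i \in J -> k != i ->
  (gder k (gbas F A) : G) * gder k (gbas F J) = 0.
Proof.
move=> iA iJ ki; rewrite !gder_gbas; case: ifP => kA; last by rewrite mul0r.
case: ifP => kJ; last by rewrite mulr0.
rewrite -scalerAl -scalerAr (@gbas_mul_meet _ _ i) ?scaler0 //;
  by rewrite !inE eq_sym ki.
Qed.

Lemma gbracket_disjoint A J : A :&: J = set0 -> gbracket (gbas F A) (gbas F J) = 0 :> G.
Proof.
move=> AJ; rewrite gbracketE big1 // => k _.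
rewrite gpar_gbas (linZ (gder_linear k)) -scalerAl.
have : k \notin A :&: J by rewrite AJ inE.
rewrite inE negb_and !gder_gbas => /orP[/negbTE ->|/negbTE ->].
  by rewrite mul0r scaler0.
by rewrite mulr0 scaler0.
Qed.

Lemma gbracket_meet2 A J i j : i != j -> i \in A :&: J -> j \in A :&: J ->
  gbracket (gbas F A) (gbas F J) = 0 :> G.
Proof.
rewrite !inE => ij /andP[iA iJ] /andP[jA jJ]; rewrite gbracketE big1 // => k _.
rewrite gpar_gbas (linZ (gder_linear k)) -scalerAl.
have [ki|ki] := eqVneq k i; last by rewrite (gder_gbas_mul iA iJ ki) scaler0.
by rewrite (gder_gbas_mul jA jJ) ?scaler0 // ki.
Qed.

Lemma gder_rcons u i : i \notin u ->
  gder i (gw (u ++ [:: i])) = (-1) ^+ size u *: gw u :> G.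
Proof.
move=> iu; rewrite -gwordM gderM gword1 gder_gen eqxx mulr1 gpar_gword.
suff -> : gder i (gw u) = 0 :> G by rewrite mul0r add0r.
rewrite /gword; case: ifP => _; last exact: (lin0 (gder_linear i)).
by rewrite (linZ (gder_linear i)) gder_gbas inE (negbTE iu) scaler0.
Qed.

Lemma gbas_gword w A : uniq w -> [set i in w] = A -> gbas F A = sgn w *: gw w :> G.
Proof. by move=> Uw <-; rewrite /gword Uw scalerA sgn_sqr scale1r. Qed.

Lemma gbracket_meet1 A J i : A :&: J = [set i] ->
  let a := enum (A :\ i) in let w := enum (J :\ i) in
  gbracket (gbas F A) (gbas F J) =
  (- (-1) ^+ size w * (sgn (a ++ [:: i]) * sgn (w ++ [:: i]))) *: gw (a ++ w) :> G.
Proof.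
move=> AJ a w; have iAJ : i \in A :&: J by rewrite AJ inE.
move: (iAJ); rewrite inE => /andP[iA iJ].
have ia : i \notin a by rewrite mem_enum !inE eqxx.
have iw : i \notin w by rewrite mem_enum !inE eqxx.
have Ua : uniq (a ++ [:: i]) by rewrite cat_uniq enum_uniq /= orbF ia.
have Uw : uniq (w ++ [:: i]) by rewrite cat_uniq enum_uniq /= orbF iw.
have Ea : [set k in a ++ [:: i]] = A.
  apply/setP => k; rewrite !inE mem_cat mem_enum !inE.
  by case: eqP => [->|]; rewrite ?iA ?orbF ?andTb.
have Ew : [set k in w ++ [:: i]] = J.
  apply/setP => k; rewrite !inE mem_cat mem_enum !inE.
  by case: eqP => [->|]; rewrite ?iJ ?orbF ?andTb.
rewrite gbracketE (bigD1 i) //= big1 => [|k ki]; last first.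
  by rewrite gpar_gbas (linZ (gder_linear k)) -scalerAl (gder_gbas_mul iA iJ ki) scaler0.
rewrite addr0 (gbas_gword Ua Ea) (gbas_gword Uw Ew) (linZ (@gpar_linear F n)) gpar_gword.
rewrite !(linZ (gder_linear i)) !gder_rcons // -!scalerAl -!scalerAr gwordM !scalerA.
congr (_ *: _); rewrite size_cat addn1 exprS.
have := sqrr_sign F (size a); rewrite expr2.
move: (_ ^+ size a) (_ ^+ size w) (sgn _) (sgn _) => x y z t x2; ring: x2.
Qed.

Lemma vwordE c w : uniq w -> vword F c w = kel c (gw w : G).
Proof. by move=> Uw; rewrite /vword /kel /gword Uw; case: c. Qed.

Definition kstar (x : G * G) : G * G := (gstar x.1, gstar x.2).

Lemma kstar_linear : linear kstar.
Proof. by move=> a x y; congr pair; apply: gstar_linear. Qed.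

Lemma kstar_kel c f : kstar (kel c f) = kel c (gstar f).
Proof. by case: c; congr pair; rewrite /= ?(lin0 gstar_linear). Qed.

Lemma kel0 c : kel c (0 : G) = 0.
Proof. exact: (lin0 (@kel_linear F n c)). Qed.

(** The three cases of the table correspond to the number of common letters of
    [A] and [J]: without any, the products survive and the bracket is the term in
    [alpha]; one common letter gives the single term of the Poisson bracket; two
    kill everything. *)
Lemma V_table_star A c d J :
  gstar_sign A *: V_table alpha c (~: A) d J =
  kstar (kal_r alpha (kel c (gbas F A)) (kel d (gbas F J))).
Proof.
rewrite (kel_r _ _ (@ghom_gbas F n J)) (linZ kstar_linear) kstar_kel /V_table.
have IJ : ~: A :&: J = J :\: A by rewrite setDE setIC.
have JI : J :\: ~: A = A :&: J by rewrite setDE setCK setIC.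
rewrite IJ JI; set r := enum (~: A :\: J).
have ar i : (i \in r) = (i \notin A) && (i \notin J).
  by rewrite mem_enum !inE andbC.
have Ur : uniq r by exact: enum_uniq.
have [AJ0|[i iAJ]] := set_0Vmem (A :&: J).
  have -> : J :\: A = J.
    by apply/setDidPl; rewrite -setI_eq0 setIC AJ0.
  have disj i : i \in A -> i \notin J.
    by move=> iA; apply/negP => iJ; have : i \in A :&: J by [rewrite inE iA]; rewrite AJ0 inE.
  rewrite AJ0 cards0 enum_set0 cats0 sgn_enum mulr1 eqxx !vwordE //.
  have UAJ : uniq (enum A ++ enum J).
    rewrite cat_uniq !enum_uniq andbT /=; apply/hasP => -[i].
    by rewrite !mem_enum => iJ /disj; rewrite iJ.
  have st : gstar ((gbas F A : G) * gbas F J) =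
      (gstar_sign A * sgn (r ++ rev (enum J))) *: gw r.
    rewrite -[gbas F A]gword_enum -[gbas F J]gword_enum gwordM (gstar_gword (u := r)).
      rewrite rev_cat catA (@sgn_perml _ (enum (~: A))) ?sgn_enum ?mulr1 1?mulrC //.
      apply: uniq_perm; rewrite ?enum_uniq //.
        rewrite cat_uniq rev_uniq !enum_uniq andbT /=; apply/hasP => -[i].
        by rewrite mem_rev mem_enum /= ar => ->; rewrite andbF.
      move=> i; rewrite mem_cat mem_rev ar !mem_enum inE.
      by case: (boolP (i \in A)) => [/disj/negbTE ->|_] //=; case: (i \in J).
    apply: uniq_perm; rewrite ?enum_uniq //.
      rewrite cat_uniq UAJ enum_uniq andbT /=; apply/hasP => -[i].
      by rewrite /= ar mem_cat !mem_enum => /orP[] ->; rewrite ?andbF.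
    move=> i; rewrite !mem_cat ar !mem_enum.
    by case: (i \in A); case: (i \in J).
  have eJ : geuler (gbas F J : G) = (#|J|%:R - 1) *: (gbas F J : G).
    rewrite geulerE -gword_enum gwt_gword scalerBl scale1r; congr (_ *: _ - _).
    by rewrite big_const_seq count_predT iter_addr_0 -cardE.
  case: c; case: d => /=; rewrite /kraw /=.
  - rewrite (gbracket_disjoint AJ0) mulr0n scale0r !add0r eJ -scalerAr.
    rewrite (linN gstar_linear) !(linZ gstar_linear) st.
    congr pair; rewrite /= ?scaler0 //.
    rewrite -scaleNr !scalerA; congr (_ *: _).
    rewrite exprS signr_odd; ring.
  - rewrite st; congr pair; rewrite /= ?scaler0 // !scalerA signr_odd; congr (_ *: _).
    by rewrite mulrA mulrC.
  - by rewrite st; congr pair; rewrite /= ?scaler0 // !scalerA mul1r.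
  - by rewrite st; congr pair; rewrite /= ?scaler0 // !scalerA mul1r.
have iA : i \in A by move: iAJ; rewrite inE => /andP[].
have iJ : i \in J by move: iAJ; rewrite inE => /andP[].
have s2 : #|A :&: J| == 0%N = false by rewrite cards_eq0; apply/set0Pn; exists i.
have p0 : (gbas F A : G) * gbas F J = 0 by apply: gbas_mul_meet iA iJ.
have [/andP[cT dT]|ncd] := boolP (c && d); last first.
  rewrite /kraw (negbTE ncd) p0 (lin0 gstar_linear) kel0 scaler0.
  by move: ncd; rewrite s2; case: (c); case: (d) => //; rewrite !scaler0.
rewrite /kraw cT dT /= s2 mulr0n scale0r addr0.
have eJ : geuler (gbas F J : G) = (#|J|%:R - 1) *: (gbas F J : G).
  rewrite geulerE -gword_enum gwt_gword scalerBl scale1r; congr (_ *: _ - _).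
  by rewrite big_const_seq count_predT iter_addr_0 -cardE.
rewrite eJ -scalerAr p0 !scaler0 subr0.
have [s21|s21] := eqVneq #|A :&: J| 1%N; last first.
  have [j [ij jAJ]] : exists j, i != j /\ j \in A :&: J.
    have : (0 < #|(A :&: J) :\ i|)%N.
      by move: s21; rewrite (cardsD1 i (A :&: J)) iAJ /=; case: #|_|.
    rewrite card_gt0 => /set0Pn[j]; rewrite in_setD1 => /andP[ji jAJ].
    by exists j; rewrite eq_sym.
  by rewrite (gbracket_meet2 ij iAJ jAJ) (lin0 gstar_linear) !scaler0.
have AJ1 : A :&: J = [set i].
  by move/eqP/cards1P: s21 => [k Ek]; move: iAJ; rewrite Ek inE => /eqP ->.
have JA : J :\: A = J :\ i.
  apply/setP => k; rewrite !inE; have := congr1 (fun X : {set 'I_n} => k \in X) AJ1; rewrite /= !inE.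
  by case: (boolP (k \in J)) => kJ; rewrite ?andbF ?andbT // => ->.
rewrite (gbracket_meet1 AJ1) JA AJ1 enum_set1.
set a := enum (A :\ i); set w := enum (J :\ i).
have ia : i \notin a by rewrite mem_enum !inE eqxx.
have iw : i \notin w by rewrite mem_enum !inE eqxx.
have ir : i \notin r by rewrite ar iA.
have aw k : k \in a -> k \notin w.
  rewrite !mem_enum !inE => /andP[ki kA]; rewrite ki /=; apply/negP => kJ.
  have : k \in A :&: J by rewrite inE kA.
  by rewrite AJ1 inE (negbTE ki).
have Ui : uniq (r ++ [:: i]) by rewrite cat_uniq enum_uniq /= orbF ir.
have Uaw : uniq (a ++ w).
  rewrite cat_uniq !enum_uniq andbT /=; apply/hasP => -[k kw /aw].
  by rewrite kw.
have mar k : (k \in a) = (k != i) && (k \in A) by rewrite mem_enum !inE.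
have mw k : (k \in w) = (k != i) && (k \in J) by rewrite mem_enum !inE.
have p1 : perm_eq ((r ++ [:: i]) ++ (a ++ w)) (enum 'I_n).
  apply: uniq_perm; rewrite ?enum_uniq //.
    rewrite cat_uniq Uaw Ui andbT /=; apply/hasP => -[k].
    rewrite /= !mem_cat mar mw ar inE.
    by case: eqP => //= _; case: (k \in A); case: (k \in J).
  move=> k; rewrite !mem_cat ar mar mw inE mem_enum.
  by case: (k \in A); case: (k \in J); case: (k == i).
have p2 : perm_eq (r ++ rev w) (enum (~: A)).
  apply: uniq_perm; rewrite ?enum_uniq //.
    rewrite cat_uniq rev_uniq !enum_uniq andbT /=; apply/hasP => -[k].
    by rewrite mem_rev /= ar mw => /andP[_ ->]; rewrite andbF.
  move=> k; rewrite mem_cat mem_rev ar mw mem_enum inE.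
  case: (boolP (k \in A)) => kA /=; last first.
    by case: (k \in J); rewrite //= andbT; apply/negP => /eqP E; rewrite E iA in kA.
  by have [//|ki] := eqVneq k i; apply/negbTE/negP => kJ; have := aw k; rewrite mar mw ki kA kJ => /(_ isT).
have Ai : perm_eq (a ++ [:: i]) (enum A).
  apply: uniq_perm; rewrite ?enum_uniq // ?cat_uniq ?enum_uniq /= ?orbF ?ia //.
  move=> k; rewrite mem_cat mar mem_enum inE.
  by case: eqP => [->|]; rewrite ?iA ?orbF.
rewrite (linZ gstar_linear) (gstar_gword p1).
have -> : gw (r ++ [:: i]) = sgn (r ++ [:: i]) *: gbas F [set k in r ++ [:: i]].
  by rewrite /gword Ui.
congr pair; rewrite /= ?scaler0 // !scalerA; congr (_ *: _).
have J1 : (-1) ^+ #|J| = - (-1) ^+ size w :> F.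
  by rewrite (cardsD1 i J) iJ /= cardE exprS mulN1r.
have J2 : #|J :\ i| = size w by rewrite cardE.
have Uri : uniq (i :: rev w) by rewrite /= mem_rev iw rev_uniq enum_uniq.
have S1 : sgn ((r ++ [:: i]) ++ rev w ++ rev a) =
    (-1) ^+ size w * sgn ((r ++ rev w) ++ i :: rev a).
  have pu : perm_eq (i :: rev w) (rev w ++ [:: i]) by rewrite perm_sym perm_catC.
  have P := perm_cat pu (perm_refl (rev a)).
  have -> : (r ++ [:: i]) ++ rev w ++ rev a = r ++ (i :: rev w) ++ rev a by rewrite -catA.
  have -> : (r ++ rev w) ++ i :: rev a = r ++ (rev w ++ [:: i]) ++ rev a by rewrite -!catA.
  rewrite !(sgn_cat _ r) (perm_crossings (perm_refl r) P) (sgn_perml _ pu) (sgn_consr Uri).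
  rewrite size_rev; have := sgn_sqr F (rev w ++ [:: i]).
  move: (sgn (rev w ++ _)) (sgn ((rev w ++ _) ++ _)) ((-1) ^+ crossings r _) ((-1) ^+ size w) (sgn r).
  by move=> x y z t o x2; ring: x2.
have S2 : sgn (enum (~: A) ++ i :: rev a) = sgn (a ++ [:: i]) * gstar_sign A.
  have -> : i :: rev a = rev (a ++ [:: i]) by rewrite rev_cat.
  rewrite /gstar_sign !(sgn_cat _ (enum (~: A))) sgn_enum !sgn_rev ?enum_uniq ?(perm_uniq Ai) ?enum_uniq //.
  rewrite sgn_enum -(perm_size Ai) -!(perm_crossings (perm_refl _) (_ : perm_eq (rev (a ++ [:: i])) (rev (enum A)))).
    by move: (_ ^+ _) (sgn _) ((-1) ^+ crossings _ _) => x y z; ring.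
  apply: uniq_perm; rewrite ?rev_uniq ?(perm_uniq Ai) ?enum_uniq // => k.
  by rewrite !mem_rev (perm_mem Ai).
rewrite rev_cat S1 (sgn_perml _ p2) sgn_enum S2 signr_odd J1 J2.
have := sgn_sqr F (a ++ [:: i]); have := sqrr_sign F (size w); rewrite expr2.
move: (_ ^+ size w) (sgn (a ++ _)) (sgn (r ++ rev w)) (sgn (w ++ _)) (sgn (r ++ _)).
by move=> x y z t o x2 y2; ring: x2 y2.
Qed.

(** ** The two bimodules are isomorphic *)

Lemma kelP (x : G * G) : x = \sum_c \sum_A Defs.coord c A x *: kel c (gbas F A : G).
Proof.
have H c f : kel c f = \sum_A f A *: kel c (gbas F A : G).
  rewrite {1}(gbasP f) (lin_sum (@kel_linear F n c)).
  by apply: eq_bigr => A _; rewrite (linZ (@kel_linear F n c)).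
by rewrite {1}(kelE x) !H big_bool addrC.
Qed.

Lemma bilin_expand (V : lmodType F) (B : G * G -> G * G -> V) x a :
  (forall x, linear (B x)) -> (forall a, linear (B^~ a)) ->
  B x a = \sum_c \sum_A \sum_d \sum_J
    (Defs.coord c A x * Defs.coord d J a) *: B (kel c (gbas F A)) (kel d (gbas F J)).
Proof.
move=> L Ll; rewrite {1}(kelP x) (lin_sum (Ll a)); apply: eq_bigr => c _.
rewrite (lin_sum (Ll a)); apply: eq_bigr => A _.
rewrite (linZ (Ll a)) {1}(kelP a) (lin_sum (L _)) scaler_sumr; apply: eq_bigr => d _.
rewrite (lin_sum (L _)) scaler_sumr; apply: eq_bigr => J _.
by rewrite (linZ (L _)) scalerA.
Qed.

Lemma coord_star c A (x : G * G) :
  Defs.coord c (~: A) (kstar x) = gstar_sign A * Defs.coord c A x.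
Proof. by case: c; rewrite /= ffunE setCK. Qed.

Lemma V_r_star (x a : G * G) : V_r alpha (kstar x) a = kstar (kal_r alpha x a).
Proof.
rewrite (bilin_expand _ _ (kal_r_linear alpha) (kal_r_linearl alpha)).
rewrite (lin_sum kstar_linear); apply: eq_bigr => c _.
rewrite (reindex_inj (inv_inj (@setCK _))) (lin_sum kstar_linear); apply: eq_bigr => A _.
rewrite (lin_sum kstar_linear); apply: eq_bigr => d _.
rewrite (lin_sum kstar_linear); apply: eq_bigr => J _.
rewrite (linZ kstar_linear) -V_table_star coord_star [RHS]scalerA; congr (_ *: _).
by rewrite [RHS]mulrC mulrA.
Qed.

Lemma V_parityC c A : V_parity c (~: A) = c (+) odd #|A|.
Proof.
rewrite /V_parity -{1}[n]card_ord -(cardsC A) oddD.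
by case: (odd _); case: (odd _); case: (c).
Qed.

Lemma V_l_star (a x : G * G) : V_l alpha a (kstar x) = kstar (kal_l alpha a x).
Proof.
have -> : kal_l alpha a x = \sum_c \sum_A \sum_d \sum_J
    ((-1) ^+ (kan_parity d J && V_parity c (~: A)) * Defs.coord c A x * Defs.coord d J a)
      *: kal_r alpha (kel c (gbas F A)) (kel d (gbas F J)).
  rewrite (bilin_expand (B := fun y b => kal_l alpha b y) x a
    (kal_l_linearl alpha) (kal_l_linear alpha)).
  apply: eq_bigr => c _; apply: eq_bigr => A _; apply: eq_bigr => d _; apply: eq_bigr => J _.
  have gA := @ghom_gbas F n A; have gJ := @ghom_gbas F n J.
  rewrite (kel_l _ _ gA) (kel_r _ _ gJ) (kraw_sym alpha _ _ _ _ gA gJ) addbC.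
  rewrite (linZ (@kel_linear F n _)) !scalerA; congr (_ *: _).
  rewrite V_parityC /kan_parity.
  move: (Defs.coord c A x) (Defs.coord d J a) => y z.
  by case: (c); case: (d); case: (odd _); case: (odd _); rewrite /= ?expr0 ?expr1; ring.
rewrite (lin_sum kstar_linear); apply: eq_bigr => c _.
rewrite (reindex_inj (inv_inj (@setCK _))) (lin_sum kstar_linear); apply: eq_bigr => A _.
rewrite (lin_sum kstar_linear); apply: eq_bigr => d _.
rewrite (lin_sum kstar_linear); apply: eq_bigr => J _.
rewrite (linZ kstar_linear) -V_table_star coord_star [RHS]scalerA; congr (_ *: _).
move: (_ ^+ _) (gstar_sign A) => s t; ring.
Qed.

Lemma V_pr_star b (x : G * G) : V_pr b (kstar x) = kstar (kan_pr b x).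
Proof.
congr pair; apply/ffunP => I; rewrite !ffunE -{1}[I]setCK V_parityC;
  by case: ifP => _; rewrite ?mulr0 // setCK.
Qed.

Lemma kstar_bij : bijective kstar.
Proof.
pose inv (f : G) : G := [ffun A : {set 'I_n} => gstar_sign A * f (~: A)].
exists (fun x => (inv x.1, inv x.2)) => -[f g]; congr pair; rewrite /inv /=;
  by apply/ffunP => A; rewrite !ffunE setCK mulrA gstar_signK mul1r.
Qed.

End ValphaModel.

(** * Transport along isomorphisms *)

Section Transport.
Variables (F : fieldType).

Section Superalgebras.
Variables (A B : superalg F) (h : A -> B).
Hypothesis h_lin : linear h.
Hypothesis h_bij : bijective h.
Hypothesis h_pr : forall b x, h (sa_pr b x) = sa_pr b (h x).
Hypothesis h_mul : forall x y, h (sa_mul x y) = sa_mul (h x) (h y).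

Lemma jordan_superalg_transport : is_jordan_superalg A -> is_jordan_superalg B.
Proof.
have [g gK hK] := h_bij.
have hom i y : homog (@sa_pr F B) i y -> homog (@sa_pr F A) i (g y).
  by rewrite /homog -{1 2}[y]hK -h_pr => /(bij_inj h_bij).
have hom' i x : homog (@sa_pr F A) i x -> homog (@sa_pr F B) i (h x).
  by rewrite /homog -h_pr => ->.
have zd a x y : a *: h x + h y = h (a *: x + y) by rewrite h_lin.
have z a x : a *: h x = h (a *: x) by rewrite (linZ h_lin).
have d x y : h x + h y = h (x + y) by rewrite (linD h_lin).
case=> [[[L P S] [Bl Blr] M] C J]; split; first split.
- split=> [b a u v|b c u|u].
  + by rewrite -[u]hK -[v]hK zd -!h_pr L zd.
  + by rewrite -[u]hK -!h_pr P; case: eqP => // _; rewrite (lin0 h_lin).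
  + by rewrite -[u]hK -!h_pr d S.
- split=> [u a v w|u a v w].
  + by rewrite -[u]hK -[v]hK -[w]hK zd -!h_mul Bl zd.
  + by rewrite -[u]hK -[v]hK -[w]hK zd -!h_mul Blr zd.
- move=> i j x y /hom hx /hom hy; rewrite -[x]hK -[y]hK -h_mul; apply: hom'.
  exact: M.
- move=> i j x y /hom hx /hom hy; rewrite -[x]hK -[y]hK -!h_mul z; congr h.
  exact: C.
move=> i j k l x y zz t /hom hx /hom hy /hom hz /hom ht.
rewrite -[x]hK -[y]hK -[zz]hK -[t]hK -!h_mul !z !d; congr h.
exact: J.
Qed.

End Superalgebras.

Variables (A : superalg F) (V W : superbimod A) (h : V -> W).
Hypothesis h_lin : linear h.
Hypothesis h_bij : bijective h.
Hypothesis h_pr : forall b x, h (bm_pr b x) = bm_pr b (h x).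
Hypothesis h_l : forall a x, h (bm_l a x) = bm_l a (h x).
Hypothesis h_r : forall a x, h (bm_r x a) = bm_r (h x) a.

Lemma jordan_bimod_transport : jordan_bimod V -> jordan_bimod W.
Proof.
have [g gK hK] := h_bij.
have hom i y : homog (@bm_pr F A W) i y -> homog (@bm_pr F A V) i (g y).
  by rewrite /homog -{1 2}[y]hK -h_pr => /(bij_inj h_bij).
have hom' i x : homog (@bm_pr F A V) i x -> homog (@bm_pr F A W) i (h x).
  by rewrite /homog -h_pr => ->.
have zd a x y : a *: h x + h y = h (a *: x + y) by rewrite h_lin.
case=> [[[L P S] [Bl Bll] [Br Brl] Ml Mr] J]; split; last first.
  apply: (@jordan_superalg_transport (split_null_ext V) (split_null_ext W)
    (fun x => (x.1, h x.2))) J.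
  - by move=> a x y; congr pair; apply: h_lin.
  - by exists (fun x => (x.1, g x.2)) => -[x y] /=; rewrite ?gK ?hK.
  - by move=> b x; congr pair; apply: h_pr.
  - by move=> x y; congr pair; rewrite /= (linD h_lin) h_l h_r.
split.
- split=> [b a u v|b c u|u].
  + by rewrite -[u]hK -[v]hK zd -!h_pr L zd.
  + by rewrite -[u]hK -!h_pr P; case: eqP => // _; rewrite (lin0 h_lin).
  + by rewrite -[u]hK -!h_pr -(linD h_lin) S.
- split=> [x a u v|u a x y].
  + by rewrite -[u]hK -[v]hK zd -!h_l Bl zd.
  + by rewrite -[u]hK -!h_l Bll zd.
- split=> [u a x y|x a u v].
  + by rewrite -[u]hK -!h_r Br zd.
  + by rewrite -[u]hK -[v]hK zd -!h_r Brl zd.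
- by move=> i j x v hx /hom hv; rewrite -[v]hK -h_l; apply: hom'; apply: Ml.
- by move=> i j x v hx /hom hv; rewrite -[v]hK -h_r; apply: hom'; apply: Mr.
Qed.

Lemma unital_bimod_transport : unital_bimod V -> unital_bimod W.
Proof.
have [g gK hK] := h_bij; case=> e He Hv; exists e => // w.
by rewrite -[w]hK -h_l -h_r; have [-> ->] := Hv (g w).
Qed.

Lemma irreducible_bimod_transport : irreducible_bimod V -> irreducible_bimod W.
Proof.
have [g gK hK] := h_bij; case=> -[v v0] irr; split.
  by exists (h v) => hv; apply: v0; rewrite -[v]gK hv -(lin0 h_lin) gK.
move=> X [X0 XD Xp Xm]; case: (irr (fun u => X (h u))).
- split=> [|c u w Xu Xw|b u Xu|a u Xu]; first by rewrite (lin0 h_lin).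
  + by rewrite h_lin; apply: XD.
  + by rewrite h_pr; apply: Xp.
  + by rewrite h_l h_r; apply: Xm.
- by move=> H; left=> w; rewrite -[w]hK => /H ->; rewrite (lin0 h_lin).
- by move=> H; right=> w; rewrite -[w]hK; apply: H.
Qed.

End Transport.

Section ValphaTransport.
Variables (F : fieldType) (n : nat) (alpha : F).

Lemma Valpha_jordan : jordan_bimod (Valpha n alpha).
Proof.
apply: (@jordan_bimod_transport _ _ (Kalpha n alpha) (Valpha n alpha) (@kstar F n)).
- exact: kstar_linear.
- exact: kstar_bij.
- by move=> b x; rewrite /= V_pr_star.
- by move=> a x; rewrite /= V_l_star.
- by move=> a x; rewrite /= V_r_star.
- exact: Kalpha_jordan.
Qed.

Lemma Kalpha_unital : unital_bimod (Kalpha n alpha).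
Proof.
have gp0 : gpar (0 : gring F n) = 0 := lin0 (@gpar_linear F n).
have br0 h : gbracket h (0 : gring F n) = 0 :> gring F n := lin0 (gbracket_linear h).
have br0l h : gbracket (0 : gring F n) h = 0 :> gring F n := lin0 (gbracket_linearl h).
have e0 : geuler (0 : gring F n) = 0 := lin0 (@geuler_linear F n).
exists ((1 : gring F n), (0 : gring F n)).
  move=> [f g]; rewrite /= !kan_mulE /=.
  by rewrite gp0 gpar1 br0 br0l !mul1r !mulr1 !mul0r !mulr0 !addr0 add0r.
move=> [f g]; rewrite /= /kal_l /kal_r /= gp0 gpar1 br0 br0l e0.
by rewrite !mul1r !mulr1 !mul0r !mulr0 scaler0 subr0 !addr0 add0r.
Qed.

End ValphaTransport.

(** * Right multiplications in a Jordan bimodule *)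

(** To prove an equality as a consequence of one or two others, leaving an
    identity for [zmod]. *)
Lemma zcomb1 (V : zmodType) (a b c d : V) : c = d -> a - b = c - d -> a = b.
Proof. by move=> ->; rewrite subrr => /eqP; rewrite subr_eq0 => /eqP. Qed.

Lemma zcomb2 (V : zmodType) (a b c d c' d' : V) :
  c = d -> c' = d' -> a - b = (c - d) + (c' - d') -> a = b.
Proof. by move=> -> ->; rewrite !subrr addr0 => /eqP; rewrite subr_eq0 => /eqP. Qed.

Section JordanBimodule.
Variables (F : fieldType) (A : superalg F) (V : superbimod A).
Hypothesis jV : jordan_bimod V.

Local Notation "x '*A' y" := (@sa_mul F A x y) (at level 40, left associativity).
Local Notation "v '<*' a" := (@bm_r F A V v a) (at level 45, left associativity).
Local Notation hA := (homog (@sa_pr F A)).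
Local Notation hV := (homog (@bm_pr F A V)).
Local Notation E := (split_null_ext V).
Local Notation sg b := ((-1) ^+ nat_of_bool b).
Implicit Types (v w : V) (a b c x y : A) (p q r s : bool).

Let sV : is_superbimod V := let: conj h _ := jV in h.
Let jE : is_jordan_superalg E := let: conj _ h := jV in h.
Let mE : bilin (@sa_mul F E) := let: And3 (And3 _ h _) _ _ := jE in h.

Lemma bm_pr_linear s : linear (@bm_pr F A V s).
Proof. by have [[h _ _] _ _ _ _] := sV. Qed.
Lemma bm_prK s t v : bm_pr s (bm_pr t v) = if s == t then bm_pr s v else 0.
Proof. by have [[_ h _] _ _ _ _] := sV. Qed.
Lemma bm_pr_sum v : bm_pr false v + bm_pr true v = v.
Proof. by have [[_ _ h] _ _ _ _] := sV. Qed.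
Lemma bm_r_linear v : linear (@bm_r F A V v).
Proof. by have [_ _ [h _] _ _] := sV. Qed.
Lemma bm_r_linearl a : linear (fun v => v <* a).
Proof. by have [_ _ [_ h] _ _] := sV. Qed.
Lemma bm_l_linear a : linear (@bm_l F A V a).
Proof. by have [_ [h _] _ _ _] := sV. Qed.
Lemma bm_l_linearl v : linear (fun a : A => bm_l a v).
Proof. by have [_ [_ h] _ _ _] := sV. Qed.
Lemma hom_r p q a v : hA p a -> hV q v -> hV (p (+) q) (v <* a).
Proof. by have [_ _ _ _ h] := sV; apply: h. Qed.

Lemma hV_pr s v : hV s (bm_pr s v).
Proof. by rewrite /homog bm_prK eqxx. Qed.

Lemma sa_mul_linear a : linear (@sa_mul F A a).
Proof.
have [h _] := mE; move=> k b c; have := congr1 fst (h (a, 0 : V) k (b, 0 : V) (c, 0 : V)).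
by rewrite /=.
Qed.

Lemma sa_mul_linearl b : linear (fun a => a *A b).
Proof.
have [_ h] := mE; move=> k a c; have := congr1 fst (h (b, 0 : V) k (a, 0 : V) (c, 0 : V)).
by rewrite /=.
Qed.

Lemma sa_pr_linear s : linear (@sa_pr F A s).
Proof.
have [[[h _ _] _ _] _ _] := jE.
move=> k a b; exact: (congr1 fst (h s k (a, 0 : V) (b, 0 : V))).
Qed.

Lemma sa_prK s t a : sa_pr s (sa_pr t a) = if s == t then sa_pr s a else 0.
Proof.
have [[[_ h _] _ _] _ _] := jE; have := congr1 fst (h s t (a, 0 : V)).
by rewrite /=; case: eqP.
Qed.

Lemma sa_pr_sum a : sa_pr false a + sa_pr true a = a.
Proof. have [[[_ _ h] _ _] _ _] := jE; exact: (congr1 fst (h (a, 0 : V))). Qed.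

Lemma hA_pr s a : hA s (sa_pr s a).
Proof. by rewrite /homog sa_prK eqxx. Qed.

Let rD u v a : (u + v) <* a = (u <* a) + (v <* a).
Proof. exact: (linD (bm_r_linearl a)). Qed.
Let r0 a : (0 : V) <* a = 0.
Proof. exact: (lin0 (bm_r_linearl a)). Qed.
Let rr0 v : v <* (0 : A) = 0.
Proof. exact: (lin0 (bm_r_linear v)). Qed.
Let l0 a : bm_l a (0 : V) = 0.
Proof. exact: (lin0 (bm_l_linear a)). Qed.
Let ll0 v : bm_l (0 : A) v = 0.
Proof. exact: (lin0 (bm_l_linearl v)). Qed.
Let m0 a : a *A 0 = 0.
Proof. exact: (lin0 (sa_mul_linear a)). Qed.
Let m0l a : 0 *A a = 0.
Proof. exact: (lin0 (sa_mul_linearl a)). Qed.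

Lemma hA_ext p a : hA p a -> homog (@sa_pr F E) p (a, 0 : V).
Proof. by move=> ha; congr pair; rewrite //= (lin0 (bm_pr_linear p)). Qed.

Lemma hV_ext p v : hV p v -> homog (@sa_pr F E) p (0 : A, v).
Proof. by move=> ha; congr pair; rewrite //= (lin0 (sa_pr_linear p)). Qed.

Lemma sa_superC p q a b : hA p a -> hA q b -> a *A b = sg (p && q) *: (b *A a).
Proof.
move=> ha hb; have [_ C _] := jE.
exact: (congr1 fst (C p q (a, 0 : V) (b, 0 : V) (hA_ext ha) (hA_ext hb))).
Qed.

Lemma hA_mul p q a b : hA p a -> hA q b -> hA (p (+) q) (a *A b).
Proof.
move=> ha hb; have [[_ _ M] _ _] := jE.
exact: (congr1 fst (M p q (a, 0 : V) (b, 0 : V) (hA_ext ha) (hA_ext hb))).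
Qed.

Lemma bm_lr p q a v : hA p a -> hV q v -> bm_l a v = sg (p && q) *: (v <* a).
Proof.
move=> ha hv; have [_ C _] := jE.
have := congr1 snd (C p q (a, 0 : V) (0 : A, v) (hA_ext ha) (hV_ext hv)).
by rewrite /= r0 l0 addr0 add0r.
Qed.

Lemma bm_r_bm_pr p s a v : hA p a -> bm_pr s (v <* a) = bm_pr (p (+) s) v <* a.
Proof.
move=> ha; rewrite -{1}(bm_pr_sum v) rD (linD (bm_pr_linear s)).
have H q : bm_pr s (bm_pr q v <* a) = if s == p (+) q then bm_pr q v <* a else 0.
  have := hom_r ha (@hV_pr q v); rewrite {1}/homog => {1}<-.
  by rewrite bm_prK; case: eqP => // ->; exact: (hom_r ha (@hV_pr q v)).
by rewrite !H; case: p {ha H}; case: s; rewrite /= ?addr0 ?add0r.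
Qed.

Lemma hV_ind (P : V -> Prop) : (forall u v, P u -> P v -> P (u + v)) ->
  (forall s v, hV s v -> P v) -> forall v, P v.
Proof.
by move=> PD Ph v; rewrite -(bm_pr_sum v); apply: PD; apply: Ph (hV_pr _ _).
Qed.

(** The Jordan identity with the module element in first position, and in third
    position in [identity2]; the left actions are turned into right ones. *)
Lemma identity1 p q r a b c v : hA p a -> hA q b -> hA r c ->
  (v <* a <* b <* c) + sg ((p && q) (+) (p && r) (+) (q && r)) *: (v <* c <* b <* a)
  + sg (q && r) *: (v <* (a *A c *A b))
  = (v <* a <* (b *A c)) + sg (p && q) *: (v <* b <* (a *A c))
  + sg (r && (p (+) q)) *: (v <* c <* (a *A b)).
Proof.
move=> ha hb hc; elim/hV_ind: v => [u v IHu IHv|i v hv].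
  rewrite !rD !scalerDr.
  by apply: (zcomb2 IHu IHv); zmod.
have [_ _ J] := jE.
have := congr1 snd (J i p q r (0 : A, v) (a, 0 : V) (b, 0 : V) (c, 0 : V)
  (hV_ext hv) (hA_ext ha) (hA_ext hb) (hA_ext hc)).
rewrite /= !(r0, l0, rr0, ll0, m0, m0l, addr0, add0r).
rewrite (bm_lr (hA_mul (hA_mul ha hc) hb) hv) scalerA -[(-1) ^+ (_ + _ + _ + _)%N]signr_odd -[(-1) ^+ (_ + _ + _)%N]signr_odd !oddD !oddb -!signr_addb.
case: i {hv}; case: p {ha}; case: q {hb}; case: r {hc}; exact.
Qed.

Lemma identity2 p q r a b c v : hA p a -> hA q b -> hA r c ->
  (v <* (a *A b) <* c) + sg (q && r) *: (v <* (a *A c) <* b)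
  + sg (p && (q (+) r)) *: (v <* (b *A c) <* a)
  = sg ((p (+) q) && r) *: (v <* c <* (a *A b)) + (v <* a <* (b *A c))
  + sg (p && q) *: (v <* b <* (a *A c)).
Proof.
move=> ha hb hc; elim/hV_ind: v => [u v IHu IHv|i v hv].
  rewrite !rD !scalerDr.
  by apply: (zcomb2 IHu IHv); zmod.
have [_ _ J] := jE.
have := congr1 snd (J p q i r (a, 0 : V) (b, 0 : V) (0 : A, v) (c, 0 : V)
  (hA_ext ha) (hA_ext hb) (hV_ext hv) (hA_ext hc)).
rewrite /= !(r0, l0, rr0, ll0, m0, m0l, addr0, add0r).
rewrite (bm_lr (hA_mul ha hb) hv) (bm_lr (hA_mul ha hc) hv) (bm_lr (hA_mul hb hc) hv).
rewrite (bm_lr (hA_mul ha hb) (hom_r hc hv)) (bm_lr ha hv) (bm_lr hb hv).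
have lZ k w x : bm_l x (k *: w) = k *: bm_l x w by exact: (linZ (bm_l_linear x)).
rewrite lZ (bm_lr (hA_mul ha hc) (hom_r hb hv)).
have rZ k w x : (k *: w) <* x = k *: (w <* x) by exact: (linZ (bm_r_linearl x)).
rewrite !rZ !scalerA -[(-1) ^+ (_ + _ + _ + _)%N]signr_odd -[(-1) ^+ (_ + _ + _)%N]signr_odd !oddD !oddb -!signr_addb.
move=> J1; have {J1} := congr1 (fun w => sg ((p (+) q) && i) *: w) J1.
rewrite !scalerDr !scalerA -!signr_addb.
by case: i {hv}; case: p {ha}; case: q {hb}; case: r {hc};
  rewrite /= ?expr0 ?expr1 ?scale1r ?scaleN1r => J1; apply: (zcomb1 J1); zmod.
Qed.

(** The difference of two instances of [identity1]: the supercommutator of two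
    right multiplications is a superderivation of the bimodule, over the inner
    derivation of [A] given by the same formula. *)
Lemma inner_derivation p q r a b c v : hA p a -> hA q b -> hA r c ->
  (v <* c <* a <* b) - sg (p && q) *: (v <* c <* b <* a) =
  (v <* ((c *A a *A b) - sg (p && q) *: (c *A b *A a)))
  + sg (r && (p (+) q)) *: ((v <* a <* b <* c) - sg (p && q) *: (v <* b <* a <* c)).
Proof.
move=> ha hb hc.
have E1 := identity1 v ha hb hc; have E2 := identity1 v hb ha hc.
have mZ k x y : (k *: x) *A y = k *: (x *A y) by exact: (linZ (sa_mul_linearl y)).
have rZ k w x : w <* (k *: x) = k *: (w <* x) by exact: (linZ (bm_r_linear w)).
have rB w x y : w <* (x - y) = (w <* x) - (w <* y) by exact: (linB (bm_r_linear w)).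
rewrite (sa_superC ha hc) (sa_superC hb hc) !mZ !rZ !scalerA in E1.
rewrite (sa_superC ha hc) (sa_superC hb hc) (sa_superC hb ha) !mZ !rZ !scalerA in E2.
rewrite rB rZ !scalerBr !scalerA.
move: E1 E2; case: p {ha}; case: q {hb}; case: r {hc};
  rewrite /= ?expr0 ?expr1 ?mul1r ?mulN1r ?opprK ?scale1r ?scaleN1r => E1 E2;
  first [ by apply: (zcomb2 E1 E2); zmod | by apply: (zcomb2 E1 (esym E2)); zmod
        | by apply: (zcomb2 (esym E1) E2); zmod | by apply: (zcomb2 (esym E1) (esym E2)); zmod].
Qed.

End JordanBimodule.

(** * Central operators of an irreducible bimodule *)

Section Irreducible.
Variables (F : fieldType) (A : superalg F) (V : superbimod A).
Hypothesis jV : jordan_bimod V.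

(** The left action is determined by the right one, up to signs on the
    homogeneous components. *)
Lemma graded_rightsub (W : V -> Prop) :
  W 0 -> (forall (c : F) u v, W u -> W v -> W (c *: u + v)) ->
  (forall b v, W v -> W (bm_pr b v)) -> (forall a v, W v -> W (bm_r v a)) ->
  graded_subbimod W.
Proof.
move=> W0 WD Wp Wr; split=> // a v Wv; split; last exact: Wr.
have add u w : W u -> W w -> W (u + w) by move=> ? ?; rewrite -[u]scale1r; apply: WD.
have H s t : W (bm_l (sa_pr s a) (bm_pr t v)).
  rewrite (bm_lr jV (hA_pr jV s a) (hV_pr jV t v)) -[_ *: _]addr0.
  by apply: WD => //; apply/Wr/Wp.
rewrite -(sa_pr_sum jV a) -(bm_pr_sum jV v) (linD (bm_l_linear jV _)).
by rewrite !(linD (bm_l_linearl jV _)); do 2?apply: (add).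
Qed.

Hypothesis iV : irreducible_bimod V.

(** The lemma of Schur, for kernels. *)
Lemma ker_dichotomy (th : V -> V) : linear th ->
  (forall b v, th v = 0 -> th (bm_pr b v) = 0) ->
  (forall a v, th v = 0 -> th (bm_r v a) = 0) ->
  (forall v, th v = 0 -> v = 0) \/ (forall v, th v = 0).
Proof.
move=> L hp hr; have [_ irr] := iV; apply: irr.
apply: graded_rightsub => //; first exact: (lin0 L).
by move=> c u v hu hv; rewrite L hu hv scaler0 addr0.
Qed.

Lemma nilpotent_central_eq0 (th : V -> V) : linear th ->
  (forall b v, th v = 0 -> th (bm_pr b v) = 0) ->
  (forall a v, th v = 0 -> th (bm_r v a) = 0) ->
  (forall v, th (th v) = 0) -> forall v, th v = 0.
Proof.
by move=> L hp hr th2; case: (ker_dichotomy L hp hr) => // inj v; apply/inj/inj; rewrite !th2.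
Qed.

End Irreducible.

(** * Right multiplications in Kan(n) *)

Section KanElements.
Variables (F : fieldType) (n : nat).
Local Notation G := (gring F n).
Local Notation A := (Kan F n).
Local Notation "x '*A' y" := (@sa_mul F (Kan F n) x y) (at level 40, left associativity).
Local Notation hA := (homog (@sa_pr F (Kan F n))).
Implicit Types (f g : G) (i j : 'I_n) (x : G * G).

Definition kG f : A := (f, 0 : G).
Definition kB f : A := (0 : G, f).
Definition kX i : A := kG (gen F i).
Definition kY i : A := kB (gen F i).
Definition kD : A := kB 1.

Let gp0 : gpar (0 : G) = 0 := lin0 (@gpar_linear F n).
Let br0 h : gbracket h (0 : G) = 0 :> G := lin0 (gbracket_linear h).

Lemma hA_kG p f : ghom p f -> hA p (kG f).
Proof. by move=> hf; apply/kan_homogP; split=> //; exact: ghom0. Qed.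
Lemma hA_kB p f : ghom p f -> hA (~~ p) (kB f).
Proof. by move=> hf; apply/kan_homogP; split; rewrite ?negbK //; exact: ghom0. Qed.
Lemma hA_kX i : hA true (kX i).
Proof. exact: (hA_kG (@ghom_gen F n i)). Qed.
Lemma hA_kY i : hA false (kY i).
Proof. exact: (hA_kB (@ghom_gen F n i)). Qed.
Lemma hA_kD : hA true kD.
Proof. exact: (hA_kB (@ghom1 F n)). Qed.
Lemma ghom_gen2 i j : ghom false (gen F i * gen F j : G).
Proof. exact: (ghomM (@ghom_gen F n i) (@ghom_gen F n j)). Qed.

Lemma kmulG x f : x *A kG f = (x.1 * f, x.2 * gpar f) :> G * G.
Proof. by rewrite /= kan_mulE /= gp0 br0 mulr0 addr0 add0r. Qed.

Lemma kmulB x f : x *A kB f = (gbracket x.2 (gpar f), x.1 * f) :> G * G.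
Proof. by rewrite /= kan_mulE /= gp0 !mulr0 addr0 add0r. Qed.

Lemma kmulX x i : x *A kX i = (x.1 * gen F i, - (x.2 * gen F i)) :> G * G.
Proof. by rewrite kmulG gpar_gen mulrN. Qed.

Lemma kmulY x i : x *A kY i = (- gder i (gpar x.2) : G, x.1 * gen F i) :> G * G.
Proof. by rewrite kmulB gpar_gen (linN (gbracket_linear _)) gbracket_gen. Qed.

Lemma kmulD x : x *A kD = (0, x.1) :> G * G.
Proof. by rewrite kmulB gpar1 gbracket1 mulr1. Qed.

Lemma kG_linear : linear kG.
Proof. by move=> a f g; congr pair; rewrite /= scaler0 addr0. Qed.
Lemma kB_linear : linear kB.
Proof. by move=> a f g; congr pair; rewrite /= scaler0 addr0. Qed.

(** Supercommutators of the generators remove a bar, differentiate, or vanish; by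
    [inner_derivation], every bimodule inherits these derivations. *)
Lemma der_YX i j x : (x *A kY i *A kX j) - (x *A kX j *A kY i) = ((i == j)%:R *: x.2, 0) :> G * G.
Proof.
rewrite !kmulX !kmulY /=; congr pair; rewrite /=; last first.
  by rewrite -!mulrA [gen F i * _]gen_anticomm mulrN opprK subrr.
rewrite (linN (@gpar_linear F n)) gparM gpar_gen mulrN !opprK gderM gparK gder_gen.
by rewrite mulNr addKr mulr_natr scaler_nat.
Qed.

Lemma der_DY i x : (x *A kD *A kY i) - (x *A kY i *A kD) =
  (- gder i (gpar x.1) : G, gder i (gpar x.2) : G) :> G * G.
Proof.
rewrite !(kmulD, kmulY) /=; congr pair; rewrite /= ?subr0 //.
by rewrite mul0r sub0r opprK.
Qed.

Lemma der_GX p f i x : ghom p f ->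
  (x *A kG f *A kX i) - (-1) ^+ p *: (x *A kX i *A kG f) = 0 :> G * G.
Proof.
move=> hf; rewrite !(kmulX, kmulG) /= (ghom_gpar hf); congr pair; rewrite /=.
  rewrite -!mulrA (gmul_superC hf (@ghom_gen F n i)) andbT -scalerAr.
  by rewrite subrr.
have ef := gmul_superC (@ghom_gen F n i) hf; rewrite andTb in ef.
rewrite -!scalerAr -!scalerAl mulNr -!mulrA ef -!scalerAr !scalerN opprK !scalerA.
by rewrite -!signr_addb addbb addFb addNr.
Qed.

Lemma der_DG f x : ghom false f -> (x *A kD *A kG f) - (x *A kG f *A kD) = 0 :> G * G.
Proof.
move=> hf; rewrite !(kmulD, kmulG) /= (ghom_gpar hf) scale1r.
by congr pair; rewrite /= ?mul0r subrr.
Qed.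

Lemma der_DD x : (x *A kD *A kD) = 0 :> G * G.
Proof. by rewrite !kmulD. Qed.

Lemma der_GG f g x : ghom false f -> ghom false g ->
  (x *A kG f *A kG g) - (x *A kG g *A kG f) = 0 :> G * G.
Proof.
move=> hf hg; rewrite !kmulG /= (ghom_gpar hf) (ghom_gpar hg) !scale1r.
by congr pair; rewrite /= -!mulrA (gmul_superC hf hg) scale1r subrr.
Qed.

End KanElements.

(** * Odd central operators *)

Section OddCentral.
Variables (F : fieldType) (A : superalg F) (V : superbimod A).
Hypothesis char2 : (2%:R : F) != 0.
Hypothesis jV : jordan_bimod V.
Hypothesis iV : irreducible_bimod V.

Local Notation "v '<*' a" := (@bm_r F A V v a) (at level 45, left associativity).
Local Notation hA := (homog (@sa_pr F A)).
Local Notation sg b := ((-1) ^+ nat_of_bool b).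

Lemma vdouble_eq0 (v : V) : v + v = 0 -> v = 0.
Proof.
rewrite -{1 2}[v]scale1r -scalerDl => /eqP; rewrite scaler_eq0 -[1 + 1]/(2%:R).
by rewrite (negbTE char2) => /eqP.
Qed.

Lemma r_pr_split (W : V -> Prop) : (forall u v, W u -> W v -> W (u + v)) ->
  (forall p a v, hA p a -> W v -> W (v <* a)) -> forall a v, W v -> W (v <* a).
Proof.
move=> WD Wh a v Wv; rewrite -(sa_pr_sum jV a) (linD (bm_r_linear jV v)).
by apply: WD; apply: (Wh _ _ _ (hA_pr jV _ _)).
Qed.

(** The last hypothesis says that [th] supercommutes with itself, which holds as
    soon as [th] is built from the action; then its square is zero, and its kernel
    is a nonzero submodule. *)
Lemma odd_central_eq0 (th : V -> V) : linear th ->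
  (forall b v, th (bm_pr b v) = bm_pr (~~ b) (th v)) ->
  (forall p a v, hA p a -> th (v <* a) = sg p *: (th v <* a)) ->
  (forall v, th (th v) = - th (th v)) -> forall v, th v = 0.
Proof.
move=> L hp hc th2; apply: (nilpotent_central_eq0 jV iV) => //.
- by move=> b v tv; rewrite hp tv (lin0 (bm_pr_linear jV _)).
- apply: r_pr_split => [u v hu hv|p a v ha tv]; first by rewrite (linD L) hu hv addr0.
  by rewrite (hc _ _ _ ha) tv (lin0 (bm_r_linearl jV _)) scaler0.
- by move=> v; apply: vdouble_eq0; rewrite {1}th2 addNr.
Qed.

(** This gives relations in the bimodule from relations in the algebra, when the
    supercommutator is odd. *)
Lemma odd_commutator_eq0 p q a b : hA p a -> hA q b -> p (+) q ->
  (forall c, sa_mul (sa_mul c a) b - sa_mul (sa_mul c b) a = 0) ->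
  forall v, v <* a <* b = v <* b <* a.
Proof.
move=> ha hb pq d0 v; apply/eqP; rewrite -subr_eq0; apply/eqP; move: v.
have rlin := bm_r_linearl jV.
have pq0 : p && q = false by case: p q pq {ha hb} => [] [].
have hc r c v : hA r c -> v <* c <* a <* b - (v <* c <* b <* a) =
    sg r *: ((v <* a <* b - (v <* b <* a)) <* c).
  move=> hr; have := inner_derivation jV v ha hb hr.
  rewrite pq0 pq andbT !scale1r d0 (lin0 (bm_r_linear jV v)) add0r => ->.
  by rewrite (linB (rlin c)).
apply: odd_central_eq0.
- move=> k u v; rewrite !(rlin a k, rlin b k) scalerBr opprD addrACA.
  by [].
- move=> s v; rewrite !(linB (bm_pr_linear jV _)).
  rewrite !(bm_r_bm_pr jV _ _ ha, bm_r_bm_pr jV _ _ hb) !addbA [q (+) p]addbC.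
  by rewrite (_ : p (+) q (+) ~~ s = s) //; case: (p (+) q) pq; case: (s).
- exact: hc.
pose th v := v <* a <* b - (v <* b <* a).
have thB u v : th (u - v) = th u - th v.
  by rewrite /th !(linB (rlin _)); zmod.
have th_ab v : th (v <* a <* b) = - (th v <* a <* b).
  rewrite /th (hc _ _ _ hb) -/(th (v <* a)) /th (hc _ _ _ ha) (linZ (rlin b)) scalerA -signr_addb.
  by rewrite addbC pq scaleN1r.
have th_ba v : th (v <* b <* a) = - (th v <* b <* a).
  rewrite /th (hc _ _ _ ha) -/(th (v <* b)) /th (hc _ _ _ hb) (linZ (rlin a)) scalerA -signr_addb.
  by rewrite pq scaleN1r.
move=> v; rewrite -/(th v) -/(th (th v)).
by rewrite {1 2}/th thB th_ab th_ba opprK /th; zmod.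
Qed.

End OddCentral.

(** * Generation by the Jordan identity *)

Section Generation.
Variables (F : fieldType) (n : nat).
Local Notation G := (gring F n).
Local Notation A := (Kan F n).
Local Notation "x '*A' y" := (@sa_mul F (Kan F n) x y) (at level 40, left associativity).
Local Notation hA := (homog (@sa_pr F (Kan F n))).
Local Notation e := (@gen F n).
Implicit Types (f g : G) (i j : 'I_n) (x : G * G).

Lemma kGM f g : kG f *A kG g = kG (f * g).
Proof. by rewrite kmulG /= mul0r. Qed.

(** By [identity1], the action of [(a c) b] is determined by those of the elements
    in the second hypothesis: a property of the action need only be checked on the
    generators listed here. *)
Lemma kan_generated (P : A -> Prop) :
  (forall k a b, P a -> P b -> P (k *: a + b)) ->
  (forall p q r a b c, hA p a -> hA q b -> hA r c -> P a -> P b -> P c ->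
     P (a *A b) -> P (a *A c) -> P (b *A c) -> P (a *A c *A b)) ->
  P (kG 1) -> (forall i, P (kX F i)) -> (forall i, P (kY F i)) -> P (kD F n) ->
  (forall i j, P (kG (e i * e j))) -> forall a, P a.
Proof.
move=> PL Pm P1 PX PY PD PH.
have P0 : P 0 by have := PL (- 1) _ _ P1 P1; rewrite scaleN1r addNr.
have PN a : P a -> P (- a) by move=> /PL /(_ P0) => /(_ (- 1)); rewrite scaleN1r addr0.
have PG f : P (kG f).
  elim/gword_ind: f => [k f g Pf Pg|w]; first by rewrite (@kG_linear F n); exact: PL.
  have [m] := ubnP (size w); elim: m w => // m IH [|i [|j w]] /= sw.
  - by rewrite gword_nil1.
  - by rewrite gword1; exact: PX.
  have hw := @ghom_gword F n w.
  have := Pm _ _ _ _ _ _ (hA_kX F i) (hA_kG hw) (hA_kX F j) (PX i).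
  rewrite /kX !kGM -[e i * e j * _]mulrA -!gword_cons -gword_rcons; apply.
  - exact: IH (ltnW sw).
  - exact: PX.
  - exact: IH.
  - exact: PH.
  by apply: IH; rewrite size_rcons.
have PB f : P (kB f).
  elim/gword_ind: f => [k f g Pf Pg|w]; first by rewrite (@kB_linear F n); exact: PL.
  elim/last_ind: w => [|w j IH]; first by rewrite gword_nil1.
  have hw := @ghom_gword F n w.
  have := Pm _ _ _ _ _ _ (hA_kG hw) (hA_kX F j) (hA_kD F n) (PG _) (PX j) PD.
  rewrite kGM !kmulD !kmulX /= mul0r gword_rcons => /(_ (PG _) IH (PY j)) /PN.
  by congr P; congr pair; rewrite /= ?oppr0 ?opprK.
case=> f g; have -> : (f, g) = 1 *: kG f + kB g :> A.
  by congr pair; rewrite /= ?scaler0 ?scale1r ?addr0 ?add0r.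
exact: PL.
Qed.

End Generation.

Section Intertwining.
Variables (F : fieldType) (A : superalg F) (U V : superbimod A).
Hypotheses (jU : jordan_bimod U) (jV : jordan_bimod V).
Variable th : U -> V.
Hypothesis th_lin : linear th.
Local Notation "x '*A' y" := (@sa_mul F A x y) (at level 40, left associativity).
Local Notation hA := (homog (@sa_pr F A)).

Definition intertwines a := forall u, th (bm_r u a) = bm_r (th u) a.

Lemma intertwines_linear k a b :
  intertwines a -> intertwines b -> intertwines (k *: a + b).
Proof.
by move=> ha hb u; rewrite (bm_r_linear jU) th_lin ha hb (bm_r_linear jV).
Qed.

Lemma intertwines_mul p q r a b c : hA p a -> hA q b -> hA r c ->
  intertwines a -> intertwines b -> intertwines c ->
  intertwines (a *A b) -> intertwines (a *A c) -> intertwines (b *A c) ->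
  intertwines (a *A c *A b).
Proof.
move=> ha hb hc ta tb tc tab tac tbc u.
have := congr1 th (identity1 jU u ha hb hc).
rewrite !(linD th_lin) !(linZ th_lin) !(ta, tb, tc, tab, tac, tbc).
rewrite -(identity1 jV (th u) ha hb hc) => /addrI.
by move=> E; apply: (scalerI _ E); rewrite signr_eq0.
Qed.

End Intertwining.

(** * Relations in a unital irreducible bimodule *)

Section Relations.
Variables (F : fieldType) (n : nat) (V : superbimod (Kan F n)).
Hypothesis char2 : (2%:R : F) != 0.
Hypothesis n_ge2 : (2 <= n)%N.
Hypothesis jV : jordan_bimod V.
Hypothesis uV : unital_bimod V.
Hypothesis iV : irreducible_bimod V.

Local Notation G := (gring F n).
Local Notation A := (Kan F n).
Local Notation "x '*A' y" := (@sa_mul F (Kan F n) x y) (at level 40, left associativity).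
Local Notation "v '<*' a" := (@bm_r F (Kan F n) V v a) (at level 45, left associativity).
Local Notation hA := (homog (@sa_pr F (Kan F n))).
Local Notation sg b := ((-1) ^+ nat_of_bool b).
Local Notation X := (@kX F n).
Local Notation Y := (@kY F n).
Local Notation D := (@kD F n).
Local Notation e := (@gen F n).
Local Notation H i j := (kG (gen F i * gen F j)).
Implicit Types (v w : V) (a b c : A) (i j l : 'I_n) (f g : G) (p q r : bool).

Let rlin a := bm_r_linearl jV a.
Let rD a u v : (u + v) <* a = (u <* a) + (v <* a). Proof. exact: (linD (rlin a)). Qed.
Let rB a u v : (u - v) <* a = (u <* a) - (v <* a). Proof. exact: (linB (rlin a)). Qed.
Let rN a v : (- v) <* a = - (v <* a). Proof. exact: (linN (rlin a)). Qed.
Let rZ a k v : (k *: v) <* a = k *: (v <* a). Proof. exact: (linZ (rlin a)). Qed.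
Let r0 a : (0 : V) <* a = 0. Proof. exact: (lin0 (rlin a)). Qed.
Let rr v := bm_r_linear jV v.
Let rr0 v : v <* (0 : A) = 0. Proof. exact: (lin0 (rr v)). Qed.
Let rrN v a : v <* (- a) = - (v <* a). Proof. exact: (linN (rr v)). Qed.
Let rrZ v k a : v <* (k *: a) = k *: (v <* a). Proof. exact: (linZ (rr v)). Qed.
Let rrD v a b : v <* (a + b) = (v <* a) + (v <* b). Proof. exact: (linD (rr v)). Qed.
Lemma r_one v : v <* kG 1 = v.
Proof.
have [u uA uu] := uV; have [_ r1] := uu v; suff -> : kG 1 = u by [].
have [_ <-] := uA (kG 1); have := kmulG (kG 1) (1 : G).
have -> : kG 1 *A u = u.
  by rewrite /= kan_mulE /kG /= !mul1r mul0r addr0 (lin0 (gbracket_linearl _)) addr0;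
     case: u {uA uu r1}.
by [].
Qed.

(** ** The operator Q *)

(** The supercommutator of [Y i] and [X i], a superderivation of the bimodule over
    the one of Kan(n) that sends \bar g to g; two of them differ by an odd central
    operator, so that they are equal. It is locked, as are two operators below,
    because its unfolding, a difference, matches too many rewriting rules. *)
Fact opQ_key : unit. Proof. by []. Qed.
Definition opQ i v : V := locked_with opQ_key ((v <* Y i <* X i) - (v <* X i <* Y i)).

Lemma opQE i v : opQ i v = (v <* Y i <* X i) - (v <* X i <* Y i).
Proof. by rewrite /opQ unlock. Qed.

Lemma opQ_linear i : linear (opQ i).
Proof. by move=> k u v; rewrite !opQE !(rD, rZ) scalerBr; zmod. Qed.

Lemma opQ_r i r c v : hA r c -> opQ i (v <* c) = (v <* kG c.2) + sg r *: (opQ i v <* c).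
Proof.
move=> hc; have := inner_derivation jV v (hA_kY F i) (hA_kX F i) hc.
rewrite !scale1r der_YX eqxx scale1r andbT -rB.
by rewrite !opQE => ->.
Qed.

Lemma opQ_pr i s v : opQ i (bm_pr s v) = bm_pr (~~ s) (opQ i v).
Proof.
rewrite !opQE (linB (bm_pr_linear jV _)).
by rewrite !(bm_r_bm_pr jV _ _ (hA_kX F i), bm_r_bm_pr jV _ _ (hA_kY F i)) /= negbK.
Qed.

Let i0 : 'I_n := Ordinal (ltnW n_ge2).

Lemma opQ_eq i j v : opQ i v = opQ j v.
Proof.
apply/eqP; rewrite -subr_eq0; apply/eqP; move: v.
have th_c r c v : hA r c -> opQ i (v <* c) - opQ j (v <* c) =
    sg r *: ((opQ i v - opQ j v) <* c).
  by move=> hc; rewrite !(opQ_r _ _ hc) rB scalerBr; zmod.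
apply: (odd_central_eq0 char2 jV iV) => //.
- by move=> k u v; rewrite !opQ_linear scalerBr; zmod.
- by move=> s v; rewrite !opQ_pr (linB (bm_pr_linear jV _)).
move=> v; pose th v := opQ i v - opQ j v.
have thB u w : th (u - w) = th u - th w by rewrite /th !(linB (opQ_linear _)); zmod.
have thY k u : th (u <* Y k) = th u <* Y k by rewrite /th (th_c _ _ _ (hA_kY F k)) scale1r.
have thX k u : th (u <* X k) = - (th u <* X k) by rewrite /th (th_c _ _ _ (hA_kX F k)) scaleN1r.
have thQ k u : th (opQ k u) = - opQ k (th u).
  by rewrite !opQE thB !(thX, thY) rN; zmod.
by rewrite -/(th v) -/(th (th v)) {1 2}/th thB !thQ /th; zmod.
Qed.

Definition Q v := opQ i0 v.

Lemma QE i v : Q v = (v <* Y i <* X i) - (v <* X i <* Y i).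
Proof. by rewrite -opQE; exact: opQ_eq. Qed.

Lemma Q_linear : linear Q. Proof. exact: opQ_linear. Qed.
Let QB_ u v : Q (u - v) = Q u - Q v. Proof. exact: (linB Q_linear). Qed.
Lemma QG p f v : ghom p f -> Q (v <* kG f) = sg p *: (Q v <* kG f).
Proof. by move=> hf; rewrite /Q (opQ_r _ _ (hA_kG hf)) rr0 add0r. Qed.

Lemma QX i v : Q (v <* X i) = - (Q v <* X i).
Proof. by rewrite (QG _ (@ghom_gen F n i)) scaleN1r. Qed.

Lemma QY i v : Q (v <* Y i) = (v <* X i) + (Q v <* Y i).
Proof. by rewrite /Q (opQ_r _ _ (hA_kY F i)) scale1r. Qed.

Lemma QD v : Q (v <* D) = v - (Q v <* D).
Proof. by rewrite /Q (opQ_r _ _ (hA_kD F n)) scaleN1r r_one. Qed.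

Lemma YX_neq i j v : i != j -> v <* Y i <* X j = v <* X j <* Y i.
Proof.
move=> ij; apply: (odd_commutator_eq0 char2 jV iV (hA_kY F i) (hA_kX F j)) => // c.
by rewrite der_YX (negbTE ij) scale0r.
Qed.

Lemma YX i j v : v <* Y i <* X j = (v <* X j <* Y i) + (i == j)%:R *: Q v.
Proof.
case: eqVneq => [->|ij]; last by rewrite scale0r addr0; exact: YX_neq.
by rewrite scale1r (QE j); zmod.
Qed.

(** [Q] is applied to the commutation of [Y i] and [X j]. *)
Lemma XX_neq i j v : i != j -> v <* X i <* X j = - (v <* X j <* X i).
Proof.
move=> ij; have := congr1 Q (YX_neq v ij).
rewrite QX !QY QX rN rD (YX_neq _ ij) => E; apply: (zcomb1 (esym E)); zmod.
Qed.

Lemma XX_sqr i v : v <* X i <* X i = - Q (Q v).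
Proof.
have := QE i v => E; have E2 := congr1 Q E.
have E3 := QE i (Q v).
rewrite QB_ QX !QY QX rN rD in E2.
have {E2 E3} : (v <* X i <* X i + Q (Q v)) + (v <* X i <* X i + Q (Q v)) = 0.
  by apply: (zcomb2 E2 E3); zmod.
by move/(vdouble_eq0 char2) => E4; apply: (zcomb1 E4); zmod.
Qed.

(** ** The operators implementing the partial derivatives *)

Fact opd_key : unit. Proof. by []. Qed.
Definition opd i v : V := locked_with opd_key ((v <* D <* Y i) - (v <* Y i <* D)).

Lemma opdE i v : opd i v = (v <* D <* Y i) - (v <* Y i <* D).
Proof. by rewrite /opd unlock. Qed.

Lemma opd_r i r c v : hA r c ->
  (v <* c <* D <* Y i) - (v <* c <* Y i <* D) =
  (v <* ((- gder i (gpar c.1) : G), (gder i (gpar c.2) : G)))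
  + sg r *: ((v <* D <* Y i <* c) - (v <* Y i <* D <* c)).
Proof.
move=> hc; have := inner_derivation jV v (hA_kD F n) (hA_kY F i) hc.
by rewrite !scale1r der_DY andbT.
Qed.

Lemma opdG i p f v : ghom p f ->
  opd i (v <* kG f) = - (v <* kG (gder i (gpar f))) + sg p *: (opd i v <* kG f).
Proof.
move=> hf; rewrite !opdE (opd_r _ _ (hA_kG hf)) /= (lin0 (@gpar_linear F n)).
rewrite (lin0 (gder_linear i)) -rB; congr (_ + _).
by rewrite -rrN; congr (_ <* _); congr pair; rewrite /= oppr0.
Qed.

Lemma opdB i p f v : ghom p f ->
  opd i (v <* kB f) = (v <* kB (gder i (gpar f))) + sg (~~ p) *: (opd i v <* kB f).
Proof.
move=> hf; rewrite !opdE (opd_r _ _ (hA_kB hf)) /= (lin0 (@gpar_linear F n)).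
by rewrite (lin0 (gder_linear i)) oppr0 -rB.
Qed.

Lemma opdX i l v : opd i (v <* X l) = (i == l)%:R *: v - (opd i v <* X l).
Proof.
rewrite (opdG _ _ (@ghom_gen F n l)) gpar_gen (linN (gder_linear i)) gder_gen scaleN1r.
congr (_ - _); rewrite (linN (@kG_linear F n)) rrN opprK.
by case: eqP; rewrite ?scale1r ?r_one // scale0r (lin0 (@kG_linear F n)) rr0.
Qed.

Lemma opdD i v : opd i (v <* D) = - (opd i v <* D).
Proof.
rewrite (opdB _ _ (@ghom1 F n)) gpar1 gder1 (lin0 (@kB_linear F n)) rr0 add0r.
by rewrite scaleN1r.
Qed.

Lemma opdY i l v : opd i (v <* Y l) = - ((i == l)%:R *: (v <* D)) + (opd i v <* Y l).
Proof.
rewrite (opdB _ _ (@ghom_gen F n l)) gpar_gen (linN (gder_linear i)) gder_gen scale1r.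
rewrite (linN (@kB_linear F n)) rrN; congr (- _ + _).
by case: eqP; rewrite ?scale1r // scale0r (lin0 (@kB_linear F n)) rr0.
Qed.

Let opd_linear i : linear (opd i).
Proof. by move=> k u v; rewrite !opdE !(rD, rZ) scalerBr; zmod. Qed.
Let d0_ i : opd i 0 = 0. Proof. exact: (lin0 (opd_linear i)). Qed.

Lemma DG f v : ghom false f -> v <* D <* kG f = v <* kG f <* D.
Proof.
move=> hf; apply: (odd_commutator_eq0 char2 jV iV (hA_kD F n) (hA_kG hf)) => // c.
exact: der_DG.
Qed.

Lemma GX f i v : ghom false f -> v <* kG f <* X i = v <* X i <* kG f.
Proof.
move=> hf; apply: (odd_commutator_eq0 char2 jV iV (hA_kG hf) (hA_kX F i)) => // c.
by have := der_GX i c hf; rewrite scale1r.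
Qed.

Let gd2 i j : i != j -> gder j (gpar (e i * e j : G)) = - e i :> G.
Proof.
move=> ij; rewrite (ghom_gpar (ghom_gen2 F i j)) scale1r gder_gen_mul gder_gen eqxx mulr1.
by rewrite eq_sym (negbTE ij) scale0r add0r.
Qed.

Lemma other i : exists j, i != j.
Proof.
have [->|ne] := eqVneq i i0; last by exists i0.
by exists (Ordinal n_ge2).
Qed.

(** The derivative of the commutation of [D] with e_i e_j. *)
Lemma DX i v : v <* D <* X i = - (v <* X i <* D).
Proof.
have [j ij] := other i.
have h2 := ghom_gen2 F i j.
have := congr1 (opd j) (DG v h2); rewrite (opdG _ _ h2) !opdD (opdG _ _ h2).
rewrite gd2 // (linN (@kG_linear F n)) !rrN !opprK !scale1r !rD !rN (DG _ h2) -/(X i) => E.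
by apply: (zcomb1 E); zmod.
Qed.

Lemma even_sqr_zero (h : G) v : ghom false h -> h * h = 0 -> v <* kG h <* kG h <* kG h = 0.
Proof.
move=> hh hh0; have := identity1 jV v (hA_kG hh) (hA_kG hh) (hA_kG hh).
have -> : kG h *A kG h = 0 by rewrite kmulG /= (ghom_gpar hh) scale1r hh0 mul0r.
rewrite (lin0 (sa_mul_linearl jV _)) !rr0 !scale1r !addr0.
exact: vdouble_eq0.
Qed.

(** A first comparison of the action of e_i e_j with those of e_i and e_j; it is the
    identity for e_i, e_i e_j and e_j. *)
Lemma HH i j v : i != j -> v <* H i j <* H i j = (v <* X i <* X j <* H i j) *+ 2.
Proof.
move=> ij; have h2 := ghom_gen2 F i j.
have := identity1 jV v (hA_kX F i) (hA_kG h2) (hA_kX F j).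
rewrite !kGM.
have -> : e i * e j * e j = 0 :> G by rewrite -mulrA gen_sqr mulr0.
have -> : e i * (e i * e j) = 0 :> G by rewrite mulrA gen_sqr mul0r.
have -> : e i * e j * (e i * e j) = 0 :> G.
  by rewrite -mulrA (mulrA (e j)) [e j * _]gen_anticomm mulNr -mulrA gen_sqr mulr0 oppr0 mulr0.
rewrite (lin0 (@kG_linear F n)) !rr0 !expr0 !scale1r !expr1 !scaleN1r oppr0 !addr0 add0r.
rewrite !(GX _ _ h2) => E; have XX := XX_neq v ij.
have XXh : v <* X j <* X i = - (v <* X i <* X j) by rewrite XX opprK.
by move: E; rewrite XXh rN opprK mulr2n => ->.
Qed.

Lemma sqr_central b : hA true b -> (forall a, a *A b *A b = 0) ->
  forall a v, v <* a <* b <* b = v <* b <* b <* a.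
Proof.
move=> hb b0 a v; apply/eqP; rewrite -subr_eq0; apply/eqP.
move: v; suff K r c v : hA r c -> v <* c <* b <* b - (v <* b <* b <* c) = 0.
  move=> v; rewrite -(sa_pr_sum jV a) !rrD !rD opprD addrACA.
  by rewrite !(K _ _ _ (hA_pr jV _ _)) addr0.
move=> hc; apply: (vdouble_eq0 char2).
have := inner_derivation jV v hb hb hc.
rewrite b0 andbF !expr1 !scaleN1r scale1r !opprK addr0 rr0 add0r => E.
by apply: (zcomb1 E); zmod.
Qed.

Lemma XX_central i a v :
  v <* a <* X i <* X i = v <* X i <* X i <* a.
Proof.
apply: (sqr_central (hA_kX F i)) => c.
by rewrite !kmulX /= mulNr -!mulrA gen_sqr !mulr0 !oppr0.
Qed.

Lemma DD_central a v : v <* a <* D <* D = v <* D <* D <* a.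
Proof. by apply: (sqr_central (hA_kD F n)) => c; exact: der_DD. Qed.

(** The operator c = X_i^2 is central, and it does not depend on [i] as it is - Q^2.
    For H = e_i e_j, [HH] and H^3 = 0 give c^2 H = 0. If c were injective, H would
    vanish, and so would X_i, which is the derivative of H; hence c = 0. *)
Lemma XX0 i v : v <* X i <* X i = 0.
Proof.
have [j ij] := other i.
have h2 := ghom_gen2 F i j.
have c2H w : w <* X i <* X i <* X i <* X i <* H i j = 0.
  have := even_sqr_zero w h2.
  have -> : e i * e j * (e i * e j) = 0 :> G.
    by rewrite -mulrA (mulrA (e j)) [e j * _]gen_anticomm mulNr -mulrA gen_sqr mulr0 oppr0 mulr0.
  move=> /(_ erefl); rewrite (HH w ij) mulr2n rD (HH _ ij).
  rewrite -!mulr2n -mulrnA => /eqP; rewrite -scaler_nat scaler_eq0.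
  have n4 : ((2 * 2)%:R : F) != 0 by rewrite natrM mulf_neq0.
  rewrite (negbTE n4) => /eqP.
  have e4 : w <* X i <* X j <* X i <* X j = - (w <* X i <* X i <* X i <* X i).
    rewrite [w <* X i <* X j]XX_neq // !rN XX_central.
    by rewrite !XX_sqr.
  by rewrite e4 rN => /eqP; rewrite oppr_eq0 => /eqP.
pose th w := w <* X i <* X i.
have Lth : linear th by move=> k u w; rewrite /th !(rD, rZ).
have th_pr (b : bool) w : th w = 0 -> th (bm_pr b w) = 0.
  rewrite /th => tw; rewrite -[b]negbK -(bm_r_bm_pr jV _ _ (hA_kX F i)).
  by rewrite -(bm_r_bm_pr jV _ _ (hA_kX F i)) tw (lin0 (bm_pr_linear jV _)).
have th_r a w : th w = 0 -> th (w <* a) = 0 by rewrite /th XX_central => ->; rewrite r0.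
case: (ker_dichotomy jV iV Lth th_pr th_r) => [inj|h]; last exact: h.
have H0 w : w <* H i j = 0.
  by apply/inj/inj; rewrite /th !(XX_central _ (H i j)).
have := congr1 (opd j) (H0 v); rewrite (opdG _ _ h2) H0 d0_.
rewrite gd2 // (linN (@kG_linear F n)) rrN opprK scaler0 addr0 => ->.
by rewrite r0.
Qed.

Lemma QQ v : Q (Q v) = 0.
Proof. by have /eqP := XX_sqr i0 v; rewrite XX0 eq_sym oppr_eq0 => /eqP. Qed.

Lemma XX i j v : v <* X i <* X j = - (v <* X j <* X i).
Proof. by have [->|/XX_neq->//] := eqVneq i j; rewrite XX0 oppr0. Qed.

Lemma kB_gen2 i j v : v <* kB (e i * e j) =
  (v <* X i <* Y j) + (v <* D <* H i j) - (v <* X j <* Y i) - (v <* X i <* X j <* D) *+ 2.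
Proof.
have := identity1 jV v (hA_kX F i) (hA_kD F n) (hA_kX F j).
have -> : X i *A X j *A D = kB (e i * e j) by rewrite kmulD kmulX /=.
have -> : D *A X j = - Y j.
  by rewrite kmulX /= mul0r mul1r; congr pair; rewrite /= ?oppr0.
have -> : X i *A D = Y i by rewrite kmulD.
have -> : X i *A X j = H i j by rewrite kGM.
rewrite !expr1 !scaleN1r expr0 scale1r rrN.
rewrite !DX [v <* X j <* X i]XX !rN => E.
by apply: (zcomb1 (esym E)); rewrite mulr2n; zmod.
Qed.

Lemma kB_gen2_X j k l v : (v <* kB (e j * e k) <* X l) + (v <* X l <* kB (e j * e k)) =
  (j == l)%:R *: (Q v <* X k) - (k == l)%:R *: (Q v <* X j).
Proof.
have h2 := ghom_gen2 F j k.
rewrite !kB_gen2 !mulr2n !(rD, rB, rN) (GX _ _ h2) !(YX _ l) !(DX l) rN.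
rewrite (XX l j v) (XX l k v) !rN (XX l k (v <* X j)) !rN !QX !scalerN.
by zmod.
Qed.

Lemma H_Y i j k v : (v <* H i j <* Y k) - (v <* Y k <* H i j) =
  (v <* X i <* X j <* Y k) - (v <* Y k <* X i <* X j).
Proof.
have E := identity2 jV v (hA_kX F i) (hA_kX F j) (hA_kY F k).
have XY l : X l *A Y k = kB (e l * e k) by rewrite kmulY /= (lin0 (@gpar_linear F n)) (lin0 (gder_linear _)) oppr0.
move: E; rewrite !XY !kGM /= !expr0 !expr1 !scale1r !scaleN1r => E.
have E1 := kB_gen2_X i k j v; have E2 := kB_gen2_X j k i v.
rewrite (YX k i v) rD rZ (YX k j) QX.
have -> : v <* H i j <* Y k - v <* Y k <* H i j =
   ((v <* kB (e j * e k) <* X i) + (v <* X i <* kB (e j * e k)))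
   - ((v <* kB (e i * e k) <* X j) + (v <* X j <* kB (e i * e k))).
  by apply: (zcomb1 E); zmod.
rewrite E1 E2 [i == j]eq_sym scalerN; zmod.
Qed.

(** ** The products e_i e_j *)

(** The defect of associativity. It commutes with e_k, \bar e_k and \bar 1, and it
    has square zero; it is central as soon as it commutes with the e_k e_l. *)
Fact eta_key : unit. Proof. by []. Qed.
Definition eta i j v : V := locked_with eta_key ((v <* H i j) - (v <* X i <* X j)).

Lemma etaE i j v : eta i j v = (v <* H i j) - (v <* X i <* X j).
Proof. by rewrite /eta unlock. Qed.

Lemma eta_linear i j : linear (eta i j).
Proof. by move=> k u v; rewrite !etaE !(rD, rZ) scalerBr; zmod. Qed.

Let eB i j u v : eta i j (u - v) = eta i j u - eta i j v.
Proof. exact: (linB (eta_linear i j)). Qed.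

Lemma eta_X i j k v : eta i j (v <* X k) = eta i j v <* X k.
Proof.
rewrite !etaE rB (GX _ _ (ghom_gen2 F i j)); congr (_ - _).
by rewrite (XX k i) rN (XX k j) opprK.
Qed.

Lemma eta_Y i j k v : eta i j (v <* Y k) = eta i j v <* Y k.
Proof. by rewrite !etaE rB; have E := H_Y i j k v; apply: (zcomb1 (esym E)); zmod. Qed.

Lemma eta_D i j v : eta i j (v <* D) = eta i j v <* D.
Proof.
rewrite !etaE rB (DG _ (ghom_gen2 F i j)); congr (_ - _).
by rewrite DX rN DX opprK.
Qed.

Lemma eta_sqr i j v : eta i j (eta i j v) = 0.
Proof.
have [<-|ij] := eqVneq i j.
  by rewrite etaE XX0 gen_sqr (lin0 (@kG_linear F n)) rr0 subrr.
have h2 := ghom_gen2 F i j.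
rewrite [eta i j v]etaE eB !eta_X etaE HH // etaE !rB !(GX _ _ h2).
by rewrite (XX i j) !rN XX0 !r0; zmod.
Qed.

Lemma eta_eta_H i j k l v :
  eta i j (eta k l v) - eta k l (eta i j v) = (v <* H k l <* H i j) - (v <* H i j <* H k l).
Proof.
have h2 := ghom_gen2 F i j; have h2' := ghom_gen2 F k l.
have X4 : v <* X i <* X j <* X k <* X l = v <* X k <* X l <* X i <* X j.
  rewrite (XX j k) rN (XX i k) !rN opprK (XX j l) (XX i l) !rN opprK.
  by [].
rewrite [eta k l v]etaE [eta i j v]etaE !eB !eta_X !etaE !rB X4.
by zmod.
Qed.

Lemma eta_central i j : (forall k l v, eta i j (v <* H k l) = eta i j v <* H k l) ->
  forall a v, eta i j (v <* a) = eta i j v <* a.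
Proof.
move=> eH; elim/kan_generated => [k a b|p q r a b c|||||].
- exact: (intertwines_linear jV jV (eta_linear i j)).
- exact: (intertwines_mul jV jV (eta_linear i j)).
- by move=> v; rewrite !r_one.
- by move=> k v; exact: eta_X.
- by move=> k v; exact: eta_Y.
- by move=> v; exact: eta_D.
by move=> k l v; exact: eH.
Qed.

Lemma eta_pr i j s v : eta i j (bm_pr s v) = bm_pr s (eta i j v).
Proof.
rewrite !etaE (linB (bm_pr_linear jV _)) (bm_r_bm_pr jV _ _ (hA_kG (ghom_gen2 F i j))).
by rewrite !(bm_r_bm_pr jV _ _ (hA_kX F _)) !addTb negbK.
Qed.

(** The commutator of two defects is that of the multiplications by e_i e_j and
    e_k e_l, hence central by [inner_derivation]; it is killed by the defects, so
    its square is zero. *)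
Lemma eta_comm i j k l v : eta i j (eta k l v) = eta k l (eta i j v).
Proof.
apply/eqP; rewrite -subr_eq0; apply/eqP; move: v.
pose om v := eta i j (eta k l v) - eta k l (eta i j v).
have omE v : om v = (v <* H k l <* H i j) - (v <* H i j <* H k l) by exact: eta_eta_H.
have om_lin : linear om by move=> c u v; rewrite /om !eta_linear scalerBr; zmod.
have omB u v : om (u - v) = om u - om v by exact: (linB om_lin).
have om_hom r c v : hA r c -> om (v <* c) = om v <* c.
  move=> hc; have h2 := ghom_gen2 F i j; have h2' := ghom_gen2 F k l.
  have := inner_derivation jV v (hA_kG h2') (hA_kG h2) hc.
  by rewrite !scale1r der_GG // andbF rr0 add0r expr0 scale1r -rB -!omE.
have om_r c v : om (v <* c) = om v <* c.
  rewrite -(sa_pr_sum jV c) !rrD (linD om_lin).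
  by rewrite !(om_hom _ _ _ (hA_pr jV _ _)).
have om_eta i1 j1 v : om (eta i1 j1 v) = eta i1 j1 (om v).
  by rewrite etaE omB !om_r -etaE.
have om_eta0 v : om (eta i j v) = 0.
  apply: (vdouble_eq0 char2); rewrite {1}om_eta /om eB !eta_sqr.
  by rewrite (lin0 (eta_linear k l)); zmod.
have om2 v : om (om v) = 0.
  by rewrite {2}/om omB om_eta0 om_eta om_eta0 (lin0 (eta_linear k l)) subrr.
apply: (nilpotent_central_eq0 jV iV om_lin _ _ om2).
  move=> s v; rewrite /om !eta_pr -(linB (bm_pr_linear jV s)) => ->; exact: (lin0 (bm_pr_linear jV _)).
by move=> a v; rewrite om_r => ->; rewrite r0.
Qed.

Lemma eta_eq0 i j v : eta i j v = 0.
Proof.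
have eC a u : eta i j (u <* a) = eta i j u <* a.
  apply: eta_central => k l w.
  have E : w <* H k l = eta k l w + (w <* X k <* X l) by rewrite (etaE k l) subrK.
  have E' : eta i j w <* H k l = eta k l (eta i j w) + (eta i j w <* X k <* X l).
    by rewrite (etaE k l) subrK.
  by rewrite E E' (linD (eta_linear i j)) !eta_X eta_comm.
apply: (nilpotent_central_eq0 jV iV (eta_linear i j)) => {v}.
- by move=> s v; rewrite eta_pr => ->; exact: (lin0 (bm_pr_linear jV _)).
- by move=> a v; rewrite eC => ->; rewrite r0.
exact: eta_sqr.
Qed.

Lemma HE i j v : v <* H i j = v <* X i <* X j.
Proof. by apply/eqP; rewrite -subr_eq0 -etaE eta_eq0. Qed.

(** ** The action of the Grassmann algebra is associative *)

Definition rword v (w : seq 'I_n) := foldl (fun u i => u <* X i) v w.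

Lemma rword_X v i (w : seq 'I_n) : rword (v <* X i) w = sg (odd (size w)) *: (rword v w <* X i).
Proof.
elim/last_ind: w => [|w j IH]; first by rewrite scale1r.
rewrite /rword !foldl_rcons -/(rword _ _) -/(rword _ _) IH rZ XX scalerN size_rcons /=.
by rewrite signrN scaleNr.
Qed.

(** The identity for e_i, w and e_j gives the action of e_i e_j w. *)
Lemma r_gword (w : seq 'I_n) v : v <* kG (gword F w) = rword v w.
Proof.
have [m] := ubnP (size w); elim: m w v => // m IH [|i [|j w]] v sw.
- by rewrite gword_nil1 r_one.
- by rewrite gword1.
have hw := @ghom_gword F n w; rewrite /= !ltnS in sw.
have := identity1 jV v (hA_kX F i) (hA_kG hw) (hA_kX F j).
rewrite /kX !kGM -[e i * e j * _]mulrA -!gword_cons -gword_rcons.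
rewrite !(IH w) ?(ltnW sw) // (IH (rcons w j)) ?size_rcons // (IH (i :: w)) //.
rewrite -/(X i) -/(X j) /rword foldl_rcons /= -/(rword _ _) -!/(rword _ _) HE.
rewrite !rword_X.
case: (odd (size w)); rewrite /= ?expr0 ?expr1 ?scale1r ?scaleN1r ?rN => E;
  [apply: (zcomb1 (esym E)) | apply: (zcomb1 E)]; zmod.
Qed.

Lemma r_kG_mul f g v : v <* kG f <* kG g = v <* kG (f * g).
Proof.
elim/gword_ind: f => [k f1 f2 IH1 IH2|u].
  by rewrite mulrDl -scalerAl !(@kG_linear F n) !(rrD, rrZ) rD rZ IH1 IH2.
elim/gword_ind: g => [k f1 f2 IH1 IH2|w].
  by rewrite mulrDr -scalerAr !(@kG_linear F n) !(rrD, rrZ) IH1 IH2.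
by rewrite gwordM !r_gword /rword foldl_cat.
Qed.

(** ** The kernel of Q *)

Lemma YYY i j v : i != j -> v <* Y i <* Y j <* Y i = 0.
Proof.
move=> ij; have := identity1 jV v (hA_kY F i) (hA_kY F j) (hA_kY F i).
have YY k l : Y k *A Y l = (k == l)%:R *: kG 1.
  rewrite kmulY /= mul0r gpar_gen (linN (gder_linear l)) opprK gder_gen eq_sym.
  by congr pair; rewrite /= ?scaler0 // scaler_nat.
rewrite !YY eqxx eq_sym (negbTE ij) !scale0r !rr0 !scale1r.
have -> : kG 1 *A Y j = Y j by rewrite kmulY /= mul1r (lin0 (@gpar_linear F n)) (lin0 (gder_linear _)) oppr0.
rewrite r_one addr0 add0r => E; apply: (vdouble_eq0 char2); apply: (zcomb1 E); zmod.
Qed.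

(** Obtained by moving [X j] through the relation [YYY]. *)
Lemma QYY i v : Q (v <* Y i) <* Y i = 0.
Proof.
have [j ij] := other i.
rewrite (QE j) rB -[_ <* X j <* Y i]YX_neq // (YX_neq v ij) !YYY // r0 subrr.
by [].
Qed.

Lemma ker_XY i v : Q v = 0 -> v <* X i <* Y i = 0.
Proof. by move=> qv; have := QYY i v; rewrite QY qv r0 addr0. Qed.

Lemma ker_opd i v : Q v = 0 -> Q (opd i v) = 0.
Proof.
by move=> qv; rewrite opdE QB_ QY !QD QY qv !r0 DX subr0 addr0; zmod.
Qed.

Lemma ker_X i v : Q v = 0 -> Q (v <* X i) = 0.
Proof. by move=> qv; rewrite QX qv r0 oppr0. Qed.

(** On the kernel of [Q] the action of \bar e_i reduces to those of e_i and \bar 1: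
    this is the derivative of [ker_XY]. *)
Lemma ker_Y i v : Q v = 0 -> v <* Y i = v <* X i <* D.
Proof.
move=> qv; have := congr1 (opd i) (ker_XY i qv).
rewrite opdY opdX eqxx !scale1r rB (ker_XY _ (ker_opd i qv)) d0_ => E.
by apply: (zcomb1 E); zmod.
Qed.

(** On the kernel of [Q], the operators [lowr i] and [X j] satisfy the canonical
    anticommutation relations, by [lowr_X] and [lowr_anticomm]. *)
Definition lowr i v : V := v <* D <* Y i.

Lemma lowr_linear i : linear (lowr i).
Proof. by move=> k u v; rewrite /lowr !(rD, rZ). Qed.

Lemma ker_lowr i v : Q v = 0 -> Q (lowr i v) = 0.
Proof.
by move=> qv; rewrite /lowr QY QD qv r0 subr0 DX (ker_Y i qv) addNr.
Qed.

Lemma lowr_X i j v : Q v = 0 -> lowr i (v <* X j) = (i == j)%:R *: v - (lowr i v <* X j).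
Proof.
move=> qv; have := DX j v => /(congr1 (fun u => - u)); rewrite opprK /lowr => <-.
by rewrite rN YX QD qv r0 subr0; zmod.
Qed.

Lemma lowr_T i v : lowr i (v <* D <* D) = lowr i v <* D <* D.
Proof. by rewrite /lowr -!DD_central. Qed.

Lemma lowr_anticomm i j v : Q v = 0 -> lowr i (lowr j v) = - lowr j (lowr i v).
Proof.
move=> qv.
have opd_lowr k u : Q u = 0 -> opd k u = lowr k u - (u <* X k <* D <* D).
  by move=> qu; rewrite opdE /lowr (ker_Y k qu).
have E : opd j (lowr i v) = - ((i == j)%:R *: (v <* D <* D)) - lowr i (opd j v).
  by rewrite /lowr opdY opdD !rN eq_sym.
rewrite (opd_lowr j _ (ker_lowr i qv)) (opd_lowr j v qv) in E.
rewrite (linB (lowr_linear i)) lowr_T lowr_X // !(rB, rZ) in E.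
by apply: (zcomb1 E); zmod.
Qed.

Lemma lowr_sqr i v : Q v = 0 -> lowr i (lowr i v) = 0.
Proof.
by move=> qv; apply: (vdouble_eq0 char2); rewrite {1}lowr_anticomm // addNr.
Qed.

Lemma hV_lowr i p v : homog (@bm_pr F A V) p v -> homog (@bm_pr F A V) (~~ p) (lowr i v).
Proof.
move=> hv; rewrite /lowr.
by have := hom_r jV (hA_kY F i) (hom_r jV (hA_kD F n) hv).
Qed.

Lemma Q_hom p v : homog (@bm_pr F A V) p v -> homog (@bm_pr F A V) (~~ p) (Q v).
Proof. by move=> hv; rewrite /homog /Q -opQ_pr hv. Qed.

(** As the operators [lowr i] anticommute and have square zero, applying those that
    do not kill a vector leads to a vector killed by all of them. It plays the role
    of 1 in the deformed bimodule. *)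
Lemma vacuum : exists p m,
  [/\ homog (@bm_pr F A V) p m, m <> 0, Q m = 0 & forall i, lowr i m = 0].
Proof.
have [p [m [hm m0 qm]]] : exists p m, [/\ homog (@bm_pr F A V) p m, m <> 0 & Q m = 0].
  have [[v v0] _] := iV.
  have [p [m [hm m0]]] : exists p m, homog (@bm_pr F A V) p m /\ m <> 0.
    have [h|h] := eqVneq (bm_pr false v) 0.
      exists true, v; split=> //; rewrite /homog -{2}(bm_pr_sum jV v) h add0r.
      by [].
    by exists false, (bm_pr false v); split; [exact: hV_pr | apply/eqP].
  have [qm|/eqP qm] := eqVneq (Q m) 0; first by exists p, m.
  by exists (~~ p), (Q m); split; rewrite ?QQ //; exact: Q_hom.
suff [p' [m' [h1 h2 h3 h4]]] : exists p m, [/\ homog (@bm_pr F A V) p m, m <> 0, Q m = 0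
    & forall i, i \in enum 'I_n -> lowr i m = 0].
  by exists p', m'; split=> // i; apply: h4; rewrite mem_enum.
elim: (enum 'I_n) => [|i s [p' [m' [h1 h2 h3 h4]]]]; first by exists p, m; split.
have [li|/eqP li] := eqVneq (lowr i m') 0.
  exists p', m'; split=> // k; rewrite inE => /orP[/eqP->//|]; exact: h4.
exists (~~ p'), (lowr i m'); split=> //; first exact: hV_lowr.
  exact: ker_lowr.
move=> k; rewrite inE => /orP[/eqP->|/h4 lk]; first exact: lowr_sqr.
by rewrite lowr_anticomm // lk (lin0 (lowr_linear i)) oppr0.
Qed.

End Relations.

(** * Vacuum vectors *)

Section Vacuum.
Variables (F : fieldType) (n : nat) (V : superbimod (Kan F n)).
Hypothesis char2 : (2%:R : F) != 0.
Hypothesis n_ge2 : (2 <= n)%N.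
Hypothesis jV : jordan_bimod V.
Hypothesis uV : unital_bimod V.
Hypothesis iV : irreducible_bimod V.

Local Notation G := (gring F n).
Local Notation A := (Kan F n).
Local Notation "v '<*' a" := (@bm_r F (Kan F n) V v a) (at level 45, left associativity).
Local Notation X := (@kX F n).
Local Notation Y := (@kY F n).
Local Notation D := (@kD F n).
Local Notation e := (@gen F n).
Local Notation Q := (@Q F n V n_ge2).
Implicit Types (v w m : V) (f g : G) (i j : 'I_n).

Let rlin a := bm_r_linearl jV a.
Let rr v := bm_r_linear jV v.
Let rD a u v : (u + v) <* a = (u <* a) + (v <* a). Proof. exact: (linD (rlin a)). Qed.
Let rN a v : (- v) <* a = - (v <* a). Proof. exact: (linN (rlin a)). Qed.
Let r0 a : (0 : V) <* a = 0. Proof. exact: (lin0 (rlin a)). Qed.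
Let rZ a k v : (k *: v) <* a = k *: (v <* a). Proof. exact: (linZ (rlin a)). Qed.
Let rG v : linear (fun f : G => v <* kG f).
Proof. by move=> k f g; rewrite (@kG_linear F n) (rr v). Qed.

Definition is_vacuum m := Q m = 0 /\ forall i, lowr i m = 0.

Lemma vacuum_T m : is_vacuum m -> is_vacuum (m <* D <* D).
Proof.
case=> qm lm; split; last by move=> i; rewrite (lowr_T char2) // lm !r0.
by rewrite !(QD n_ge2 jV uV) qm r0 subr0 subrr.
Qed.

Lemma ker_kG f v : Q v = 0 -> Q (v <* kG f) = 0.
Proof.
have QL := Q_linear n_ge2 jV; move=> qv; elim/gmul_rind: f => [|k f g IHf IHg|i f IH].
- by rewrite r_one.
- by rewrite rG QL IHf IHg scaler0 addr0.
by rewrite -(r_kG_mul char2 n_ge2 jV uV iV); exact: ker_X.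
Qed.

Lemma lowr_kG i f m : is_vacuum m ->
  lowr i (m <* kG f) = - (m <* kG (gder i (gpar f))).
Proof.
case=> qm lm; elim/gmul_rind: f => [|k f g IHf IHg|j f IH].
- by rewrite r_one // lm gpar1 gder1 (lin0 (rG m)) oppr0.
- by rewrite rG (lowr_linear jV) IHf IHg gpar_linear gder_linear rG opprD scalerN.
rewrite -(r_kG_mul char2 n_ge2 jV uV iV) (lowr_X char2 jV uV iV _ _ (ker_kG f qm)) IH.
rewrite gparM gpar_gen mulrN (linN (gder_linear i)) gderM gparK gder_gen.
rewrite (linN (rG m)) opprK rN opprK (r_kG_mul char2 n_ge2 jV uV iV) (linD (rG m)) addrC.
by rewrite mulr_natr -scaler_nat (linZ (rG m)).
Qed.

(** The only map from the deformed bimodule that sends 1 to [m] and commutes with the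
    action, as \bar g = g \bar 1. For a vacuum vector it commutes with [X i] and [Y i],
    and also with [D] when D^2 is the scalar alpha. *)
Definition vacmap m (x : G * G) : V := (m <* kG x.1) + (m <* kG x.2 <* D).

Lemma vacmap_linear m : linear (vacmap m).
Proof.
by move=> k x y; rewrite /vacmap /= !rG rD rZ scalerDr addrACA.
Qed.

Lemma vacmap_X m x i : vacmap m x <* X i = vacmap m (x.1 * e i, - (x.2 * e i)).
Proof.
rewrite /vacmap /= rD (DX char2 n_ge2 jV iV) !(r_kG_mul char2 n_ge2 jV uV iV).
by rewrite (linN (rG m)) rN.
Qed.

Lemma vacmap_D m x : vacmap m x <* D = vacmap m (0, x.1) + (m <* D <* D <* kG x.2).
Proof. by rewrite /vacmap /= rD (lin0 (rG m)) add0r DD_central. Qed.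

Lemma vacmap_Y m x i : is_vacuum m ->
  vacmap m x <* Y i = vacmap m (- gder i (gpar x.2) : G, x.1 * e i).
Proof.
move=> vm; have [qm _] := vm; rewrite /vacmap /= rD -/(lowr i _) (lowr_kG _ _ vm).
rewrite (ker_Y char2 jV uV iV _ (ker_kG _ qm)) (r_kG_mul char2 n_ge2 jV uV iV).
by rewrite (linN (rG m)) addrC.
Qed.

Lemma vacmap_hom m p q (x : A) : homog (@bm_pr F A V) p m ->
  homog (@sa_pr F A) q x -> homog (@bm_pr F A V) (p (+) q) (vacmap m x).
Proof.
move=> hm /kan_homogP[h1 h2]; rewrite /homog /vacmap (linD (bm_pr_linear jV _)).
have H1 := hom_r jV (hA_kG h1) hm.
have H2 := hom_r jV (hA_kD F n) (hom_r jV (hA_kG h2) hm).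
rewrite /homog in H1 H2; rewrite -{2}H1 -{2}H2 addTb addNb negbK.
by rewrite addbC.
Qed.

Lemma vacmap_pr m p b (x : A) : homog (@bm_pr F A V) p m ->
  bm_pr b (vacmap m x) = vacmap m (sa_pr (p (+) b) x).
Proof.
move=> hm; rewrite -{1}(sa_pr_sum jV x) (linD (vacmap_linear m)) (linD (bm_pr_linear jV _)).
have K s : bm_pr b (vacmap m (sa_pr s x)) = if s == p (+) b then vacmap m (sa_pr s x) else 0.
  have := vacmap_hom hm (hA_pr jV s x); rewrite {1}/homog => {1}<-.
  rewrite bm_prK //; have <- : (b == p (+) s) = (s == p (+) b) by case: (b) (p) s => [] [] [].
  by case: eqP => // ->; exact: vacmap_hom hm (hA_pr jV s x).
by rewrite !K; case: (p (+) b); rewrite /= ?addr0 ?add0r.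
Qed.

Lemma r_stable (S : V -> Prop) :
  (forall k u v, S u -> S v -> S (k *: u + v)) ->
  (forall i v, S v -> S (v <* X i)) -> (forall i v, S v -> S (v <* Y i)) ->
  (forall v, S v -> S (v <* D)) -> forall a v, S v -> S (v <* a).
Proof.
move=> SL SX SY SD a.
have S0 v : S v -> S 0 by move=> Sv; have := SL (-1) _ _ Sv Sv; rewrite scaleN1r addNr.
have Sadd u v : S u -> S v -> S (u + v) by move=> ? ?; rewrite -[u]scale1r; exact: SL.
have SZ k v : S v -> S (k *: v) by move=> Sv; rewrite -[_ *: _]addr0; apply: SL (Sv) (S0 _ Sv).
elim/kan_generated: a => [k a b Sa Sb v Sv|p q r a b c ha hb hc Sa Sb Sc Sab Sac Sbc v Sv|v Sv||||].
- by rewrite (rr v); apply: SL; [exact: Sa | exact: Sb].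
- have := identity1 jV v ha hb hc; set x := v <* sa_mul _ b => E.
  have -> : x = (-1) ^+ (q && r) *: ((-1) ^+ (q && r) *: x) by rewrite scalerA -signr_addb addbb scale1r.
  apply: (SZ); have -> : (-1) ^+ (q && r) *: x = (v <* a <* sa_mul b c)
    + (-1) ^+ (p && q) *: (v <* b <* sa_mul a c)
    + (-1) ^+ (r && (p (+) q)) *: (v <* c <* sa_mul a b)
    + (-1) *: ((v <* a <* b <* c)
    + (-1) ^+ ((p && q) (+) (p && r) (+) (q && r)) *: (v <* c <* b <* a)).
    by rewrite -E scaleN1r; zmod.
  by repeat first [apply: (Sadd) | apply: (SZ)]; [exact: Sbc (Sa _ Sv) | exact: Sac (Sb _ Sv)
    | exact: Sab (Sc _ Sv) | exact: Sc (Sb _ (Sa _ Sv)) | exact: Sa (Sb _ (Sc _ Sv))].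
- by rewrite r_one.
- exact: SX.
- exact: SY.
- exact: SD.
by move=> i j v Sv; rewrite (HE char2 n_ge2 jV uV iV); apply/SX/SX.
Qed.

(** The submodule generated by D^2 m, seen as a module over the polynomials in D^2:
    it is finitely generated, by the [vacmap (m <* D <* D) x] for [x] in a basis. *)
Inductive vacspan m : V -> Prop :=
| VacMap x : vacspan m (vacmap (m <* D <* D) x)
| VacT v : vacspan m v -> vacspan m (v <* D <* D)
| VacL k u v : vacspan m u -> vacspan m v -> vacspan m (k *: u + v).

Lemma vacspan_graded p m : homog (@bm_pr F A V) p m -> is_vacuum m ->
  graded_subbimod (vacspan m).
Proof.
move=> hm vm; have vTm := vacuum_T vm.
have hTm : homog (@bm_pr F A V) p (m <* D <* D).
  by have := hom_r jV (hA_kD F n) (hom_r jV (hA_kD F n) hm); rewrite !addTb negbK.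
have S0 : vacspan m 0 by have := VacMap m 0; rewrite (lin0 (vacmap_linear _)).
have SLr k u v : vacspan m u -> vacspan m v -> vacspan m (k *: u + v) by exact: VacL.
apply: graded_rightsub => //.
- move=> b v; elim=> [x|u _ IH|k u w _ IHu _ IHw].
  + by rewrite (vacmap_pr _ _ hTm); exact: VacMap.
  + rewrite !(bm_r_bm_pr jV _ _ (hA_kD F n)) !addTb negbK.
    exact: VacT.
  by rewrite (bm_pr_linear jV); exact: VacL.
apply: r_stable => // [i v|i v|v]; elim=> [x|u _ IH|k u w _ IHu _ IHw];
  do ?[by rewrite -DD_central //; exact: VacT | by rewrite (rlin _); exact: VacL].
- by rewrite vacmap_X; exact: VacMap.
- by rewrite vacmap_Y //; exact: VacMap.
- rewrite vacmap_D -[vacmap _ (0, x.1)]scale1r; apply: VacL; first exact: VacMap.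
  have -> : m <* D <* D <* D <* D <* kG x.2 = vacmap (m <* D <* D) (x.2, 0) <* D <* D.
    by rewrite /vacmap /= (lin0 (rG _)) r0 addr0 DD_central.
  exact/VacT/VacMap.
exact: VacT.
Qed.

Definition etop : G := gbas F [set: 'I_n].

Lemma mul_etop f : f * etop = f set0 *: etop.
Proof.
elim/gbas_ind: f => [|a f g IHf IHg|J]; first by rewrite mul0r ffunE scale0r.
  by rewrite mulrDl -scalerAl IHf IHg !ffunE scalerDl scalerA.
rewrite /etop -!(gword_enum F) gwordM gword_enum.
rewrite ffunE; have [<-|ne] := eqVneq set0 J.
  by rewrite enum_set0 scale1r gword_enum.
rewrite scale0r /gword cat_uniq; case: ifP => // /and3P[_ /hasPn h _].
have [i iJ] : exists i, i \in J by apply/set0Pn; rewrite eq_sym.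
by have := h i; rewrite !mem_enum inE iJ => /(_ isT).
Qed.

(** The lowering operators bring [m <* kG (gbas F J)] back to [m]. *)
Lemma vacuum_gbas m J : is_vacuum m -> m <* kG (gbas F J) = 0 -> m = 0.
Proof.
move=> vm; have [k] := ubnP #|J|; elim: k J => // k IH J cJ mJ.
have [J0|[i iJ]] := set_0Vmem J.
  by move: mJ; rewrite J0 -(gword_enum F) enum_set0 gword_nil1 r_one.
apply: (IH (J :\ i)); first by move: cJ; rewrite (cardsD1 i J) iJ.
have := lowr_kG i (gbas F J) vm; rewrite mJ (lin0 (lowr_linear jV i)).
rewrite gpar_gbas (linZ (gder_linear i)) gder_gbas iJ !(linZ (rG m)).
move/esym/eqP; rewrite oppr_eq0 !scaler_eq0 signr_eq0 (negbTE (sgn_neq0 F _)).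
by move/eqP.
Qed.

End Vacuum.

(** * Eigenvectors of a linear map killed by a polynomial *)

Section PolynomialAction.
Variables (F : fieldType) (V : lmodType F) (T : V -> V).
Hypothesis T_lin : linear T.
Implicit Types (p q : {poly F}) (v : V).

Definition pact p v : V := \sum_(i < size p) p`_i *: iter i T v.

Lemma pact_wide k p v : (size p <= k)%N -> pact p v = \sum_(i < k) p`_i *: iter i T v.
Proof.
move=> pk; rewrite /pact -!(big_mkord xpredT (fun i => p`_i *: iter i T v)).
rewrite [RHS](big_cat_nat (n := size p)) //= [X in _ + X]big1_seq ?addr0 // => i.
by rewrite mem_index_iota => /andP[_ /andP[pi _]]; rewrite nth_default ?scale0r.
Qed.

Lemma pactL a p q v : pact (a *: p + q) v = a *: pact p v + pact q v.
Proof.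
pose k := maxn (size p) (size q).
have sp : (size p <= k)%N by exact: leq_maxl.
have sq : (size q <= k)%N by exact: leq_maxr.
have sr : (size (a *: p + q)%R <= k)%N.
  by apply: leq_trans (size_polyD _ _) _; rewrite geq_max sq (leq_trans (size_scale_leq _ _)).
rewrite !(pact_wide _ sp, pact_wide _ sq, pact_wide _ sr) scaler_sumr -big_split.
by apply: eq_bigr => i _; rewrite coefD coefZ scalerDl scalerA.
Qed.

Lemma pact0 v : pact 0 v = 0.
Proof. by rewrite /pact size_poly0 big_ord0. Qed.

Lemma pactC c v : pact c%:P v = c *: v.
Proof. by rewrite (pact_wide _ (size_polyC_leq1 c)) big_ord1 coefC. Qed.

Lemma pactX p v : pact ('X * p) v = pact p (T v).
Proof.
have s : (size ('X * p)%R <= (size p).+1)%N.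
  by apply: leq_trans (size_polyMleq _ _) _; rewrite size_polyX.
rewrite (pact_wide _ s) big_ord_recl coefXM scale0r add0r; apply: eq_bigr => i _.
by rewrite coefXM /= -iterSr.
Qed.

Lemma pactT p v : pact p (T v) = T (pact p v).
Proof.
rewrite /pact (lin_sum T_lin); apply: eq_bigr => i _.
by rewrite (linZ T_lin) -iterS -iterSr.
Qed.

Lemma iter_linear i : linear (iter i T).
Proof. by move=> a u v; elim: i => //= i ->; exact: T_lin. Qed.

Lemma pact_linear p : linear (pact p).
Proof.
move=> a u v; rewrite /pact scaler_sumr -big_split; apply: eq_bigr => i _ /=.
by rewrite iter_linear scalerDr !scalerA mulrC.
Qed.

End PolynomialAction.

Lemma eigenvector (F : closedFieldType) (V : lmodType F) (T : V -> V) (p : {poly F}) v :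
  linear T -> p != 0 -> v <> 0 -> pact T p v = 0 ->
  exists a w, w <> 0 /\ T w = a *: w.
Proof.
move=> TL p0 v0; have [r ->] := closed_field_poly_normal p.
rewrite -[_ *: _]addr0 pactL // pact0 addr0 => /eqP.
rewrite scaler_eq0 lead_coef_eq0 (negbTE p0) /= => /eqP.
elim: r v v0 => [|a r IH] v v0.
  by rewrite big_nil -[1]/(1%:P) pactC scale1r.
rewrite big_cons.
have -> : ('X - a%:P) * \prod_(z <- r) ('X - z%:P) =
   (- a) *: \prod_(z <- r) ('X - z%:P) + 'X * \prod_(z <- r) ('X - z%:P) :> {poly F}.
  by rewrite mulrBl mul_polyC scaleNr addrC.
rewrite pactL // pactX // -(pact_linear TL).
have [w0|/eqP w0] := eqVneq (- a *: v + T v) 0.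
  exists a, v; split=> //; apply/eqP; rewrite -subr_eq0 addrC -scaleNr; exact/eqP.
exact: IH.
Qed.

(** * The deformed bimodule is irreducible *)

Section KalphaIrreducible.
Variables (F : fieldType) (n : nat) (alpha : F).
Local Notation G := (gring F n).
Local Notation K := (Kalpha n alpha).
Local Notation "v '<*' a" := (@bm_r F (Kan F n) K v a) (at level 45, left associativity).
Implicit Types (f g h : G) (i : 'I_n) (x : G * G).

Let gp0 : gpar (0 : G) = 0 := lin0 (@gpar_linear F n).
Let eu0 : geuler (0 : G) = 0 := lin0 (@geuler_linear F n).
Let br0 h : gbracket h (0 : G) = 0 :> G := lin0 (gbracket_linear h).

Lemma kalG x f : x <* kG f = (x.1 * f, x.2 * gpar f).
Proof. by rewrite /= /kal_r /= gp0 br0 eu0 !mulr0 scaler0 addr0 subr0 add0r. Qed.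

Lemma kalX x i : x <* kX F i = (x.1 * gen F i, - (x.2 * gen F i)).
Proof. by rewrite kalG gpar_gen mulrN. Qed.

Lemma kalY x i : x <* kY F i = (- gder i (gpar x.2) : G, x.1 * gen F i).
Proof.
rewrite /= /kal_r /= gp0 !mulr0 add0r addr0 gpar_gen (linN (gbracket_linear _)) gbracket_gen.
by rewrite (linN (@geuler_linear F n)) geuler_gen oppr0 mulr0 scaler0 subr0.
Qed.

Lemma kalD x : x <* kD F n = (alpha *: x.2, x.1).
Proof.
rewrite /= /kal_r /= gp0 !mulr0 add0r addr0 mulr1 gpar1 gbracket1 geuler1.
by rewrite mulrN mulr1 scalerN opprK add0r.
Qed.

Lemma kal1 x : (1, 0) <* (x : Kan F n) = x.
Proof.
rewrite /= /kal_r /= !mul1r !mul0r (lin0 (gbracket_linearl _)) scaler0 subr0 !addr0.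
by case: x.
Qed.

Lemma kal_lower x i : x <* kD F n <* kY F i = (- gder i (gpar x.1) : G, alpha *: x.2 * gen F i).
Proof. by rewrite kalD kalY. Qed.

Lemma kal_top x i : (x <* kY F i <* kX F i) - (x <* kX F i <* kY F i) = (x.2, 0).
Proof.
rewrite !kalX !kalY /=; congr pair; rewrite /=; last first.
  by rewrite -!mulrA gen_sqr !mulr0 oppr0 addr0.
rewrite (linN (@gpar_linear F n)) gparM gpar_gen mulrN !opprK gderM gparK gder_gen eqxx.
by rewrite mulNr addKr mulr1.
Qed.

Lemma gder_coef i f (J : {set 'I_n}) :
  gder i f J = if i \in J then 0 else f (i |: J) * sgn_word F (i :: enum J).
Proof.
elim/gbas_ind: f => [|a f g IHf IHg|I]; first by rewrite (lin0 (gder_linear i)) !ffunE mul0r if_same.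
  rewrite gder_linear !ffunE IHf IHg; case: ifP => _; first by rewrite scaler0 addr0.
  by rewrite mulrDl /GRing.scale /= mulrA.
rewrite gder_gbas ffunE; case: ifP => iI; last first.
  rewrite ffunE; case: ifP => // _; case: eqP => [E|]; last by rewrite mul0r.
  by rewrite -E setU11 in iI.
rewrite !ffunE; case: ifP => iJ.
  by case: eqP => [E|]; rewrite /GRing.scale /= ?mulr0 //; rewrite E !inE eqxx in iJ.
have -> : (i |: J == I) = (J == I :\ i).
  apply/eqP/eqP => [<-|->]; last by rewrite setD1K.
  by rewrite setU1K // iJ.
by case: eqP => [->|]; rewrite /GRing.scale /= ?mulr0 ?mul0r // mulr1 mul1r.
Qed.

Hypothesis n_gt0 : (0 < n)%N.

(** A nonzero submodule contains a nonzero (f, 0), by [kal_top]; the operators of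
    [kal_lower], which are derivatives on such vectors, lead from it to (1, 0), and
    this generates the bimodule. *)
Lemma Kalpha_irreducible : irreducible_bimod K.
Proof.
split; first by exists (1, 0) => /(congr1 fst) /= /eqP; rewrite (negbTE (oner_neq0 _)).
move=> W [W0 WL _ WA].
have Wr a x : W x -> W (x <* a) by move=> /(WA a)[].
have WB x y : W x -> W y -> W (x - y).
  by move=> Wx Wy; rewrite -scaleN1r addrC; exact: WL.
have done1 : W (1, 0) -> forall x, W x by move=> W1 x; rewrite -[x]kal1; exact: Wr.
have low k f : (forall J : {set 'I_n}, (k <= #|J|)%N -> f J = 0) -> f <> 0 -> W (f, 0) -> W (1, 0).
  elim: k f => [|k IH] f fk f0 Wf; first by case: f0; apply/ffunP => J; rewrite fk // ffunE.
  have [/existsP[i di]|/existsPn d0] := boolP [exists i, gder i (gpar f) != 0].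
    apply: (IH (- gder i (gpar f))).
    - move=> J kJ; rewrite ffunE gder_coef; case: ifP => [|/negbT iJ]; first by rewrite oppr0.
      by rewrite ffunE fk ?mulr0 ?mul0r ?oppr0 // cardsU1 iJ.
    - by move/eqP; rewrite oppr_eq0 (negbTE di).
    have := Wr (kY F i) _ (Wr (kD F n) _ Wf); rewrite kal_lower /=.
    by rewrite scaler0 mul0r.
  (* all derivatives of [f] vanish: [f] is a constant *)
  have fE : f = f set0 *: (1 : G).
    apply/ffunP => J; rewrite !ffunE; have [->|[i iJ]] := set_0Vmem J.
      by rewrite eqxx /GRing.scale /= mulr1.
    have Jn0 : (J == set0) = false by apply/negbTE/set0Pn; exists i.
    have := d0 i; rewrite negbK => /eqP/ffunP/(_ (J :\ i)).
    rewrite gder_coef !inE eqxx /= setD1K // !ffunE Jn0 /GRing.scale /= mulr0 => /eqP.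
    by rewrite !mulf_eq0 signr_eq0 (negbTE (sgn_neq0 F _)) orbF => /eqP.
  have c0 : f set0 != 0 by apply/eqP => c0; apply: f0; rewrite fE c0 scale0r.
  move: fE c0; set c := f set0 => fE c0.
  have := WL c^-1 _ _ Wf W0; rewrite addr0; congr W.
  by congr pair; rewrite /= ?scaler0 // fE scalerA mulVf // scale1r.
have low' f : f <> 0 -> W (f, 0) -> W (1, 0).
  by apply: (low n.+1) => J; rewrite ltnNge -[X in (_ <= X)%N]card_ord max_card.
have [[x [Wx x0]]|no] := Classical_Prop.classic (exists x, W x /\ x <> 0); last first.
  by left=> x Wx; apply/eqP/negPn/negP => /eqP x0; apply: no; exists x.
right; apply: done1; have [x2|/eqP x2] := eqVneq (x.2 : G) 0.
  have ex : x = (x.1, 0) by rewrite -x2; case: (x).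
  by apply: (low' x.1); rewrite -?ex // => x1; apply: x0; rewrite ex x1.
apply: (low' x.2) => //; pose i := Ordinal n_gt0; rewrite -(kal_top x i).
by apply: WB; do 2!apply: (Wr).
Qed.

End KalphaIrreducible.

(** * Isomorphisms and right actions *)

(** [s] tells whether the map exchanges the parities; the left actions then differ
    by the sign that defines the opposite bimodule. *)
Section RightIsomorphism.
Variables (F : fieldType) (A : superalg F) (V W : superbimod A).
Hypotheses (jV : jordan_bimod V) (jW : jordan_bimod W).
Variables (s : bool) (f : V -> W).
Hypothesis f_lin : linear f.
Hypothesis f_bij : bijective f.
Hypothesis f_pr : forall b v, f (bm_pr b v) = bm_pr (s (+) b) (f v).
Hypothesis f_r : forall a v, f (bm_r v a) = bm_r (f v) a.

Lemma right_iso_l (a : A) v :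
  f (bm_l a v) = bm_l (sa_pr false a) (f v) + (-1) ^+ s *: bm_l (sa_pr true a) (f v).
Proof.
have H p q : f (bm_l (sa_pr p a) (bm_pr q v)) =
    (-1) ^+ (p && s) *: bm_l (sa_pr p a) (f (bm_pr q v)).
  have hp := hA_pr jV p a; have hq := hV_pr jV q v.
  have hf : homog (@bm_pr F A W) (s (+) q) (f (bm_pr q v)).
    by rewrite /homog -f_pr hq.
  rewrite (bm_lr jV hp hq) (bm_lr jW hp hf) (linZ f_lin) f_r scalerA -signr_addb.
  by congr (_ *: _); rewrite -andb_addr addKb.
have H' p : f (bm_l (sa_pr p a) v) = (-1) ^+ (p && s) *: bm_l (sa_pr p a) (f v).
  rewrite -[in LHS](bm_pr_sum jV v) (linD (bm_l_linear jV _)) (linD f_lin) !H.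
  by rewrite -scalerDr -(linD (bm_l_linear jW _)) -(linD f_lin) (bm_pr_sum jV).
rewrite -{1}(sa_pr_sum jV a) (linD (bm_l_linearl jV _)) (linD f_lin) !H'.
by rewrite scale1r.
Qed.

Lemma right_iso : if s then bimod_iso V (op_bimod W) else bimod_iso V W.
Proof.
pose fl : {linear V -> W} := HB.pack f (GRing.isLinear.Build F V W *:%R f f_lin).
have lE := right_iso_l; have prE := f_pr.
case: (s) lE prE => lE prE; exists fl; split=> //=.
- by move=> a v; rewrite lE scaleN1r.
by move=> a v; rewrite lE scale1r -(linD (bm_l_linearl jW _)) (sa_pr_sum jW).
Qed.

End RightIsomorphism.

(** * Classification *)

Section Classification.
Variables (F : closedFieldType) (n : nat) (V : superbimod (Kan F n)).
Hypothesis char2 : (2%:R : F) != 0.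
Hypothesis n_ge2 : (2 <= n)%N.
Hypothesis jV : jordan_bimod V.
Hypothesis uV : unital_bimod V.
Hypothesis iV : irreducible_bimod V.

Local Notation G := (gring F n).
Local Notation A := (Kan F n).
Local Notation "v '<*' a" := (@bm_r F (Kan F n) V v a) (at level 45, left associativity).
Local Notation X := (@kX F n).
Local Notation Y := (@kY F n).
Local Notation D := (@kD F n).
Local Notation Q := (@Q F n V n_ge2).
Local Notation T := (fun v : V => v <* D <* D).
Implicit Types (v w m : V) (f g : G) (i j : 'I_n).

Let rlin a := bm_r_linearl jV a.
Let r0 a : (0 : V) <* a = 0. Proof. exact: (lin0 (rlin a)). Qed.

Let T_lin : linear T.
Proof. by move=> k u v; rewrite !(rlin _). Qed.

(** The coordinate along the vacuum of an element of the span: [Q (v <* D)] drops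
    the barred part, and the product by [etop] all but the constant term of the rest. *)
Lemma vacspan_poly m v : is_vacuum n_ge2 m -> vacspan m v ->
  exists p, Q (v <* D) <* kG (etop F n) = pact T p (T (m <* kG (etop F n))).
Proof.
move=> vm; have vTm := vacuum_T char2 jV uV vm; have [qTm _] := vTm.
have QL := Q_linear n_ge2 jV.
elim=> [x|u _ [p IH]|k u w _ [p IHp] _ [q IHq]].
- exists ((x.1 set0)%:P); rewrite pactC vacmap_D // (linD QL).
  have -> : Q (m <* D <* D <* D <* D <* kG x.2) = 0.
    by apply: ker_kG => //; have [] := vacuum_T char2 jV uV vTm.
  rewrite addr0 /vacmap /= (lin0 (@kG_linear F n)) (lin0 (bm_r_linear jV _)) add0r.
  rewrite (QD n_ge2 jV uV) (ker_kG char2 jV uV iV _ qTm) r0 subr0.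
  rewrite (r_kG_mul char2 n_ge2 jV uV iV) mul_etop (linZ (@kG_linear F n)) (linZ (bm_r_linear jV _)).
  by rewrite -!DD_central.
- exists ('X * p); rewrite pactX (pactT T_lin) -IH /=.
  rewrite (QD n_ge2 jV uV (u <* D <* D)) (QD n_ge2 jV uV (u <* D)) (linB (rlin D)) subKr.
  by rewrite DD_central.
exists (k *: p + q); rewrite pactL -IHp -IHq (rlin D) QL.
by rewrite (rlin _).
Qed.

(** If D^2 m is not zero, the vacuum [m] lies in the submodule that it generates, so
    that u = p(D^2) D^2 u for a polynomial p and u = m e_1...e_n. Hence D^2 has an
    eigenvector, and as D^2 is central, its eigenspaces are submodules. *)
Lemma T_scalar : exists alpha : F, forall v, v <* D <* D = alpha *: v.
Proof.
have [p [m [hm m0 qm lm]]] := vacuum char2 n_ge2 jV uV iV.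
have vm : is_vacuum n_ge2 m by split.
have eigen_all a w : w <> 0 -> T w = a *: w -> forall v, T v = a *: v.
  move=> w0 wE; pose th v := T v - a *: v.
  have thL : linear th.
    by move=> k u v; rewrite /th T_lin !scalerDr !scalerN !scalerA mulrC; zmod.
  have th_r c v : th v = 0 -> th (v <* c) = 0.
    by move=> tv; rewrite /th DD_central // -(linZ (rlin c)) -(linB (rlin c)) -/(th v) tv r0.
  have th_pr b v : th v = 0 -> th (bm_pr b v) = 0.
    have prD c u : bm_pr c u <* D = bm_pr (~~ c) (u <* D).
      by rewrite (bm_r_bm_pr jV _ _ (hA_kD F n)) /= negbK.
    rewrite /th !prD negbK -(linZ (bm_pr_linear jV b)) -(linB (bm_pr_linear jV b)) => ->.
    exact: (lin0 (bm_pr_linear jV b)).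
  case: (ker_dichotomy jV iV thL th_pr th_r) => [inj|th0 v].
    by case: w0; apply: inj; rewrite /th wE subrr.
  by apply/eqP; rewrite -subr_eq0; apply/eqP; exact: th0.
have [Tm|/eqP Tm] := eqVneq (T m) 0.
  by exists 0; apply: (eigen_all 0 m); rewrite // scale0r.
pose u := m <* kG (etop F n).
have u0 : u <> 0 by move=> /(vacuum_gbas char2 jV uV iV vm).
have Sm : vacspan m m.
  have [_ irr] := iV; case: (irr _ (vacspan_graded char2 jV uV iV hm vm)) => // S0.
  case: Tm; apply: S0; have := VacMap m (1, 0).
  by rewrite /vacmap /= r_one // (lin0 (@kG_linear F n)) (lin0 (bm_r_linear jV _)) r0 addr0.
have [q qE] := vacspan_poly vm Sm.
rewrite (QD n_ge2 jV uV) qm r0 subr0 -/u in qE.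
have [|||a [w [w0 wE]]] := @eigenvector F V T ((-1) *: ('X * q) + 1%:P) u T_lin.
- apply/eqP => /(congr1 (fun r : {poly F} => r`_0)) /eqP.
  by rewrite coefD coefZ coefXM coefC coef0 mulr0 add0r oner_eq0.
- exact: u0.
- by rewrite pactL pactX pactC -qE scale1r scaleN1r addNr.
by exists a; exact: eigen_all w0 wE.
Qed.

Theorem unital_irreducible_classification : exists alpha : F,
  bimod_iso V (Valpha n alpha) \/ bimod_iso V (op_bimod (Valpha n alpha)).
Proof.
have [alpha TE] := T_scalar; exists alpha.
have [p [m [hm m0 qm lm]]] := vacuum char2 n_ge2 jV uV iV.
have vm : is_vacuum n_ge2 m by split.
pose K := Kalpha n alpha; have jK : jordan_bimod K by exact: Kalpha_jordan.
pose ph : K -> V := vacmap m; have phL : linear ph := vacmap_linear jV m.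
have phX i : intertwines ph (X i).
  by move=> x; rewrite /ph (vacmap_X char2 n_ge2 jV uV iV) kalX.
have phY i : intertwines ph (Y i).
  by move=> x; rewrite /ph (vacmap_Y char2 jV uV iV _ _ vm) kalY.
have phD : intertwines ph D.
  move=> x; rewrite /ph (vacmap_D char2 jV) kalD TE /vacmap /=.
  rewrite (lin0 (@kG_linear F n)) (lin0 (bm_r_linear jV _)) add0r addrC.
  by rewrite (linZ (rlin _)) (linZ (@kG_linear F n)) (linZ (bm_r_linear jV _)).
have ph_r a : intertwines ph a.
  elim/kan_generated: a => // [k a b|q r t a b c||i j].
  - exact: (intertwines_linear jK jV phL).
  - exact: (intertwines_mul jK jV phL).
  - by move=> x; rewrite (r_one uV) kalG !mulr1 gpar1 mulr1; case: x.
  move=> x; rewrite (HE char2 n_ge2 jV uV iV) -!phX !kalX kalG /= gparM !gpar_gen.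
  by rewrite mulrNN mulNr opprK !mulrA.
have ph_pr b (x : K) : ph (bm_pr b x) = bm_pr (p (+) b) (ph x).
  by rewrite /ph (vacmap_pr jV _ _ hm) addKb.
have ph_inj x : ph x = 0 -> x = 0.
  have [_ irr] := Kalpha_irreducible alpha (ltnW n_ge2).
  have [|inj|all0] := irr (fun x => ph x = 0).
  - apply: graded_rightsub => //; first exact: (lin0 phL).
    + by move=> c u v hu hv; rewrite phL hu hv scaler0 addr0.
    + by move=> b v hv; rewrite ph_pr hv (lin0 (bm_pr_linear jV _)).
    by move=> a v hv; rewrite ph_r hv r0.
  - exact: inj.
  case: m0; have := all0 (1, 0); rewrite /ph /vacmap /= (r_one uV).
  by rewrite (lin0 (@kG_linear F n)) (lin0 (bm_r_linear jV _)) r0 addr0.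
have ph_surj v : exists x, ph x == v.
  have [_ irr] := iV; have [|no|] := irr (fun v => exists x, ph x == v).
  - apply: graded_rightsub => //.
    + by exists 0; rewrite (lin0 phL).
    + move=> c u w [x /eqP<-] [y /eqP<-]; exists (c *: x + y); by rewrite phL.
    + by move=> b u [x /eqP<-]; exists (bm_pr (p (+) b) x); rewrite ph_pr addKb.
    by move=> a u [x /eqP<-]; exists (bm_r x a); rewrite ph_r.
  - case: m0; apply: no; exists (1, 0); rewrite /ph /vacmap /= (r_one uV).
    by rewrite (lin0 (@kG_linear F n)) (lin0 (bm_r_linear jV _)) r0 addr0.
  exact.
pose ps v := xchoose (ph_surj v).
have psK : cancel ps ph by move=> v; apply/eqP; exact: xchooseP (ph_surj v).
have phI : injective ph.
  by move=> x y E; apply/eqP; rewrite -subr_eq0; apply/eqP/ph_inj; rewrite (linB phL) E subrr.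
have phK : cancel ph ps by move=> x; apply: phI; rewrite psK.
have psL : linear ps by move=> c u v; apply: phI; rewrite phL !psK.
have ps_pr b v : ps (bm_pr b v) = bm_pr (p (+) b) (ps v).
  by apply: phI; rewrite ph_pr !psK addKb.
have ps_r a v : ps (v <* a) = bm_r (ps v) a by apply: phI; rewrite ph_r !psK.
have [st1 st1K stK1] := kstar_bij F n.
have fbij : bijective (fun v => kstar (ps v)).
  exists (fun z => ph (st1 z)) => [v|z]; last by rewrite phK stK1.
  by rewrite st1K psK.
have := @right_iso _ _ V (Valpha n alpha) jV (Valpha_jordan n alpha) p (fun v => kstar (ps v)).
case: (p) ps_pr => ps_pr iso; [right | left]; apply: iso => //.
all: try by move=> c u v; rewrite psL kstar_linear.
all: try by move=> b v; rewrite ps_pr /= V_pr_star.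
all: by move=> a v; rewrite ps_r /= V_r_star.
Qed.

End Classification.

Lemma Valpha_unital_irreducible (F : fieldType) n (alpha : F) : (0 < n)%N ->
  unital_bimod (Valpha n alpha) /\ irreducible_bimod (Valpha n alpha).
Proof.
move=> n0; split; [apply: (@unital_bimod_transport _ _ (Kalpha n alpha) (Valpha n alpha) (@kstar F n))
  | apply: (@irreducible_bimod_transport _ _ (Kalpha n alpha) (Valpha n alpha) (@kstar F n))].
all: try exact: kstar_linear.
all: try exact: kstar_bij.
all: try by move=> b x; rewrite /= V_pr_star.
all: try by move=> a x; rewrite /= V_l_star.
all: try by move=> a x; rewrite /= V_r_star.
- exact: Kalpha_unital.
exact: Kalpha_irreducible.
Qed.

Theorem theorem6p4 (F : closedFieldType) (charF : 2%N \notin [pchar F])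
    (n : nat) (n_ge2 : (2 <= n)%N) :
  (forall alpha : F,
     [/\ jordan_bimod (Valpha n alpha),
         unital_bimod (Valpha n alpha)
       & irreducible_bimod (Valpha n alpha)])
  /\
  (forall V : superbimod (Kan F n),
     jordan_bimod V -> unital_bimod V -> irreducible_bimod V ->
     exists alpha : F,
       bimod_iso V (Valpha n alpha) \/ bimod_iso V (op_bimod (Valpha n alpha))).
Proof.
split=> [alpha|V jV uV iV].
  have [uV iV] := Valpha_unital_irreducible alpha (ltnW n_ge2).
  by split=> //; exact: Valpha_jordan.
by apply: unital_irreducible_classification => //; move: charF; rewrite inE.
Qed.
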